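(* Let $\mathcal P$ be a locally trivial quantum principal fibre bundle whose Hopf algebra $H$ has bijective antipode, and assume a differential structure on $\mathcal P$ is given. Let $D_{l}$ ($D_r$) be a left (right) covariant derivative and $\alpha_{l}$ ($\alpha_r$) a left (right) gauge transformation. Then the map $$D'_{l,r}:=\alpha_{l,r}\circ D_{l,r}\circ\alpha_{l,r}^{-1}$$ is a left (right) covariant derivative.
   Context: Bundles. Algebras are unital and associative over $\mathbb C$. A covering of an algebra $B$ is a finite family $(J_i)_{i\in I}$ of two-sided ideals with $\bigcap_i J_i=0$; $B_i=B/J_i$, $B_{ij}=B/(J_i+J_j)$, with quotient maps $\pi_i:B\to B_i$, $\pi^i_j:B_i\to B_{ij}$. It is complete if $b\mapsto(\pi_i(b))_i$ maps $B$ onto $\{(b_i)\mid \pi^i_j(b_i)=\pi^j_i(b_j)\}$. A locally trivial quantum principal fibre bundle consists of an algebra $B$ with complete covering $(J_i)_{i\in I}$, a Hopf algebra $H$, a right $H$-comodule algebra $\mathcal P$ with coaction $\Delta_{\mathcal P}$, an injective homomorphism $\iota:B\to\mathcal P$, and surjective homomorphisms $\chi_i:\mathcal P\to B_i\otimes H$ with $\chi_i(\iota(b))=\pi_i(b)\otimes 1$, $(\chi_i\otimes id)\circ\Delta_{\mathcal P}=(id\otimes\Delta)\circ\chi_i$, and $(\ker\chi_i)_i$ a complete covering of $\mathcal P$. Gauge transformations. A left (right) gauge transformation on $B_i\otimes H$ is an isomorphism $\alpha$ of left (right) $(B_i\otimes1)$-modules with $(\alpha\otimes id)(id\otimes\Delta)=(id\otimes\Delta)\alpha$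 and $\alpha(a\otimes1)=a\otimes1$. A left (right) gauge transformation on $\mathcal P$ is an isomorphism $\alpha:\mathcal P\to\mathcal P$ of left (right) $\iota(B)$-modules such that for all $i$ there is a left (right) gauge transformation $\alpha_i$ on $B_i\otimes H$ with $\chi_i\circ\alpha=\alpha_i\circ\chi_i$. Such $\alpha$ correspond bijectively to linear maps $g_\alpha:H\to\mathcal P$ with $g_\alpha(1)=1$ and: (left) $\alpha_l(f)=\sum f_0g_{\alpha_l}(f_1)$, $\Delta_{\mathcal P}(g_{\alpha_l}(h))=\sum g_{\alpha_l}(h_2)\otimes S(h_1)h_3$, $\sum g_{\alpha_l}(h_1)g_{\alpha_l^{-1}}(h_2)=\sum g_{\alpha_l^{-1}}(h_1)g_{\alpha_l}(h_2)=\varepsilon(h)1$; (right) $\alpha_r(f)=\sum g_{\alpha_r}(f_1)f_0$, $\Delta_{\mathcal P}(g_{\alpha_r}(h))=\sum g_{\alpha_r}(h_2)\otimes h_3S^{-1}(h_1)$, $\sum g_{\alpha_r}(h_2)g_{\alpha_r^{-1}}(h_1)=\sum g_{\alpha_r^{-1}}(h_2)g_{\alpha_r}(h_1)=\varepsilon(h)1$. Here $\Delta_{\mathcal P}(f)=\sum f_0\otimes f_1$. Differential structures. A differential algebra $\Gamma(A)$ over an algebra $A$ is a differential graded algebra with $\Gamma^0(A)=A$ generated by $A$ and $dA$, i.e. a quotient of the universal one $\Omega(A)$. Given differential algebras $\Gamma(B_i)$ and a right covariant differential algebra $\Gamma(H)$, let $J_i(\mathcal P)$ be the kernel of the map $\Omega(\mathcal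 P)\to\Gamma(B_i)\hat\otimes\Gamma(H)$ (graded tensor product) induced by $\chi_i$. The differential structure on $\mathcal P$ is $\Gamma(\mathcal P)=\Omega(\mathcal P)/\bigcap_iJ_i(\mathcal P)$. Let $\chi_{i_\Gamma}:\Gamma(\mathcal P)\to\Gamma(B_i)\hat\otimes\Gamma(H)$ be the induced surjections, $K_i$ their kernels. $\Gamma_c(\mathcal P)$ is the algebra of families $(\gamma_i)_i$, $\gamma_i\in\Gamma(B_i)\hat\otimes\Gamma(H)\cong\Gamma(\mathcal P)/K_i$, such that $\gamma_i,\gamma_j$ have equal image in $\Gamma(\mathcal P)/(K_i+K_j)$; it is a differential graded algebra containing $\Gamma(\mathcal P)$, $\Gamma^0_c(\mathcal P)=\mathcal P$, and $\chi_{i_\Gamma}$ extends to it as $i$-th projection. $hor\,\Gamma_c(\mathcal P)=\{\gamma\mid\chi_{i_\Gamma}(\gamma)\in\Gamma(B_i)\hat\otimes H\ \forall i\}$, with right coaction $\gamma\mapsto\sum\gamma_0\otimes\gamma_1\in hor\,\Gamma_c(\mathcal P)\otimes H$ extending $\Delta_{\mathcal P}$, given locally by $id\otimes\Delta$. $\Gamma_m(B)=\{\gamma\in\Gamma_c(\mathcal P)\mid\chi_{i_\Gamma}(\gamma)\in\Gamma(B_i)\hat\otimes1\ \forall i\}$ (a differential subalgebra). Gauge transformations act bijectively on $hor\,\Gamma_c(\mathcal P)$ by $\alpha_l(\gamma)=\sum\gamma_0g_{\alpha_l}(\gamma_1)$, $\alpha_r(\gamma)=\sum g_{\alpha_r}(\gamma_1)\gamma_0$.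 A left (right) covariant derivative is a linear map $D$ of degree $1$ on $hor\,\Gamma_c(\mathcal P)$ with $D(1)=0$, commuting with the coaction, $D(\ker\chi_{i_\Gamma}\cap hor\,\Gamma_c(\mathcal P))\subset\ker\chi_{i_\Gamma}$ for all $i$, and $D(\rho\gamma)=(d\rho)\gamma+(-1)^n\rho D(\gamma)$ for $\rho\in\Gamma^n_m(B)$ (left), respectively $D(\gamma\rho)=D(\gamma)\rho+(-1)^n\gamma\,d\rho$ for $\gamma$ of degree $n$ and $\rho\in\Gamma_m(B)$ (right). *)

(* Defs.v *)
From HB Require Import structures.
From mathcomp Require Import all_boot all_order all_algebra.
From mathcomp Require Import boolp classical_sets functions.

Set Implicit Arguments.
Unset Strict Implicit.
Unset Printing Implicit Defensive.

Import GRing.Theory.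
Local Open Scope quotient_scope.
Local Open Scope ring_scope.

(* The library's [algType] excludes the zero algebra, which
   is allowed here (B_i = B / J_i may vanish, and B / (J_i + J_j) often does);
   hence a separate notion of algebra, on top of [lmodType] and [pzRingType]. *)
Record alg (k : fieldType) := Alg {
  alg_mod : lmodType k;
  alg_one : alg_mod;
  alg_mul : alg_mod -> alg_mod -> alg_mod;
  alg_mulA : associative alg_mul;
  alg_mul1 : left_id alg_one alg_mul;
  alg_mulr1 : right_id alg_one alg_mul;
  alg_mulDl : left_distributive alg_mul +%R;
  alg_mulDr : right_distributive alg_mul +%R;
  alg_scaleAl : forall (c : k) x y, c *: alg_mul x y = alg_mul (c *: x) y;
  alg_scaleAr : forall (c : k) x y, c *: alg_mul x y = alg_mul x (c *: y)
}.
Definition alg_car k (A : alg k) : Type := alg_mod A.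
Arguments alg_car : simpl never.
Coercion alg_car : alg >-> Sortclass.

Section AlgInstances.
Variables (k : fieldType) (A : alg k).
HB.instance Definition _ := GRing.Lmodule.copy (alg_car A) (alg_mod A).
HB.instance Definition _ := GRing.Zmodule_isPzRing.Build (alg_car A)
  (@alg_mulA _ A) (@alg_mul1 _ A) (@alg_mulr1 _ A)
  (@alg_mulDl _ A) (@alg_mulDr _ A).
Lemma ascalerAl (c : k) (x y : A) : c *: (x * y) = (c *: x) * y.
Proof. exact: (@alg_scaleAl _ A). Qed.
Lemma ascalerAr (c : k) (x y : A) : c *: (x * y) = x * (c *: y).
Proof. exact: (@alg_scaleAr _ A). Qed.
End AlgInstances.

Record alghom (k : fieldType) (A B : alg k) := AlgHom {
  alghom_fun :> A -> B;
  alghom_linear : linear alghom_fun;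
  alghom_monoid : monoid_morphism alghom_fun
}.


Definition bilin (k : fieldType) (V W Z : lmodType k) (f : V -> W -> Z) : Prop :=
  (forall w, linear (f^~ w)) /\ (forall v, linear (f v)).

Section LinearFacts.
Variables (k : fieldType) (U V : lmodType k) (f : U -> V).
Hypothesis f_lin : linear f.
Lemma lin0 : f 0 = 0.
Proof. by have := f_lin (-1) 0 0; rewrite scaler0 addr0 scaleN1r addNr. Qed.
Lemma linD x y : f (x + y) = f x + f y.
Proof. by have := f_lin 1 x y; rewrite !scale1r. Qed.
Lemma linZ c x : f (c *: x) = c *: f x.
Proof. by have := f_lin c x 0; rewrite lin0 !addr0. Qed.
Lemma linN x : f (- x) = - f x.
Proof. by rewrite -scaleN1r linZ scaleN1r. Qed.
Lemma linB x y : f (x - y) = f x - f y.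
Proof. by rewrite linD linN. Qed.
Lemma lin_sum (I : Type) (r : seq I) (P : pred I) (F : I -> U) :
  f (\sum_(i <- r | P i) F i) = \sum_(i <- r | P i) f (F i).
Proof. exact: (big_morph f linD lin0). Qed.
End LinearFacts.

Section AlgHomFacts.
Variables (k : fieldType) (A B : alg k) (f : alghom A B).
Lemma ah0 : f 0 = 0. Proof. exact: lin0 (alghom_linear f). Qed.
Lemma ahD x y : f (x + y) = f x + f y. Proof. exact: linD (alghom_linear f) _ _. Qed.
Lemma ahB x y : f (x - y) = f x - f y. Proof. exact: linB (alghom_linear f) _ _. Qed.
Lemma ahP c x y : f (c *: x + y) = c *: f x + f y. Proof. exact: alghom_linear. Qed.
Lemma ah1 : f 1 = 1. Proof. exact: (alghom_monoid f).1. Qed.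
Lemma ahM x y : f (x * y) = f x * f y. Proof. exact: (alghom_monoid f).2. Qed.
End AlgHomFacts.

Lemma lin_id (k : fieldType) (U : lmodType k) : linear (@id U).
Proof. by []. Qed.
Lemma lin_comp (k : fieldType) (U V W : lmodType k) (g : V -> W) (f : U -> V) :
  linear g -> linear f -> linear (g \o f).
Proof. by move=> lg lf a u v /=; rewrite lf lg. Qed.

(* V (x) W: formal sums of pairs, identified when every bilinear map takes
   the same value on them; [tlift] is the resulting universal property. *)
Section Tensor.
Variables (k : fieldType) (V W : lmodType k).

Definition fsum (Z : lmodType k) (f : V -> W -> Z) (s : seq (V * W)) : Z :=
  \sum_(p <- s) f p.1 p.2.

Definition teqv (s t : seq (V * W)) : bool :=
  `[< forall (Z : lmodType k) (f : V -> W -> Z), bilin f -> fsum f s = fsum f t >].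

Lemma teqv_refl : reflexive teqv.
Proof. by move=> s; apply/asboolP. Qed.
Lemma teqv_sym : symmetric teqv.
Proof.
by move=> s t; apply/idP/idP => /asboolP h; apply/asboolP => Z f /h ->.
Qed.
Lemma teqv_trans : transitive teqv.
Proof.
move=> s t u /asboolP h1 /asboolP h2; apply/asboolP => Z f bf.
by rewrite h1 // h2.
Qed.
Canonical teqv_equiv := EquivRel teqv teqv_refl teqv_sym teqv_trans.

Definition tens := {eq_quot teqv}.
HB.instance Definition _ := Choice.on tens.
HB.instance Definition _ := EqQuotient.on tens.

Definition tpure (v : V) (w : W) : tens := \pi_tens [:: (v, w)].

(* the linear map V (x) W -> Z induced by f (when f is bilinear) *)
Definition tlift (Z : lmodType k) (f : V -> W -> Z) (x : tens) : Z :=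
  fsum f (repr x).

Lemma tlift_pi (Z : lmodType k) (f : V -> W -> Z) s :
  bilin f -> tlift f (\pi_tens s) = fsum f s.
Proof.
move=> bf; rewrite /tlift.
have /asboolP h : teqv (repr (\pi_tens s)) s.
  by have /eqmodP := reprK (\pi_tens s).
exact: h.
Qed.

Lemma tens_ext (x y : tens) :
  (forall (Z : lmodType k) (f : V -> W -> Z), bilin f -> tlift f x = tlift f y) ->
  x = y.
Proof.
move=> h; rewrite -[x]reprK -[y]reprK; apply/eqmodP/asboolP => Z f bf.
by rewrite -!tlift_pi // !reprK; apply: h.
Qed.

Definition tadd (x y : tens) : tens := \pi_tens (repr x ++ repr y).
Definition tscale (c : k) (x : tens) : tens :=
  \pi_tens [seq (c *: p.1, p.2) | p <- repr x].
Definition topp (x : tens) : tens := tscale (-1) x.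
Definition tzero : tens := \pi_tens [::].

Lemma tlift0 (Z : lmodType k) (f : V -> W -> Z) : bilin f -> tlift f tzero = 0.
Proof. by move=> bf; rewrite tlift_pi // /fsum big_nil. Qed.
Lemma tliftD (Z : lmodType k) (f : V -> W -> Z) x y :
  bilin f -> tlift f (tadd x y) = tlift f x + tlift f y.
Proof. by move=> bf; rewrite tlift_pi // /fsum big_cat. Qed.
Lemma tliftZ (Z : lmodType k) (f : V -> W -> Z) c x :
  bilin f -> tlift f (tscale c x) = c *: tlift f x.
Proof.
move=> bf; rewrite tlift_pi // /fsum big_map scaler_sumr.
by apply: eq_bigr => p _; rewrite (linZ (bf.1 p.2)).
Qed.
Lemma tliftN (Z : lmodType k) (f : V -> W -> Z) x :
  bilin f -> tlift f (topp x) = - tlift f x.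
Proof. by move=> bf; rewrite tliftZ // scaleN1r. Qed.

Lemma taddA : associative tadd.
Proof. by move=> x y z; apply: tens_ext => Z f bf; rewrite !tliftD ?addrA. Qed.
Lemma taddC : commutative tadd.
Proof. by move=> x y; apply: tens_ext => Z f bf; rewrite !tliftD // addrC. Qed.
Lemma tadd0 : left_id tzero tadd.
Proof. by move=> x; apply: tens_ext => Z f bf; rewrite tliftD // tlift0 ?add0r. Qed.
Lemma taddN : left_inverse tzero topp tadd.
Proof.
by move=> x; apply: tens_ext => Z f bf; rewrite tliftD // tliftN // tlift0 ?addNr.
Qed.
HB.instance Definition _ := GRing.isZmodule.Build tens taddA taddC tadd0 taddN.

Lemma tscaleA a b x : tscale a (tscale b x) = tscale (a * b) x.
Proof. by apply: tens_ext => Z f bf; rewrite !tliftZ // scalerA. Qed.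
Lemma tscale1 : left_id 1 tscale.
Proof. by move=> x; apply: tens_ext => Z f bf; rewrite tliftZ // scale1r. Qed.
Lemma tscaleDr : right_distributive tscale +%R.
Proof.
move=> c x y; apply: tens_ext => Z f bf.
by rewrite tliftZ // !tliftD // !tliftZ // scalerDr.
Qed.
Lemma tscaleDl x : {morph tscale^~ x : a b / a + b}.
Proof.
move=> a b; apply: tens_ext => Z f bf.
by rewrite tliftZ // tliftD // !tliftZ // scalerDl.
Qed.
HB.instance Definition _ :=
  GRing.Zmodule_isLmodule.Build k tens tscaleA tscale1 tscaleDr tscaleDl.

Lemma tlift_linear (Z : lmodType k) (f : V -> W -> Z) :
  bilin f -> linear (tlift f).
Proof. by move=> bf a x y; rewrite -tliftZ // -tliftD. Qed.
Lemma tliftE (Z : lmodType k) (f : V -> W -> Z) v w :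
  bilin f -> tlift f (tpure v w) = f v w.
Proof. by move=> bf; rewrite tlift_pi // /fsum big_seq1. Qed.

Lemma tpure_bilin : bilin tpure.
Proof.
split=> [w a u v|v a u w]; apply: tens_ext => Z f bf;
  rewrite (tlift_linear bf) !tliftE //; [exact: bf.1 | exact: bf.2].
Qed.

Lemma tens_sum (x : tens) : x = \sum_(p <- repr x) tpure p.1 p.2.
Proof.
apply: tens_ext => Z f bf; rewrite (lin_sum (tlift_linear bf)).
by apply: eq_bigr => p _; rewrite tliftE.
Qed.

Lemma tens_ind (P : tens -> Prop) :
  P 0 -> (forall v w, P (tpure v w)) -> (forall x y, P x -> P y -> P (x + y)) ->
  forall x, P x.
Proof. by move=> P0 Pp PD x; rewrite (tens_sum x); apply: big_ind. Qed.

Lemma tens_lin_ext (Z : lmodType k) (f g : tens -> Z) :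
  linear f -> linear g -> (forall v w, f (tpure v w) = g (tpure v w)) -> f =1 g.
Proof.
move=> lf lg h; elim/tens_ind => [|//|x y hx hy]; first by rewrite !lin0.
by rewrite !linD // hx hy.
Qed.

Lemma tlift_unique (Z : lmodType k) (f : V -> W -> Z) : bilin f ->
  exists! g : tens -> Z, linear g /\ (forall v w, g (tpure v w) = f v w).
Proof.
move=> bf; exists (tlift f); split.
  by split=> [|v w]; [exact: tlift_linear | exact: tliftE].
move=> g [lg hg]; apply/funext; apply: tens_lin_ext => //.
  exact: tlift_linear.
by move=> v w; rewrite hg tliftE.
Qed.

(* linearity in the bilinear map: no hypothesis is needed *)
Lemma tlift_linl (Z : lmodType k) (f g : V -> W -> Z) c x :
  tlift (fun v w => c *: f v w + g v w) x = c *: tlift f x + tlift g x.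
Proof. by rewrite /tlift /fsum big_split scaler_sumr. Qed.
Lemma eq_tlift (Z : lmodType k) (f g : V -> W -> Z) x :
  (forall v w, f v w = g v w) -> tlift f x = tlift g x.
Proof. by move=> h; apply: eq_bigr => p _; apply: h. Qed.
End Tensor.

Lemma bilin_tlift (k : fieldType) (U U' V W Z : lmodType k)
    (F : U -> U' -> V -> W -> Z) x :
  (forall v w, bilin (fun a b => F a b v w)) ->
  bilin (fun a b => tlift (F a b) x).
Proof.
move=> h; split=> [b c a a'|a c b b'];
  rewrite -tlift_linl; apply: eq_tlift => v w; [exact: (h v w).1|exact: (h v w).2].
Qed.

Section TensorMap.
Variables (k : fieldType) (V V' W W' : lmodType k).
Definition tmap (f : V -> V') (g : W -> W') : tens V W -> tens V' W' :=
  tlift (fun v w => tpure (f v) (g w)).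
Lemma tmap_bilin (f : V -> V') (g : W -> W') : linear f -> linear g ->
  bilin (fun v w => tpure (f v) (g w)).
Proof.
move=> lf lg; split=> [w a u v|v a u w]; rewrite ?lf ?lg;
  [exact: (tpure_bilin _ _).1|exact: (tpure_bilin _ _).2].
Qed.
Lemma tmap_linear (f : V -> V') (g : W -> W') : linear f -> linear g -> linear (tmap f g).
Proof. by move=> lf lg; apply/tlift_linear/tmap_bilin. Qed.
Lemma tmapE (f : V -> V') (g : W -> W') v w : linear f -> linear g ->
  tmap f g (tpure v w) = tpure (f v) (g w).
Proof. by move=> lf lg; rewrite /tmap tliftE //; apply: tmap_bilin. Qed.
End TensorMap.

(* the canonical isomorphism U (x) (V (x) W) -> (U (x) V) (x) W *)
Definition tassoc (k : fieldType) (U V W : lmodType k)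
  : tens U (tens V W) -> tens (tens U V) W :=
  tlift (fun u => tlift (fun v w => tpure (tpure u v) w)).

Section TensorAlg.
Variables (k : fieldType) (A B : alg k).

Definition tmul (x y : tens A B) : tens A B :=
  tlift (fun (a : A) (b : B) =>
    tlift (fun (a' : A) (b' : B) => tpure (a * a') (b * b')) y) x.

Lemma tmul_bilin4 (a : A) (b : B) :
  bilin (fun (a' : A) (b' : B) => tpure (a * a') (b * b')).
Proof.
split=> [w c u v|v c u w]; rewrite mulrDr -ascalerAr;
  [exact: (tpure_bilin _ _).1|exact: (tpure_bilin _ _).2].
Qed.
Lemma tmul_bilin4' (a' : A) (b' : B) :
  bilin (fun (a : A) (b : B) => tpure (a * a') (b * b')).
Proof.
split=> [w c u v|v c u w]; rewrite mulrDl -ascalerAl;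
  [exact: (tpure_bilin _ _).1|exact: (tpure_bilin _ _).2].
Qed.
Lemma tmul_bilin : bilin tmul.
Proof.
split=> [y|x]; first by apply/tlift_linear/bilin_tlift => *; exact: tmul_bilin4'.
move=> c y z; rewrite /tmul -tlift_linl; apply: eq_tlift => a b.
exact/tlift_linear/tmul_bilin4.
Qed.
Lemma tmulE (a : A) (b : B) (a' : A) (b' : B) :
  tmul (tpure a b) (tpure a' b') = tpure (a * a') (b * b').
Proof.
rewrite /tmul tliftE ?tliftE //; first exact: tmul_bilin4.
by apply: bilin_tlift => *; exact: tmul_bilin4'.
Qed.

Lemma tmulDl : left_distributive tmul +%R.
Proof. by move=> x y z; rewrite (linD (tmul_bilin.1 z)). Qed.
Lemma tmulDr : right_distributive tmul +%R.
Proof. by move=> x y z; rewrite (linD (tmul_bilin.2 x)). Qed.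
Lemma tmul0l x : tmul 0 x = 0. Proof. exact: (lin0 (tmul_bilin.1 x)). Qed.
Lemma tmul0r x : tmul x 0 = 0. Proof. exact: (lin0 (tmul_bilin.2 x)). Qed.
Lemma tmulA : associative tmul.
Proof.
move=> x y z; elim/tens_ind: x => [|a b|x x' hx hx']; first by rewrite !tmul0l.
  elim/tens_ind: y => [|a' b'|y y' hy hy']; first by rewrite !(tmul0r, tmul0l).
    elim/tens_ind: z => [|a'' b''|z z' hz hz']; first by rewrite !tmul0r.
      by rewrite !tmulE !mulrA.
    by rewrite !tmulDr hz hz'.
  by rewrite !(tmulDl, tmulDr) hy hy'.
by rewrite !tmulDl hx hx'.
Qed.
Lemma tmul1l : left_id (tpure (1 : A) (1 : B)) tmul.
Proof.
move=> x; elim/tens_ind: x => [|a b|x y hx hy]; first exact: tmul0r.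
  by rewrite tmulE !mul1r.
by rewrite tmulDr hx hy.
Qed.
Lemma tmul1r : right_id (tpure (1 : A) (1 : B)) tmul.
Proof.
move=> x; elim/tens_ind: x => [|a b|x y hx hy]; first exact: tmul0l.
  by rewrite tmulE !mulr1.
by rewrite tmulDl hx hy.
Qed.
Lemma tscaleAl (c : k) x y : c *: tmul x y = tmul (c *: x) y.
Proof. by rewrite (linZ (tmul_bilin.1 y)). Qed.
Lemma tscaleAr (c : k) x y : c *: tmul x y = tmul x (c *: y).
Proof. by rewrite (linZ (tmul_bilin.2 x)). Qed.

Definition talg : alg k :=
  Alg tmulA tmul1l tmul1r tmulDl tmulDr tscaleAl tscaleAr.
End TensorAlg.

Record ideal (k : fieldType) (A : alg k) := Ideal {
  ideal_car :> A -> Prop;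
  ideal0 : ideal_car 0;
  idealD : forall x y, ideal_car x -> ideal_car y -> ideal_car (x + y);
  idealMl : forall a x, ideal_car x -> ideal_car (a * x);
  idealMr : forall a x, ideal_car x -> ideal_car (x * a)
}.

Section IdealFacts.
Variables (k : fieldType) (A : alg k) (J : ideal A).
Lemma idealZ (c : k) x : J x -> J (c *: x).
Proof. by move=> Jx; rewrite -[x]mul1r ascalerAl; apply: idealMl. Qed.
Lemma idealN x : J x -> J (- x).
Proof. by move=> Jx; rewrite -scaleN1r; apply: idealZ. Qed.
Lemma idealB x y : J x -> J y -> J (x - y).
Proof. by move=> Jx Jy; apply: idealD => //; apply: idealN. Qed.
End IdealFacts.

Section IdealConstructions.
Variables (k : fieldType) (A : alg k).

Definition ker_ideal (B : alg k) (f : alghom A B) : ideal A.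
Proof.
refine (@Ideal _ A (fun x => f x = 0) _ _ _ _).
- exact: ah0.
- by move=> x y hx hy; rewrite ahD hx hy addr0.
- by move=> a x hx; rewrite ahM hx mulr0.
- by move=> a x hx; rewrite ahM hx mul0r.
Defined.

Definition add_ideal (J K : ideal A) : ideal A.
Proof.
refine (@Ideal _ A (fun x => exists y z, [/\ J y, K z & x = y + z]) _ _ _ _).
- by exists 0, 0; split; rewrite ?addr0 //; apply: ideal0.
- move=> x x' [y [z [Jy Kz ->]]] [y' [z' [Jy' Kz' ->]]].
  exists (y + y'), (z + z'); split; [exact: idealD|exact: idealD|exact: addrACA].
- move=> a x [y [z [Jy Kz ->]]]; exists (a * y), (a * z).
  by split; rewrite ?mulrDr //; apply: idealMl.
- move=> a x [y [z [Jy Kz ->]]]; exists (y * a), (z * a).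
  by split; rewrite ?mulrDl //; apply: idealMr.
Defined.

Definition bigcap_ideal (I : Type) (J : I -> ideal A) : ideal A.
Proof.
refine (@Ideal _ A (fun x => forall i, J i x) _ _ _ _).
- by move=> i; apply: ideal0.
- by move=> x y hx hy i; apply: idealD.
- by move=> a x hx i; apply: idealMl.
- by move=> a x hx i; apply: idealMr.
Defined.
End IdealConstructions.

Section Quotient.
Variables (k : fieldType) (A : alg k) (J : ideal A).

Definition quo_eqv (x y : A) : bool := `[< J (x - y) >].
Lemma quo_eqv_refl : reflexive quo_eqv.
Proof. by move=> x; apply/asboolP; rewrite subrr; apply: ideal0. Qed.
Lemma quo_eqv_sym : symmetric quo_eqv.
Proof.
by move=> x y; apply/idP/idP => /asboolP h; apply/asboolP;
  rewrite -opprB; apply: idealN.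
Qed.
Lemma quo_eqv_trans : transitive quo_eqv.
Proof.
move=> y x z /asboolP h1 /asboolP h2; apply/asboolP.
by rewrite -(subrKA y); apply: idealD.
Qed.
Canonical quo_equiv := EquivRel quo_eqv quo_eqv_refl quo_eqv_sym quo_eqv_trans.

Definition quo_car := {eq_quot quo_eqv}.
HB.instance Definition _ := Choice.on quo_car.
HB.instance Definition _ := EqQuotient.on quo_car.

Let p (x : A) : quo_car := \pi_quo_car x.
Lemma quo_eq (x y : A) : \pi_quo_car x = \pi_quo_car y <-> J (x - y).
Proof. by split=> [/eqmodP/asboolP|h]; last exact/eqmodP/asboolP. Qed.
Lemma quo_repr (x : A) : J (repr (p x) - x).
Proof. by apply/quo_eq; rewrite reprK. Qed.

Let qadd (x y : quo_car) := p (repr x + repr y).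
Let qopp (x : quo_car) := p (- repr x).
Let qscale (c : k) (x : quo_car) := p (c *: repr x).
Let qmul (x y : quo_car) := p (repr x * repr y).

Let qaddE x y : qadd (p x) (p y) = p (x + y).
Proof.
apply/quo_eq; rewrite opprD addrACA; apply: idealD; exact: quo_repr.
Qed.
Let qoppE x : qopp (p x) = p (- x).
Proof. by apply/quo_eq; rewrite -opprD; apply/idealN/quo_repr. Qed.
Let qscaleE c x : qscale c (p x) = p (c *: x).
Proof. by apply/quo_eq; rewrite -scalerBr; apply/idealZ/quo_repr. Qed.
Let qmulE x y : qmul (p x) (p y) = p (x * y).
Proof.
apply/quo_eq; rewrite -(subrKA (x * repr (p y))) -mulrBl -mulrBr.
by apply: idealD; [apply: idealMr|apply: idealMl]; apply: quo_repr.
Qed.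
Let pE (x : quo_car) : x = p (repr x). Proof. by rewrite /p reprK. Qed.

Fact qaddA : associative qadd.
Proof. by move=> x y z; rewrite (pE x) (pE y) (pE z) !qaddE addrA. Qed.
Fact qaddC : commutative qadd.
Proof. by move=> x y; rewrite (pE x) (pE y) !qaddE addrC. Qed.
Fact qadd0 : left_id (p 0) qadd.
Proof. by move=> x; rewrite (pE x) !qaddE add0r. Qed.
Fact qaddN : left_inverse (p 0) qopp qadd.
Proof. by move=> x; rewrite (pE x) qoppE qaddE addNr. Qed.
HB.instance Definition _ := GRing.isZmodule.Build quo_car qaddA qaddC qadd0 qaddN.

Let pD x y : p x + p y = p (x + y).
Proof. exact: qaddE. Qed.

Fact qscaleA a b x : qscale a (qscale b x) = qscale (a * b) x.
Proof. by rewrite (pE x) !qscaleE scalerA. Qed.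
Fact qscale1 : left_id 1 qscale.
Proof. by move=> x; rewrite (pE x) qscaleE scale1r. Qed.
Fact qscaleDr : right_distributive qscale +%R.
Proof.
by move=> c x y; rewrite (pE x) (pE y) pD !qscaleE pD scalerDr.
Qed.
Fact qscaleDl x : {morph qscale^~ x : a b / a + b}.
Proof. by move=> a b; rewrite (pE x) !qscaleE pD scalerDl. Qed.
HB.instance Definition _ :=
  GRing.Zmodule_isLmodule.Build k quo_car qscaleA qscale1 qscaleDr qscaleDl.

Let pZ c x : c *: p x = p (c *: x).
Proof. exact: qscaleE. Qed.

Fact qmulA : associative qmul.
Proof. by move=> x y z; rewrite (pE x) (pE y) (pE z) !qmulE mulrA. Qed.
Fact qmul1l : left_id (p 1) qmul.
Proof. by move=> x; rewrite (pE x) !qmulE mul1r. Qed.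
Fact qmul1r : right_id (p 1) qmul.
Proof. by move=> x; rewrite (pE x) !qmulE mulr1. Qed.
Fact qmulDl : left_distributive qmul +%R.
Proof.
by move=> x y z; rewrite (pE x) (pE y) (pE z) pD !qmulE pD mulrDl.
Qed.
Fact qmulDr : right_distributive qmul +%R.
Proof.
by move=> z x y; rewrite (pE x) (pE y) (pE z) pD !qmulE pD mulrDr.
Qed.
Fact qscaleAl (c : k) x y : c *: qmul x y = qmul (c *: x) y.
Proof.
by rewrite (pE x) (pE y) qmulE !pZ qmulE ascalerAl.
Qed.
Fact qscaleAr (c : k) x y : c *: qmul x y = qmul x (c *: y).
Proof.
by rewrite (pE x) (pE y) qmulE !pZ qmulE ascalerAr.
Qed.
Definition quo : alg k :=
  Alg qmulA qmul1l qmul1r qmulDl qmulDr qscaleAl qscaleAr.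

Fact quo_pi_linear : linear (fun x : A => \pi_quo_car x : quo).
Proof.
by move=> c x y; rewrite -[LHS]pD -pZ.
Qed.
Fact quo_pi_monoid : monoid_morphism (fun x : A => \pi_quo_car x : quo).
Proof. by split=> // x y; rewrite -[LHS]qmulE. Qed.
Definition quo_pi : alghom A quo := AlgHom quo_pi_linear quo_pi_monoid.

Definition quo_repr_of (x : quo) : A := repr (x : quo_car).
Lemma quo_repr_ofK x : quo_pi (quo_repr_of x) = x.
Proof. exact: reprK. Qed.
Lemma quo_piP (x y : A) : quo_pi x = quo_pi y <-> J (x - y).
Proof. exact: quo_eq. Qed.
End Quotient.

(* the map A/J -> C induced by f : A -> C (for J contained in ker f) *)
Section QuotientLift.
Variables (k : fieldType) (A C : alg k) (J : ideal A) (f : alghom A C).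
Hypothesis hJ : forall x, J x -> f x = 0.
Definition quo_lift_fun (x : quo J) : C := f (quo_repr_of x).
Lemma quo_lift_funE x : quo_lift_fun (quo_pi J x) = f x.
Proof.
apply/eqP; rewrite -subr_eq0 -ahB; apply/eqP/hJ/quo_piP.
exact: quo_repr_ofK.
Qed.
Fact quo_lift_linear : linear quo_lift_fun.
Proof.
move=> c x y; rewrite -(quo_repr_ofK x) -(quo_repr_ofK y) -ahP.
by rewrite !quo_lift_funE ahP.
Qed.
Fact quo_lift_monoid : monoid_morphism quo_lift_fun.
Proof.
split; first by rewrite -(ah1 (quo_pi J)) quo_lift_funE ah1.
move=> x y; rewrite -(quo_repr_ofK x) -(quo_repr_ofK y) -ahM.
by rewrite !quo_lift_funE ahM.
Qed.
Definition quo_lift : alghom (quo J) C := AlgHom quo_lift_linear quo_lift_monoid.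
End QuotientLift.

(* the canonical map A/J -> A/K (for J contained in K) *)
Definition quo_proj (k : fieldType) (A : alg k) (J K : ideal A) (x : quo J)
  : quo K := quo_pi K (quo_repr_of x).

Record subalg (k : fieldType) (A : alg k) := Subalg {
  subalg_car :> A -> Prop;
  subalg1 : subalg_car 1;
  subalgP : forall (c : k) x y, subalg_car x -> subalg_car y ->
    subalg_car (c *: x + y);
  subalgM : forall x y, subalg_car x -> subalg_car y -> subalg_car (x * y)
}.

Section SubalgType.
Variables (k : fieldType) (A : alg k) (S : subalg A).
Definition subalg_pred : {pred A} := fun x => `[< S x >].
Fact subalg_pred_subring : subring_closed subalg_pred.
Proof.
have h0 : S 0 by rewrite -[0](addNr 1) -scaleN1r; apply: subalgP; apply: subalg1.
split=> [|x y /asboolP Sx /asboolP Sy|x y /asboolP Sx /asboolP Sy]; apply/asboolP.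
- exact: subalg1.
- by rewrite addrC -scaleN1r; apply: subalgP.
- exact: subalgM.
Qed.
Fact subalg_pred_submod : GRing.subsemimod_closed subalg_pred.
Proof.
have h0 : S 0 by rewrite -[0](addNr 1) -scaleN1r; apply: subalgP; apply: subalg1.
split=> [|c x /asboolP Sx]; last by apply/asboolP; rewrite -[c *: x]addr0; apply: subalgP.
split; first exact/asboolP.
by move=> x y /asboolP Sx /asboolP Sy; apply/asboolP; rewrite -[x]scale1r; apply: subalgP.
Qed.

Record subalg_type := SubalgType { subalg_tval : A; _ : subalg_tval \in subalg_pred }.
HB.instance Definition _ := [isSub for subalg_tval].
HB.instance Definition _ := [Choice of subalg_type by <:].
HB.instance Definition _ := 
  GRing.SubChoice_isSubPzRing.Build A subalg_pred subalg_type subalg_pred_subring.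
HB.instance Definition _ := 
  GRing.SubZmodule_isSubLmodule.Build k A subalg_pred subalg_type subalg_pred_submod.

Fact subalg_scaleAl (c : k) (x y : subalg_type) : c *: (x * y) = (c *: x) * y.
Proof. apply: val_inj; exact: ascalerAl. Qed.
Fact subalg_scaleAr (c : k) (x y : subalg_type) : c *: (x * y) = x * (c *: y).
Proof. apply: val_inj; exact: ascalerAr. Qed.
Definition sub_alg : alg k :=
  @Alg k subalg_type 1 *%R (@mulrA _) (@mul1r _) (@mulr1 _) (@mulrDl _) (@mulrDr _)
    subalg_scaleAl subalg_scaleAr.

Definition sub_val (x : sub_alg) : A := subalg_tval x.
Definition sub_mk (x : A) (Sx : S x) : sub_alg := SubalgType (introT (asboolP _) Sx).
Lemma sub_valP (x : sub_alg) : S (sub_val x).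
Proof. by case: x => x /= /asboolP. Qed.
Lemma sub_val_inj : injective sub_val.
Proof. exact: val_inj. Qed.
Lemma sub_mkK x Sx : sub_val (@sub_mk x Sx) = x. Proof. by []. Qed.
Lemma sub_val_linear : linear sub_val. Proof. by []. Qed.
Lemma sub_val_monoid : monoid_morphism sub_val. Proof. by []. Qed.
End SubalgType.

Section Product.
Variables (k : fieldType) (I : Type) (A : I -> alg k).
Definition prod_car : Type := forall i, A i.
HB.instance Definition _ := Choice.copy prod_car (forall i, A i).
Let padd (x y : prod_car) : prod_car := fun i => x i + y i.
Let popp (x : prod_car) : prod_car := fun i => - x i.
Let pzero : prod_car := fun i => 0.
Let pscale (c : k) (x : prod_car) : prod_car := fun i => c *: x i.
Let pmul (x y : prod_car) : prod_car := fun i => x i * y i.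
Let pone : prod_car := fun i => 1.
Let ext (x y : prod_car) : (forall i, x i = y i) -> x = y.
Proof. exact: functional_extensionality_dep. Qed.
Fact paddA : associative padd. Proof. by move=> x y z; apply: ext => i; apply: addrA. Qed.
Fact paddC : commutative padd. Proof. by move=> x y; apply: ext => i; apply: addrC. Qed.
Fact padd0 : left_id pzero padd. Proof. by move=> x; apply: ext => i; apply: add0r. Qed.
Fact paddN : left_inverse pzero popp padd.
Proof. by move=> x; apply: ext => i; apply: addNr. Qed.
HB.instance Definition _ := GRing.isZmodule.Build prod_car paddA paddC padd0 paddN.
Fact pscaleA a b x : pscale a (pscale b x) = pscale (a * b) x.
Proof. by apply: ext => i; apply: scalerA. Qed.
Fact pscale1 : left_id 1 pscale. Proof. by move=> x; apply: ext => i; apply: scale1r. Qed.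
Fact pscaleDr : right_distributive pscale +%R.
Proof. by move=> c x y; apply: ext => i; apply: scalerDr. Qed.
Fact pscaleDl x : {morph pscale^~ x : a b / a + b}.
Proof. by move=> a b; apply: ext => i; apply: scalerDl. Qed.
HB.instance Definition _ :=
  GRing.Zmodule_isLmodule.Build k prod_car pscaleA pscale1 pscaleDr pscaleDl.
Fact pmulA : associative pmul. Proof. by move=> x y z; apply: ext => i; apply: mulrA. Qed.
Fact pmul1l : left_id pone pmul. Proof. by move=> x; apply: ext => i; apply: mul1r. Qed.
Fact pmul1r : right_id pone pmul. Proof. by move=> x; apply: ext => i; apply: mulr1. Qed.
Fact pmulDl : left_distributive pmul +%R.
Proof. by move=> x y z; apply: ext => i; apply: mulrDl. Qed.
Fact pmulDr : right_distributive pmul +%R.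
Proof. by move=> x y z; apply: ext => i; apply: mulrDr. Qed.
Fact pscaleAl (c : k) x y : c *: pmul x y = pmul (c *: x) y.
Proof. by apply: ext => i; apply: ascalerAl. Qed.
Fact pscaleAr (c : k) x y : c *: pmul x y = pmul x (c *: y).
Proof. by apply: ext => i; apply: ascalerAr. Qed.
Definition prod_alg : alg k :=
  Alg pmulA pmul1l pmul1r pmulDl pmulDr pscaleAl pscaleAr.
End Product.

(* The grading is given by the projections [hcomp n] onto its components. *)
Record dga (k : fieldType) := Dga {
  dga_alg :> alg k;
  hcomp : nat -> dga_alg -> dga_alg;
  dif : dga_alg -> dga_alg;
  hcomp_linear : forall n, linear (hcomp n);
  hcomp_proj : forall m n x,
    hcomp m (hcomp n x) = if m == n then hcomp n x else 0;
  hcomp_sum : forall x, exists N : nat, x = \sum_(n < N) hcomp n x;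
  hcomp_one : hcomp 0 1 = 1;
  hcomp_mul : forall m n x y, hcomp m x = x -> hcomp n y = y ->
    hcomp (m + n) (x * y) = x * y;
  dif_linear : linear dif;
  dif_deg : forall n x, hcomp n x = x -> hcomp n.+1 (dif x) = dif x;
  dif_dif : forall x, dif (dif x) = 0;
  dif_mul : forall n x y, hcomp n x = x ->
    dif (x * y) = dif x * y + (-1) ^+ n *: (x * dif y)
}.

Definition homog (k : fieldType) (G : dga k) (n : nat) (x : G) : Prop :=
  hcomp n x = x.

Section DgaFacts.
Variables (k : fieldType) (G : dga k).
Implicit Types x y : G.

Lemma homog_hcomp n x : homog n (hcomp n x).
Proof. by rewrite /homog hcomp_proj eqxx. Qed.
Lemma hcomp_homog m n x : homog n x -> hcomp m x = if m == n then x else 0.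
Proof. by move=> hx; rewrite -{1}hx hcomp_proj hx. Qed.
Lemma hcomp_vanish N x : x = \sum_(n < N) hcomp n x ->
  forall n, (N <= n)%N -> hcomp n x = 0.
Proof.
move=> hx n hn; rewrite hx (lin_sum (hcomp_linear n)).
apply: big1 => i _; rewrite hcomp_proj.
by case: eqP => // e; move: (ltn_ord i); rewrite -e ltnNge hn.
Qed.
Lemma hcomp_sum_widen N M x : (forall n, (N <= n)%N -> hcomp n x = 0) ->
  (N <= M)%N -> \sum_(n < M) hcomp n x = \sum_(n < N) hcomp n x.
Proof.
move=> h le; rewrite -!(big_mkord xpredT (fun n => hcomp n x)).
rewrite (@big_cat_nat _ _ _ N) //= [X in _ + X]big_nat_cond [X in _ + X]big1 ?addr0 //.
by move=> n /andP[/andP[? _] _]; apply: h.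
Qed.
Lemma hcomp_sum_le N x : (forall n, (N <= n)%N -> hcomp n x = 0) ->
  x = \sum_(n < N) hcomp n x.
Proof.
move=> h; have [M hM] := hcomp_sum x; rewrite {1}hM.
rewrite -(hcomp_sum_widen (M := maxn N M) h (leq_maxl _ _)).
by rewrite (hcomp_sum_widen (hcomp_vanish hM) (leq_maxr _ _)).
Qed.

Lemma homog_ind (P : G -> Prop) : P 0 ->
  (forall n x, homog n x -> P x) -> (forall x y, P x -> P y -> P (x + y)) ->
  forall x, P x.
Proof.
move=> P0 Ph PD x; have [N ->] := hcomp_sum x; apply: big_ind => // i _.
exact/Ph/homog_hcomp.
Qed.
Lemma hcompD n x y : hcomp n (x + y) = hcomp n x + hcomp n y.
Proof. exact: (linD (hcomp_linear n)). Qed.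
Lemma hcomp0 n : hcomp n (0 : G) = 0.
Proof. exact: (lin0 (hcomp_linear n)). Qed.
Lemma difD x y : dif (x + y) = dif x + dif y.
Proof. exact: (linD (@dif_linear _ G)). Qed.
Lemma dif0 : dif (0 : G) = 0.
Proof. exact: (lin0 (@dif_linear _ G)). Qed.

Lemma hcomp_difS n x : hcomp n.+1 (dif x) = dif (hcomp n x).
Proof.
elim/homog_ind: x => [|m x hx|x y hx hy].
- by rewrite !(hcomp0, dif0).
- rewrite (hcomp_homog n hx) (hcomp_homog n.+1 (dif_deg hx)) eqSS.
  by case: eqP => // _; rewrite dif0.
- by rewrite difD !hcompD difD hx hy.
Qed.
Lemma hcomp_dif0 x : hcomp 0 (dif x) = 0.
Proof.
elim/homog_ind: x => [|m x hx|x y hx hy].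
- by rewrite dif0 hcomp0.
- by rewrite (hcomp_homog 0 (dif_deg hx)).
- by rewrite difD hcompD hx hy addr0.
Qed.
Lemma hcompM n x y :
  hcomp n (x * y) = \sum_(i < n.+1) hcomp i x * hcomp (n - i) y.
Proof.
elim/homog_ind: x => [|p x hx|x x' hx hx'].
- rewrite mul0r hcomp0 big1 // => i _; by rewrite hcomp0 mul0r.
- elim/homog_ind: y => [|q y hy|y y' hy hy'].
  + rewrite mulr0 hcomp0 big1 // => i _; by rewrite hcomp0 mulr0.
  + rewrite (hcomp_homog n (hcomp_mul hx hy)).
    case: eqP => [->|ne].
      rewrite (bigD1 (inord p : 'I_(p + q).+1)) //= inordK ?ltnS ?leq_addr //.
      rewrite addKn hx hy big1 ?addr0 // => i /eqP ne.
      rewrite (hcomp_homog i hx); case: eqP => [e|_]; last by rewrite mul0r.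
      by case: ne; apply: val_inj; rewrite /= inordK ?ltnS ?leq_addr.
    rewrite big1 // => i _; rewrite (hcomp_homog i hx) (hcomp_homog (n - i) hy).
    case: eqP => [ei|_]; last by rewrite mul0r.
    case: eqP => [ej|_]; last by rewrite mulr0.
    by case: ne; rewrite -ej -ei subnKC // -ltnS.
  + rewrite mulrDr hcompD hy hy' -big_split; apply: eq_bigr => i _ /=.
    by rewrite hcompD mulrDr.
- rewrite mulrDl hcompD hx hx' -big_split; apply: eq_bigr => i _ /=.
  by rewrite hcompD mulrDl.
Qed.

(* \sum_n F n x_n, where x_n is the component of degree n of x *)
Definition hsum (Z : zmodType) (F : nat -> G -> Z) (x : G) : Z :=
  \sum_(n < projT1 (cid (hcomp_sum x))) F n (hcomp n x).

Lemma hsumE (Z : zmodType) (F : nat -> G -> Z) N x : (forall n, F n 0 = 0) ->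
  (forall n, (N <= n)%N -> hcomp n x = 0) ->
  hsum F x = \sum_(n < N) F n (hcomp n x).
Proof.
move=> F0 hN; rewrite /hsum; case: cid => M /= /hcomp_vanish hM.
have w (K L : nat) : (forall n, (K <= n)%N -> hcomp n x = 0) -> (K <= L)%N ->
    \sum_(n < L) F n (hcomp n x) = \sum_(n < K) F n (hcomp n x).
  move=> h le; rewrite -!(big_mkord xpredT (fun n => F n (hcomp n x))).
  rewrite (@big_cat_nat _ _ _ K) //= [X in _ + X]big_nat_cond [X in _ + X]big1 ?addr0 //.
  by move=> n /andP[/andP[? _] _]; rewrite h.
by rewrite -(w M (maxn M N)) ?leq_maxl // -(w N (maxn M N)) ?leq_maxr.
Qed.
Lemma hsum_homog (Z : zmodType) (F : nat -> G -> Z) m x :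
  (forall n, F n 0 = 0) -> homog m x -> hsum F x = F m x.
Proof.
move=> F0 hx; rewrite (@hsumE _ _ m.+1) // => [|n hn]; last first.
  by rewrite (hcomp_homog n hx) gtn_eqF.
rewrite big_ord_recr /= hx big1 ?add0r // => i _.
by rewrite (hcomp_homog i hx) ltn_eqF.
Qed.
Lemma hsum_linear (Z : lmodType k) (F : nat -> G -> Z) :
  (forall n, linear (F n)) -> linear (hsum F).
Proof.
move=> Fl c x y; have F0 n : F n 0 = 0 by apply: lin0.
have [M /hcomp_vanish hM] := hcomp_sum x; have [N /hcomp_vanish hN] := hcomp_sum y.
have hM' n : (maxn M N <= n)%N -> hcomp n x = 0.
  by rewrite geq_max => /andP[/hM].
have hN' n : (maxn M N <= n)%N -> hcomp n y = 0.
  by rewrite geq_max => /andP[_ /hN].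
rewrite !(@hsumE _ _ (maxn M N)) //; last first.
  by move=> n h; rewrite hcomp_linear hM' // hN' // scaler0 addr0.
rewrite scaler_sumr -big_split; apply: eq_bigr => i _ /=.
by rewrite hcomp_linear Fl.
Qed.
Lemma hsum_linl (Z : lmodType k) (F F' : nat -> G -> Z) c x :
  hsum (fun n z => c *: F n z + F' n z) x = c *: hsum F x + hsum F' x.
Proof. by rewrite /hsum scaler_sumr -big_split. Qed.
Lemma eq_hsum (Z : zmodType) (F F' : nat -> G -> Z) x :
  (forall n z, F n z = F' n z) -> hsum F x = hsum F' x.
Proof. by move=> h; apply: eq_bigr => i _; apply: h. Qed.
End DgaFacts.

Lemma sign_eq (R : pzRingType) m n : odd m = odd n -> (-1) ^+ m = (-1) ^+ n :> R.
Proof. by move=> h; rewrite -signr_odd h signr_odd. Qed.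

(* Graded tensor product: for b of degree m and a' of degree n,
     (a (x) b)(a' (x) b') = (-1)^(mn) aa' (x) bb',
   and d(a (x) b) = da (x) b + (-1)^m a (x) db for a of degree m; see
   [gtmulE] and [gtdifE]. *)
Section GradedTensor.
Variables (k : fieldType) (G H : dga k).
Local Notation T := (tens G H).

Definition gtmul_pure (a : G) (b : H) (a' : G) (b' : H) : T :=
  hsum (fun m bm => hsum (fun n an =>
    (-1) ^+ (m * n) *: tpure (a * an) (bm * b')) a') b.
Definition gtmul (x y : T) : T :=
  tlift (fun (a : G) (b : H) => tlift (fun (a' : G) (b' : H) =>
    gtmul_pure a b a' b') y) x.
Definition gthcomp (n : nat) : T -> T :=
  tlift (fun (a : G) (b : H) =>
    \sum_(i < n.+1) tpure (hcomp i a) (hcomp (n - i) b)).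
Definition gtdif : T -> T :=
  tlift (fun (a : G) (b : H) =>
    tpure (dif a) b + hsum (fun m am => (-1) ^+ m *: tpure am (dif b)) a).

Let pl (b : H) : linear (fun a : G => tpure a b) := (tpure_bilin _ _).1 b.
Let pr (a : G) : linear (fun b : H => tpure a b) := (tpure_bilin _ _).2 a.
Let p0l (b : H) : tpure (0 : G) b = 0. Proof. exact: lin0 (pl b). Qed.
Let p0r (a : G) : tpure a (0 : H) = 0. Proof. exact: lin0 (pr a). Qed.
Let pZl c (a : G) (b : H) : tpure (c *: a) b = c *: tpure a b.
Proof. exact: linZ (pl b) c a. Qed.
Let pZr c (a : G) (b : H) : tpure a (c *: b) = c *: tpure a b.
Proof. exact: linZ (pr a) c b. Qed.
Let pDl (a a' : G) (b : H) : tpure (a + a') b = tpure a b + tpure a' b.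
Proof. exact: linD (pl b) a a'. Qed.
Let pDr (a : G) (b b' : H) : tpure a (b + b') = tpure a b + tpure a b'.
Proof. exact: linD (pr a) b b'. Qed.

Fact gt_ind (P : T -> Prop) : P 0 ->
  (forall p q (a : G) (b : H), homog p a -> homog q b -> P (tpure a b)) ->
  (forall x y, P x -> P y -> P (x + y)) -> forall x, P x.
Proof.
move=> P0 Pp PD x; elim/tens_ind: x => // a b.
elim/homog_ind: a => [|p a ha|a a' ha ha']; first by rewrite p0l.
  elim/homog_ind: b => [|q b hb|b b' hb hb']; first by rewrite p0r.
    exact: Pp ha hb.
  by rewrite pDr; apply: PD.
by rewrite pDl; apply: PD.
Qed.

Lemma gtmul_pureE m n (a : G) (b : H) (a' : G) (b' : H) : homog m b -> homog n a' ->
  gtmul_pure a b a' b' = (-1) ^+ (m * n) *: tpure (a * a') (b * b').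
Proof.
move=> hb ha'; rewrite /gtmul_pure (hsum_homog _ hb) => [|i].
  by rewrite (hsum_homog _ ha') // => i; rewrite mulr0 p0l scaler0.
apply: big1 => j _; by rewrite mul0r p0r scaler0.
Qed.
Let gtmul_bilin_r (a : G) (b : H) : bilin (fun (a' : G) (b' : H) => gtmul_pure a b a' b').
Proof.
split=> [b'|a' c u v].
- move=> c u v; rewrite /gtmul_pure -hsum_linl; apply: eq_hsum => m z.
  apply: hsum_linear => n d x y.
  by rewrite mulrDr -ascalerAr pl scalerDr !scalerA mulrC.
- rewrite /gtmul_pure -hsum_linl; apply: eq_hsum => m z.
  rewrite -hsum_linl; apply: eq_hsum => n y.
  by rewrite mulrDr -ascalerAr pr scalerDr !scalerA mulrC.
Qed.
Let gtmul_bilin_l (a' : G) (b' : H) : bilin (fun (a : G) (b : H) => gtmul_pure a b a' b').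
Proof.
split=> [b c u v|a].
- rewrite /gtmul_pure -hsum_linl; apply: eq_hsum => m z.
  rewrite -hsum_linl; apply: eq_hsum => n y.
  by rewrite mulrDl -ascalerAl pl scalerDr !scalerA mulrC.
- apply: hsum_linear => m c x y; rewrite -hsum_linl; apply: eq_hsum => n z.
  by rewrite mulrDl -ascalerAl pr scalerDr !scalerA mulrC.
Qed.
Lemma gtmul_bilin : bilin gtmul.
Proof.
split=> [y|x]; first by apply/tlift_linear/bilin_tlift => *; exact: gtmul_bilin_l.
move=> c y z; rewrite /gtmul -tlift_linl; apply: eq_tlift => a b.
exact/tlift_linear/gtmul_bilin_r.
Qed.
Lemma gtmulE m n (a : G) (b : H) (a' : G) (b' : H) : homog m b -> homog n a' ->
  gtmul (tpure a b) (tpure a' b') = (-1) ^+ (m * n) *: tpure (a * a') (b * b').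
Proof.
move=> hb ha'; rewrite /gtmul tliftE ?tliftE; first exact: gtmul_pureE.
- exact: gtmul_bilin_r.
- by apply: bilin_tlift => *; exact: gtmul_bilin_l.
Qed.

Fact gtmulDl : left_distributive gtmul +%R.
Proof. by move=> x y z; rewrite (linD (gtmul_bilin.1 z)). Qed.
Fact gtmulDr : right_distributive gtmul +%R.
Proof. by move=> x y z; rewrite (linD (gtmul_bilin.2 x)). Qed.
Let gtmul0l x : gtmul 0 x = 0. Proof. exact: (lin0 (gtmul_bilin.1 x)). Qed.
Let gtmul0r x : gtmul x 0 = 0. Proof. exact: (lin0 (gtmul_bilin.2 x)). Qed.
Fact gtscaleAl (c : k) x y : c *: gtmul x y = gtmul (c *: x) y.
Proof. by rewrite (linZ (gtmul_bilin.1 y)). Qed.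
Fact gtscaleAr (c : k) x y : c *: gtmul x y = gtmul x (c *: y).
Proof. by rewrite (linZ (gtmul_bilin.2 x)). Qed.
Fact gtmulA : associative gtmul.
Proof.
move=> x y z; elim/gt_ind: x => [|p q a b ha hb|x x' hx hx'].
- by rewrite !gtmul0l.
- elim/gt_ind: y => [|p' q' a' b' ha' hb'|y y' hy hy'].
  + by rewrite !(gtmul0r, gtmul0l).
  + elim/gt_ind: z => [|p'' q'' a'' b'' ha'' hb''|z z' hz hz'].
    * by rewrite !gtmul0r.
    * rewrite (gtmulE _ _ hb' ha'') (gtmulE _ _ hb ha').
      rewrite -gtscaleAr -gtscaleAl.
      rewrite (gtmulE _ _ hb (hcomp_mul ha' ha'')).
      rewrite (gtmulE _ _ (hcomp_mul hb hb') ha'').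
      rewrite !scalerA -!exprD !mulrA mulnDr mulnDl.
      by rewrite [in LHS]addnC [in RHS]addnA.
    * by rewrite !gtmulDr hz hz'.
  + by rewrite !(gtmulDl, gtmulDr) hy hy'.
- by rewrite !gtmulDl hx hx'.
Qed.
Fact gtmul1l : left_id (tpure (1 : G) (1 : H)) gtmul.
Proof.
move=> x; elim/gt_ind: x => [|p q a b ha hb|x y hx hy]; first exact: gtmul0r.
  by rewrite (gtmulE _ _ (hcomp_one H) ha) mul0n scale1r !mul1r.
by rewrite gtmulDr hx hy.
Qed.
Fact gtmul1r : right_id (tpure (1 : G) (1 : H)) gtmul.
Proof.
move=> x; elim/gt_ind: x => [|p q a b ha hb|x y hx hy]; first exact: gtmul0l.
  by rewrite (gtmulE _ _ hb (hcomp_one G)) muln0 scale1r !mulr1.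
by rewrite gtmulDl hx hy.
Qed.
Definition gtens_alg : alg k :=
  Alg gtmulA gtmul1l gtmul1r gtmulDl gtmulDr gtscaleAl gtscaleAr.

Let gthcomp_bilin n : bilin (fun (a : G) (b : H) =>
  \sum_(i < n.+1) tpure (hcomp i a) (hcomp (n - i) b)).
Proof.
split=> [b c u v|a c u v]; rewrite scaler_sumr -big_split;
  by apply: eq_bigr => i _ /=; rewrite hcomp_linear ?pl ?pr.
Qed.
Fact gthcomp_linear n : linear (gthcomp n).
Proof. exact/tlift_linear/gthcomp_bilin. Qed.
Let gthcompD n x y : gthcomp n (x + y) = gthcomp n x + gthcomp n y.
Proof. exact: linD (gthcomp_linear n) x y. Qed.
Let gthcomp0 n : gthcomp n 0 = 0.
Proof. exact: lin0 (gthcomp_linear n). Qed.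
Lemma gthcompE n p q (a : G) (b : H) : homog p a -> homog q b ->
  gthcomp n (tpure a b) = if n == (p + q)%N then tpure a b else 0.
Proof.
move=> ha hb; rewrite /gthcomp tliftE; last exact: gthcomp_bilin.
case: eqP => [->|ne].
  rewrite (bigD1 (inord p : 'I_(p + q).+1)) //= inordK ?ltnS ?leq_addr //.
  rewrite addKn ha hb big1 ?addr0 // => i /eqP ne.
  rewrite (hcomp_homog i ha); case: eqP => [e|_]; last by rewrite p0l.
  by case: ne; apply: val_inj; rewrite /= inordK ?ltnS ?leq_addr.
rewrite big1 // => i _; rewrite (hcomp_homog i ha) (hcomp_homog (n - i) hb).
case: eqP => [ei|_]; last by rewrite p0l.
case: eqP => [ej|_]; last by rewrite p0r.
by case: ne; rewrite -ej -ei subnKC // -ltnS.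
Qed.
Fact gthcomp_proj m n x :
  gthcomp m (gthcomp n x) = if m == n then gthcomp n x else 0.
Proof.
elim/gt_ind: x => [|p q a b ha hb|x y hx hy].
- by rewrite !gthcomp0 if_same.
- rewrite (gthcompE n ha hb); case: (n =P (p + q)%N) => [->|ne].
    by rewrite (gthcompE m ha hb).
  by rewrite gthcomp0 if_same.
- by rewrite !gthcompD hx hy; case: eqP; rewrite ?addr0.
Qed.
Fact gthcomp_sum x : exists N : nat, x = \sum_(n < N) gthcomp n x.
Proof.
suff [N hN] : exists N, forall M, (N <= M)%N -> x = \sum_(n < M) gthcomp n x.
  by exists N; apply: hN.
elim/gt_ind: x => [|p q a b ha hb|x y [N hN] [N' hN']].
- by exists 0 => M _; rewrite big1 // => i _; rewrite gthcomp0.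
- exists (p + q).+1 => M hM; rewrite (bigD1 (Ordinal hM)) //= (gthcompE _ ha hb) eqxx.
  rewrite big1 ?addr0 // => i /eqP ne; rewrite (gthcompE _ ha hb).
  by case: eqP => // e; case: ne; apply: val_inj.
- exists (maxn N N') => M; rewrite geq_max => /andP[h h'].
  rewrite {1}(hN _ h) {1}(hN' _ h') -big_split; apply: eq_bigr => i _ /=.
  by rewrite gthcompD.
Qed.
Fact gthcomp_one : gthcomp 0 (1%R : gtens_alg) = (1%R : gtens_alg).
Proof. exact: (gthcompE 0 (hcomp_one G) (hcomp_one H)). Qed.
Let gthcompM n (x y : T) :
  gthcomp n (gtmul x y) = \sum_(i < n.+1) gtmul (gthcomp i x) (gthcomp (n - i) y).
Proof.
elim/gt_ind: x => [|p q a b ha hb|x x' hx hx'].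
- rewrite gtmul0l gthcomp0 big1 // => i _; by rewrite gthcomp0 gtmul0l.
- elim/gt_ind: y => [|p' q' a' b' ha' hb'|y y' hy hy'].
  + rewrite gtmul0r gthcomp0 big1 // => i _; by rewrite gthcomp0 gtmul0r.
  + rewrite (gtmulE _ _ hb ha') (linZ (gthcomp_linear n)).
    rewrite (gthcompE n (hcomp_mul ha ha') (hcomp_mul hb hb')) addnACA.
    case: eqP => [->|ne].
      have hp : (p + q < (p + q + (p' + q')).+1)%N by rewrite ltnS leq_addr.
      rewrite (bigD1 (Ordinal hp)) //= addKn (gthcompE _ ha hb) (gthcompE _ ha' hb').
      rewrite !eqxx (gtmulE _ _ hb ha') big1 ?addr0 // => i /eqP ne.
      rewrite (gthcompE _ ha hb); case: eqP => [e|_]; last by rewrite gtmul0l.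
      by case: ne; apply: val_inj.
    rewrite scaler0 big1 // => i _; rewrite (gthcompE _ ha hb) (gthcompE _ ha' hb').
    case: eqP => [ei|_]; last by rewrite gtmul0l.
    case: eqP => [ej|_]; last by rewrite gtmul0r.
    by case: ne; rewrite -ej -ei subnKC // -ltnS.
  + rewrite gtmulDr gthcompD hy hy' -big_split; apply: eq_bigr => i _ /=.
    by rewrite gthcompD gtmulDr.
- rewrite gtmulDl gthcompD hx hx' -big_split; apply: eq_bigr => i _ /=.
  by rewrite gthcompD gtmulDl.
Qed.
Fact gthcomp_mul m n (x y : gtens_alg) : gthcomp m x = x -> gthcomp n y = y ->
  gthcomp (m + n) (x * y) = x * y.
Proof.
move=> hx hy; rewrite -[x * y]/(gtmul x y) gthcompM.
have hm : (m < (m + n).+1)%N by rewrite ltnS leq_addr.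
rewrite (bigD1 (Ordinal hm)) //= addKn hx hy big1 ?addr0 // => i /eqP ne.
rewrite -hx gthcomp_proj; case: eqP => [e|_]; last by rewrite gtmul0l.
by case: ne; apply: val_inj.
Qed.

Let gtdif_bilin : bilin (fun (a : G) (b : H) =>
  tpure (dif a) b + hsum (fun m am => (-1) ^+ m *: tpure am (dif b)) a).
Proof.
split=> [b c u v|a c u v].
- rewrite dif_linear pl hsum_linear => [|n d x y]; last first.
    by rewrite pl scalerDr !scalerA mulrC.
  by rewrite scalerDr addrACA.
- rewrite pr [X in _ + X = _](_ : _ = c *: hsum (fun m am =>
      (-1) ^+ m *: tpure am (dif u)) a + hsum (fun m am =>
      (-1) ^+ m *: tpure am (dif v)) a).
    by rewrite scalerDr addrACA.
  rewrite -hsum_linl; apply: eq_hsum => n z.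
  by rewrite dif_linear pr scalerDr !scalerA mulrC.
Qed.
Fact gtdif_linear : linear gtdif.
Proof. exact/tlift_linear/gtdif_bilin. Qed.
Let gtdifD x y : gtdif (x + y) = gtdif x + gtdif y.
Proof. exact: linD gtdif_linear x y. Qed.
Let gtdif0 : gtdif 0 = 0.
Proof. exact: lin0 gtdif_linear. Qed.
Lemma gtdifE p (a : G) (b : H) : homog p a ->
  gtdif (tpure a b) = tpure (dif a) b + (-1) ^+ p *: tpure a (dif b).
Proof.
move=> ha; rewrite /gtdif tliftE; last exact: gtdif_bilin.
by rewrite (hsum_homog _ ha) // => n; rewrite p0l scaler0.
Qed.
Let gthcomp_gtdif n x : gthcomp n.+1 (gtdif x) = gtdif (gthcomp n x).
Proof.
elim/gt_ind: x => [|p q a b ha hb|x y hx hy].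
- by rewrite !(gthcomp0, gtdif0).
- rewrite (gtdifE _ ha) gthcompD (linZ (gthcomp_linear _)).
  rewrite (gthcompE _ (dif_deg ha) hb) (gthcompE _ ha (dif_deg hb)).
  rewrite (gthcompE _ ha hb) addSn addnS eqSS.
  by case: eqP => _; rewrite ?gtdif0 ?scaler0 ?addr0 // (gtdifE _ ha).
- by rewrite gtdifD !gthcompD gtdifD hx hy.
Qed.
Fact gtdif_deg n x : gthcomp n x = x -> gthcomp n.+1 (gtdif x) = gtdif x.
Proof. by move=> hx; rewrite gthcomp_gtdif hx. Qed.
Fact gtdif_dif x : gtdif (gtdif x) = 0.
Proof.
elim/gt_ind: x => [|p q a b ha hb|x y hx hy].
- by rewrite !gtdif0.
- rewrite (gtdifE _ ha) gtdifD (linZ gtdif_linear) (gtdifE _ (dif_deg ha)).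
  rewrite (gtdifE _ ha) !dif_dif p0l p0r scaler0 add0r addr0 exprS mulN1r.
  by rewrite scaleNr addNr.
- by rewrite !gtdifD hx hy addr0.
Qed.
Fact gtdif_mul n (x y : gtens_alg) : gthcomp n x = x ->
  gtdif (x * y) = (gtdif x : gtens_alg) * y + (-1) ^+ n *: (x * (gtdif y : gtens_alg)).
Proof.
suff h (z w : T) : gtdif (gtmul (gthcomp n z) w) =
    gtmul (gtdif (gthcomp n z)) w + (-1) ^+ n *: gtmul (gthcomp n z) (gtdif w).
  by move=> hx; have := h x y; rewrite hx.
elim/gt_ind: z => [|p q a b ha hb|z z' hz hz'].
- by rewrite gthcomp0 gtdif0 !gtmul0l gtdif0 scaler0 addr0.
- rewrite (gthcompE _ ha hb); case: eqP => [->|_]; last first.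
    by rewrite gtdif0 !gtmul0l gtdif0 scaler0 addr0.
  elim/gt_ind: w => [|p' q' a' b' ha' hb'|w w' hw hw'].
  + by rewrite gtdif0 !gtmul0r gtdif0 scaler0 addr0.
  + rewrite (gtmulE _ _ hb ha') (linZ gtdif_linear) (gtdifE _ (hcomp_mul ha ha')).
    rewrite (gtdifE _ ha) (gtdifE _ ha') gtmulDl gtmulDr -gtscaleAl -gtscaleAr.
    rewrite (gtmulE _ _ hb ha') (gtmulE _ _ (dif_deg hb) ha').
    rewrite (gtmulE _ _ hb (dif_deg ha')) (gtmulE _ _ hb ha').
    rewrite (dif_mul _ ha) (dif_mul _ hb) pDl pDr pZl pZr.
    rewrite !scalerDr !scalerA -!exprD -!addrA; congr (_ + _).
    rewrite addrCA; congr (_ + _).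
      congr (_ *: _); apply: sign_eq; rewrite !(oddD, oddM, oddS) /=.
      by case: (odd p); case: (odd q); case: (odd p').
    congr (_ + _); congr (_ *: _); apply: sign_eq; rewrite !(oddD, oddM, oddS) /=;
      by case: (odd p); case: (odd q); case: (odd p').
  + by rewrite gtdifD !gtmulDr gtdifD hw hw' scalerDr addrACA.
- by rewrite gthcompD gtdifD !gtmulDl gtdifD hz hz' scalerDr addrACA.
Qed.

Definition gtens : dga k :=
  @Dga k gtens_alg gthcomp gtdif gthcomp_linear gthcomp_proj gthcomp_sum
    gthcomp_one gthcomp_mul gtdif_linear gtdif_deg gtdif_dif gtdif_mul.
End GradedTensor.

(* The universal differential algebra Omega(A): differential expressions in
   the elements of A, identified when they agree in every differential graded
   algebra G under every algebra homomorphism A -> G^0. *)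
Section Universal.
Variables (k : fieldType) (A : alg k).

Inductive uterm : Type :=
  | UIn of A
  | UDif of uterm
  | UAdd of uterm & uterm
  | UScale of k & uterm
  | UMul of uterm & uterm.

Section Eval.
Variables (G : dga k) (phi : A -> G).
Fixpoint ueval (t : uterm) : G :=
  match t with
  | UIn a => phi a
  | UDif t => dif (ueval t)
  | UAdd t u => ueval t + ueval u
  | UScale c t => c *: ueval t
  | UMul t u => ueval t * ueval u
  end.
End Eval.

Definition in_degree0 (G : dga k) (phi : A -> G) : Prop :=
  forall a, homog 0 (phi a).

Definition ueqv (t u : uterm) : bool :=
  `[< forall (G : dga k) (phi : alghom A G), in_degree0 phi ->
      ueval phi t = ueval phi u >].

HB.instance Definition _ := gen_eqMixin uterm.
HB.instance Definition _ := gen_choiceMixin uterm.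

Lemma ueqv_refl : reflexive ueqv.
Proof. by move=> t; apply/asboolP. Qed.
Lemma ueqv_sym : symmetric ueqv.
Proof.
by move=> t u; apply/idP/idP => /asboolP h; apply/asboolP => G phi /h ->.
Qed.
Lemma ueqv_trans : transitive ueqv.
Proof.
move=> u t v /asboolP h1 /asboolP h2; apply/asboolP => G phi h.
by rewrite h1 // h2.
Qed.
Canonical ueqv_equiv := EquivRel ueqv ueqv_refl ueqv_sym ueqv_trans.

Definition omega_car := {eq_quot ueqv}.
HB.instance Definition _ := Choice.on omega_car.
HB.instance Definition _ := EqQuotient.on omega_car.

Let p (t : uterm) : omega_car := \pi_omega_car t.
Definition oeval (G : dga k) (phi : A -> G) (x : omega_car) : G :=
  ueval phi (repr x).

Lemma oeval_pi (G : dga k) (phi : alghom A G) t :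
  in_degree0 phi -> oeval phi (\pi_omega_car t) = ueval phi t.
Proof.
move=> h; rewrite /oeval.
have /asboolP e : ueqv (repr (\pi_omega_car t)) t.
  by have /eqmodP := reprK (\pi_omega_car t).
exact: e.
Qed.
Lemma omega_ext (x y : omega_car) :
  (forall (G : dga k) (phi : alghom A G), in_degree0 phi ->
     oeval phi x = oeval phi y) -> x = y.
Proof.
move=> h; rewrite -[x]reprK -[y]reprK; apply/eqmodP/asboolP => G phi h0.
exact: h.
Qed.

Let oadd (x y : omega_car) := p (UAdd (repr x) (repr y)).
Let oscale (c : k) (x : omega_car) := p (UScale c (repr x)).
Let oopp (x : omega_car) := oscale (-1) x.
Let omul (x y : omega_car) := p (UMul (repr x) (repr y)).
Let odif (x : omega_car) := p (UDif (repr x)).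
Let oin (a : A) := p (UIn a).

Section Ops.
Variables (G : dga k) (phi : alghom A G) (h : in_degree0 phi).
Lemma oevalD x y : oeval phi (oadd x y) = oeval phi x + oeval phi y.
Proof. by rewrite oeval_pi. Qed.
Lemma oevalZ c x : oeval phi (oscale c x) = c *: oeval phi x.
Proof. by rewrite oeval_pi. Qed.
Lemma oevalN x : oeval phi (oopp x) = - oeval phi x.
Proof. by rewrite oevalZ scaleN1r. Qed.
Lemma oevalM x y : oeval phi (omul x y) = oeval phi x * oeval phi y.
Proof. by rewrite oeval_pi. Qed.
Lemma oeval_dif x : oeval phi (odif x) = dif (oeval phi x).
Proof. by rewrite oeval_pi. Qed.
Lemma oeval_in a : oeval phi (oin a) = phi a.
Proof. by rewrite oeval_pi. Qed.
Lemma oeval0 : oeval phi (oin 0) = 0.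
Proof. by rewrite oeval_in ah0. Qed.
Lemma oeval1 : oeval phi (oin 1) = 1.
Proof. by rewrite oeval_in ah1. Qed.
Definition oevalE := (oeval0, oeval1, oevalD, oevalN, oevalZ, oevalM, oeval_dif,
  oeval_in).
End Ops.

Fact oaddA : associative oadd.
Proof. by move=> x y z; apply: omega_ext => G phi h; rewrite !(oevalE h) addrA. Qed.
Fact oaddC : commutative oadd.
Proof. by move=> x y; apply: omega_ext => G phi h; rewrite !(oevalE h) addrC. Qed.
Fact oadd0 : left_id (oin 0) oadd.
Proof. by move=> x; apply: omega_ext => G phi h; rewrite !(oevalE h) add0r. Qed.
Fact oaddN : left_inverse (oin 0) oopp oadd.
Proof. by move=> x; apply: omega_ext => G phi h; rewrite !(oevalE h) addNr. Qed.
HB.instance Definition _ := GRing.isZmodule.Build omega_car oaddA oaddC oadd0 oaddN.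
Let oevalD' (G : dga k) (phi : alghom A G) (h : in_degree0 phi) x y :
  oeval phi (x + y) = oeval phi x + oeval phi y.
Proof. exact: (oevalD h). Qed.

Fact oscaleA a b x : oscale a (oscale b x) = oscale (a * b) x.
Proof. by apply: omega_ext => G phi h; rewrite !(oevalE h) scalerA. Qed.
Fact oscale1 : left_id 1 oscale.
Proof. by move=> x; apply: omega_ext => G phi h; rewrite !(oevalE h) scale1r. Qed.
Fact oscaleDr : right_distributive oscale +%R.
Proof.
move=> c x y; apply: omega_ext => G phi h.
by rewrite oevalD' // !(oevalE h) ?oevalD' // scalerDr.
Qed.
Fact oscaleDl x : {morph oscale^~ x : a b / a + b}.
Proof.
move=> a b; apply: omega_ext => G phi h.
by rewrite oevalD' // !(oevalE h) scalerDl.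
Qed.
HB.instance Definition _ :=
  GRing.Zmodule_isLmodule.Build k omega_car oscaleA oscale1 oscaleDr oscaleDl.
Let oevalZ' (G : dga k) (phi : alghom A G) (h : in_degree0 phi) c x :
  oeval phi (c *: x) = c *: oeval phi x.
Proof. exact: (oevalZ h). Qed.

Fact omulA : associative omul.
Proof. by move=> x y z; apply: omega_ext => G phi h; rewrite !(oevalE h) mulrA. Qed.
Fact omul1l : left_id (oin 1) omul.
Proof. by move=> x; apply: omega_ext => G phi h; rewrite !(oevalE h) mul1r. Qed.
Fact omul1r : right_id (oin 1) omul.
Proof. by move=> x; apply: omega_ext => G phi h; rewrite !(oevalE h) mulr1. Qed.
Fact omulDl : left_distributive omul +%R.
Proof.
move=> x y z; apply: omega_ext => G phi h.
by rewrite oevalD' // !(oevalE h) ?oevalD' // mulrDl.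
Qed.
Fact omulDr : right_distributive omul +%R.
Proof.
move=> x y z; apply: omega_ext => G phi h.
by rewrite oevalD' // !(oevalE h) ?oevalD' // mulrDr.
Qed.
Fact oscaleAl (c : k) x y : c *: omul x y = omul (c *: x) y.
Proof.
by apply: omega_ext => G phi h; rewrite oevalZ' // !(oevalE h) ?oevalZ' // ascalerAl.
Qed.
Fact oscaleAr (c : k) x y : c *: omul x y = omul x (c *: y).
Proof.
by apply: omega_ext => G phi h; rewrite oevalZ' // !(oevalE h) ?oevalZ' // ascalerAr.
Qed.
Definition omega_alg : alg k :=
  Alg omulA omul1l omul1r omulDl omulDr oscaleAl oscaleAr.

Fixpoint uhcomp (t : uterm) (n : nat) : uterm :=
  match t with
  | UIn a => if n is 0 then UIn a else UIn 0
  | UDif t => if n is n'.+1 then UDif (uhcomp t n') else UIn 0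
  | UAdd t u => UAdd (uhcomp t n) (uhcomp u n)
  | UScale c t => UScale c (uhcomp t n)
  | UMul t u =>
      foldr (fun i s => UAdd (UMul (uhcomp t i) (uhcomp u (n - i))) s)
        (UIn 0) (iota 0 n.+1)
  end.
Lemma ueval_hcomp (G : dga k) (phi : alghom A G) : in_degree0 phi ->
  forall t n, ueval phi (uhcomp t n) = hcomp n (ueval phi t).
Proof.
move=> h; elim=> [a|t IH|t IHt u IHu|c t IH|t IHt u IHu] n.
- by case: n => [|n] /=; rewrite (hcomp_homog _ (h a)) ?ah0.
- by case: n => [|n] /=; rewrite ?hcomp_dif0 ?hcomp_difS ?ah0 ?IH.
- by rewrite /= IHt IHu hcompD.
- by rewrite /= IH (linZ (hcomp_linear n)).
- have hs s : ueval phi (foldr (fun i s => UAdd (UMul (uhcomp t i) (uhcomp u (n - i))) s)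
      (UIn 0) s) = \sum_(i <- s) hcomp i (ueval phi t) * hcomp (n - i) (ueval phi u).
    elim: s => [|i s IHs]; first by rewrite /= big_nil ah0.
    by rewrite big_cons /= IHt IHu IHs.
  rewrite hcompM -(big_mkord xpredT
    (fun i => hcomp i (ueval phi t) * hcomp (n - i) (ueval phi u))).
  by rewrite /index_iota subn0 -hs.
Qed.
Fixpoint ubound (t : uterm) : nat :=
  match t with
  | UIn a => 1
  | UDif t => (ubound t).+1
  | UAdd t u => maxn (ubound t) (ubound u)
  | UScale c t => ubound t
  | UMul t u => ubound t + ubound u
  end.
Lemma ueval_bound (G : dga k) (phi : alghom A G) : in_degree0 phi ->
  forall t n, (ubound t <= n)%N -> hcomp n (ueval phi t) = 0.
Proof.
move=> h; elim=> [a|t IH|t IHt u IHu|c t IH|t IHt u IHu] n /=.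
- by case: n => // n _; rewrite (hcomp_homog _ (h a)).
- by case: n => // n hn; rewrite hcomp_difS IH // dif0.
- by rewrite geq_max => /andP[h1 h2]; rewrite hcompD IHt // IHu // addr0.
- by move=> hn; rewrite (linZ (hcomp_linear n)) IH // scaler0.
- move=> hn; rewrite hcompM big1 // => i _.
  case: (leqP (ubound t) i) => hi; first by rewrite IHt // mul0r.
  rewrite IHu ?mulr0 // leq_subRL; last by rewrite -ltnS.
  by apply: leq_trans hn; rewrite leq_add2r ltnW.
Qed.

Let ohcomp (n : nat) (x : omega_alg) : omega_alg := p (uhcomp (repr (x : omega_car)) n).
Let oev (G : dga k) (phi : A -> G) (x : omega_alg) : G := oeval phi x.

Section OmegaEval.
Variables (G : dga k) (phi : alghom A G) (h : in_degree0 phi).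
Let oev_lin : linear (oev phi).
Proof. by move=> c x y; rewrite /oev oevalD' // oevalZ'. Qed.
Let oevM x y : oev phi (x * y) = oev phi x * oev phi y.
Proof. exact: (oevalM h). Qed.
Let oev1 : oev phi 1 = 1.
Proof. exact: (oeval1 h). Qed.
Let oev_hcomp n x : oev phi (ohcomp n x) = hcomp n (oev phi x).
Proof. by rewrite /oev oeval_pi // ueval_hcomp. Qed.
Let oev_dif x : oev phi (odif x) = dif (oev phi x).
Proof. exact: (oeval_dif h). Qed.
Definition omega_eval : alghom omega_alg G := AlgHom oev_lin (conj oev1 oevM).
Lemma omega_eval_hcomp n x : omega_eval (ohcomp n x) = hcomp n (omega_eval x).
Proof. exact: oev_hcomp. Qed.
Lemma omega_eval_dif0 x : omega_eval (odif x) = dif (omega_eval x).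
Proof. exact: oev_dif. Qed.
Lemma omega_eval_in0 a : omega_eval (oin a) = phi a.
Proof. exact: (oeval_in h). Qed.
End OmegaEval.

Let ext (x y : omega_alg) : (forall (G : dga k) (phi : alghom A G)
  (h : in_degree0 phi), omega_eval h x = omega_eval h y) -> x = y.
Proof. by move=> e; apply: omega_ext => G phi h; exact: (e G phi h). Qed.

Fact ohcomp_linear n : linear (ohcomp n).
Proof.
by move=> c x y; apply: ext => G phi h; rewrite ahP !omega_eval_hcomp ahP hcomp_linear.
Qed.
Fact ohcomp_proj m n x : ohcomp m (ohcomp n x) = if m == n then ohcomp n x else 0.
Proof.
apply: ext => G phi h; rewrite !omega_eval_hcomp hcomp_proj.
by case: eqP; rewrite ?omega_eval_hcomp ?ah0.
Qed.
Fact ohcomp_sum x : exists N : nat, x = \sum_(n < N) ohcomp n x.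
Proof.
exists (ubound (repr (x : omega_car))); apply: ext => G phi h.
rewrite (lin_sum (alghom_linear (omega_eval h))).
under eq_bigr do rewrite omega_eval_hcomp.
apply: hcomp_sum_le => n hn; exact: ueval_bound.
Qed.
Fact ohcomp_one : ohcomp 0 1%R = 1%R.
Proof. by apply: ext => G phi h; rewrite omega_eval_hcomp ah1 hcomp_one. Qed.
Fact ohcomp_mul m n (x y : omega_alg) : ohcomp m x = x -> ohcomp n y = y ->
  ohcomp (m + n) (x * y) = x * y.
Proof.
move=> hx hy; apply: ext => G phi h; rewrite omega_eval_hcomp ahM.
by apply: hcomp_mul; rewrite -omega_eval_hcomp ?hx ?hy.
Qed.
Fact odif_linear : linear (odif : omega_alg -> omega_alg).
Proof.
by move=> c x y; apply: ext => G phi h; rewrite ahP !omega_eval_dif0 ahP dif_linear.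
Qed.
Fact odif_deg n x : ohcomp n x = x -> ohcomp n.+1 (odif x) = odif x.
Proof.
move=> hx; apply: ext => G phi h; rewrite omega_eval_hcomp omega_eval_dif0.
by apply: dif_deg; rewrite -omega_eval_hcomp hx.
Qed.
Fact odif_dif x : odif (odif x) = (0 : omega_alg).
Proof. by apply: ext => G phi h; rewrite !omega_eval_dif0 dif_dif ah0. Qed.
Fact odif_mul n (x y : omega_alg) : ohcomp n x = x ->
  odif (x * y) = (odif x : omega_alg) * y + (-1) ^+ n *: (x * (odif y : omega_alg)).
Proof.
move=> hx; apply: ext => G phi h.
rewrite ahD (linZ (alghom_linear (omega_eval h))) !(omega_eval_dif0, ahM).
by apply: dif_mul; rewrite -omega_eval_hcomp hx.
Qed.
Definition omega : dga k :=
  @Dga k omega_alg ohcomp odif ohcomp_linear ohcomp_proj ohcomp_sum ohcomp_one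
    ohcomp_mul odif_linear odif_deg odif_dif odif_mul.

Fact omega_in_linear : linear (oin : A -> omega).
Proof.
by move=> c a b; apply: ext => G phi h; rewrite ahP !omega_eval_in0 ahP.
Qed.
Fact omega_in_monoid : monoid_morphism (oin : A -> omega).
Proof.
split=> // a b; apply: ext => G phi h.
by rewrite [LHS]omega_eval_in0 !ahM -!(omega_eval_in0 h).
Qed.
Definition omega_in : alghom A omega := AlgHom omega_in_linear omega_in_monoid.
Lemma omega_in_degree0 : in_degree0 omega_in.
Proof.
move=> a; apply: ext => G phi h.
by rewrite omega_eval_hcomp omega_eval_in0; apply: h.
Qed.

(* the universal property: phi extends uniquely to a homomorphism of
   differential graded algebras Omega(A) -> G *)
Section OmegaLift.
Variables (G : dga k) (phi : alghom A G) (h : in_degree0 phi).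
Definition omega_lift : alghom omega G := omega_eval h.
Lemma omega_lift_in a : omega_lift (omega_in a) = phi a.
Proof. exact: omega_eval_in0. Qed.
Lemma omega_lift_dif x : omega_lift (dif x) = dif (omega_lift x).
Proof. exact: omega_eval_dif0. Qed.
Lemma omega_lift_hcomp n x : omega_lift (hcomp n x) = hcomp n (omega_lift x).
Proof. exact: omega_eval_hcomp. Qed.
End OmegaLift.
Lemma omega_ind (P : omega -> Prop) :
  (forall a, P (omega_in a)) -> (forall x, P x -> P (dif x)) ->
  (forall x y, P x -> P y -> P (x + y)) -> (forall (c : k) x, P x -> P (c *: x)) ->
  (forall x y, P x -> P y -> P (x * y)) -> forall x, P x.
Proof.
move=> Pi Pd PD PZ PM x; rewrite -[x](@reprK _ omega_car).
elim: (repr _) => [a|t IH|t IHt u IHu|c t IH|t IHt u IHu].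
- exact: Pi.
- rewrite (_ : \pi_omega_car _ = dif (\pi_omega_car t : omega)); first exact: Pd.
  apply: ext => G phi h; rewrite [RHS]omega_eval_dif0.
  by rewrite -![omega_eval h _]/(oeval phi _) !oeval_pi.
- rewrite (_ : \pi_omega_car _ = (\pi_omega_car t : omega) + \pi_omega_car u).
    exact: PD.
  apply: ext => G phi h; rewrite ahD.
  by rewrite -![omega_eval h _]/(oeval phi _) !oeval_pi.
- rewrite (_ : \pi_omega_car _ = c *: (\pi_omega_car t : omega)).
    exact: PZ.
  apply: ext => G phi h; rewrite (linZ (alghom_linear (omega_eval h))).
  by rewrite -![omega_eval h _]/(oeval phi _) !oeval_pi.
- rewrite (_ : \pi_omega_car _ = (\pi_omega_car t : omega) * \pi_omega_car u).
    exact: PM.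
  apply: ext => G phi h; rewrite ahM.
  by rewrite -![omega_eval h _]/(oeval phi _) !oeval_pi.
Qed.
Lemma omega_lift_unique (G : dga k) (phi : alghom A G) (h : in_degree0 phi)
    (f : alghom omega G) : (forall a, f (omega_in a) = phi a) ->
  (forall x, f (dif x) = dif (f x)) -> f =1 omega_lift h.
Proof.
move=> fi fd; elim/omega_ind => [a|x IH|x y hx hy|c x hx|x y hx hy].
- by rewrite fi omega_lift_in.
- by rewrite fd omega_lift_dif IH.
- by rewrite !ahD hx hy.
- by rewrite (linZ (alghom_linear f)) (linZ (alghom_linear (omega_lift h))) hx.
- by rewrite !ahM hx hy.
Qed.
End Universal.

Record diffalg (k : fieldType) (A : alg k) := Diffalg {
  da_dga :> dga k;
  da_in : alghom A da_dga;
  da_inj : injective da_in;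
  da_deg0 : forall x, homog 0 x <-> exists a, da_in a = x;
  da_gen : forall S : subalg da_dga,
    (forall a, S (da_in a)) -> (forall a, S (dif (da_in a))) -> forall x, S x
}.

Record hopf (k : fieldType) := Hopf {
  hopf_alg :> alg k;
  comul : alghom hopf_alg (talg hopf_alg hopf_alg);
  counit : hopf_alg -> k;
  antipode : hopf_alg -> hopf_alg;
  comulA : forall h, tassoc (tmap id comul (comul h)) = tmap comul id (comul h);
  counit_linear : scalar counit;
  counit_monoid : monoid_morphism counit;
  counitl : forall h,
    tlift (fun h1 h2 : hopf_alg => counit h1 *: h2) (comul h) = h;
  counitr : forall h,
    tlift (fun h1 h2 : hopf_alg => counit h2 *: h1) (comul h) = h;
  antipode_linear : linear antipode;
  antipodel : forall h,
    tlift (fun h1 h2 : hopf_alg => antipode h1 * h2) (comul h) = counit h *: (1 : hopf_alg);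
  antipoder : forall h,
    tlift (fun h1 h2 : hopf_alg => h1 * antipode h2) (comul h) = counit h *: (1 : hopf_alg)
}.

Section Sweedler.
Variables (k : fieldType) (H : hopf k).

(* id (x) Delta : V (x) H -> (V (x) H) (x) H *)
Definition id_comul (V : lmodType k) (x : tens V H) : tens (tens V H) H :=
  tassoc (tmap id (comul H) x).

(* \sum F(h_(1), h_(2)) and \sum F(h_(1), h_(2), h_(3)) *)
Definition sweedler2 (Z : lmodType k) (F : H -> H -> Z) (h : H) : Z :=
  tlift F (comul H h).
Definition sweedler3 (Z : lmodType k) (F : H -> H -> H -> Z) (h : H) : Z :=
  tlift (fun (u : tens H H) (h3 : H) => tlift (fun h1 h2 : H => F h1 h2 h3) u)
    (tmap (comul H) id (comul H h)).

Definition antipodeV : H -> H := 'pinv_(fun=> 0) setT (@antipode k H).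
End Sweedler.

Record comod_alg (k : fieldType) (H : hopf k) := ComodAlg {
  ca_alg :> alg k;
  coact : alghom ca_alg (talg ca_alg H);
  coactA : forall f, tmap coact id (coact f) = id_comul (coact f);
  coact_counit : forall f,
    tlift (fun (f0 : ca_alg) (f1 : H) => counit f1 *: f0) (coact f) = f
}.

Section Coverings.
Variables (k : fieldType) (B : alg k) (I : finType) (J : I -> ideal B).
Definition covering : Prop := forall b, (forall i, J i b) -> b = 0.
Definition complete_covering : Prop := covering /\
  forall b : (forall i, quo (J i)),
    (forall i j, quo_proj (add_ideal (J i) (J j)) (b i) =
                 quo_proj (add_ideal (J i) (J j)) (b j)) ->
    exists a : B, forall i, quo_pi (J i) a = b i.
End Coverings.

Record qpfb (k : fieldType) := Qpfb {
  base_alg : alg k;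
  cov_idx : finType;
  cov_ideal : cov_idx -> ideal base_alg;
  fibre_hopf : hopf k;
  total_alg : comod_alg fibre_hopf;
  base_in : alghom base_alg total_alg;
  chi : forall i, alghom total_alg (talg (quo (cov_ideal i)) fibre_hopf);
  cov_complete : complete_covering cov_ideal;
  base_in_inj : injective base_in;
  chi_surj : forall i y, exists f, chi i f = y;
  chi_base_in : forall i b, chi i (base_in b) = tpure (quo_pi (cov_ideal i) b) (1 : fibre_hopf);
  chi_coact : forall i f, tmap (chi i) id (coact total_alg f) = id_comul (chi i f);
  chi_complete : complete_covering (fun i => ker_ideal (chi i))
}.

Section Gauge.
Variables (k : fieldType) (Q : qpfb k).
Local Notation B := (base_alg Q).
Local Notation H := (fibre_hopf Q).
Local Notation P := (total_alg Q).
Local Notation T i := (talg (quo (cov_ideal i)) H).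

Definition left_gauge_loc (i : cov_idx Q) (a : T i -> T i) : Prop :=
  [/\ linear a, bijective a,
      forall (b : quo (cov_ideal i)) (x : T i),
        a ((tpure b (1 : H) : T i) * x) = (tpure b (1 : H) : T i) * a x,
      forall x, tmap a id (id_comul x) = id_comul (a x) &
      forall b : quo (cov_ideal i), a (tpure b (1 : H)) = tpure b (1 : H)].

Definition right_gauge_loc (i : cov_idx Q) (a : T i -> T i) : Prop :=
  [/\ linear a, bijective a,
      forall (b : quo (cov_ideal i)) (x : T i),
        a (x * (tpure b (1 : H) : T i)) = a x * (tpure b (1 : H) : T i),
      forall x, tmap a id (id_comul x) = id_comul (a x) &
      forall b : quo (cov_ideal i), a (tpure b (1 : H)) = tpure b (1 : H)].

Definition left_gauge (a : P -> P) : Prop :=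
  [/\ linear a, bijective a,
      forall (b : B) (f : P), a (base_in Q b * f) = base_in Q b * a f &
      forall i, exists ai : T i -> T i, left_gauge_loc ai /\
        forall f, chi i (a f) = ai (chi i f)].

Definition right_gauge (a : P -> P) : Prop :=
  [/\ linear a, bijective a,
      forall (b : B) (f : P), a (f * base_in Q b) = a f * base_in Q b &
      forall i, exists ai : T i -> T i, right_gauge_loc ai /\
        forall f, chi i (a f) = ai (chi i f)].

Definition corresponds_l (a : P -> P) (g : H -> P) : Prop :=
  [/\ linear g, g 1 = 1,
      forall f, a f = tlift (fun (f0 : P) (f1 : H) => f0 * g f1) (coact P f) &
      forall h, coact P (g h) =
        sweedler3 (fun h1 h2 h3 => tpure (g h2) (antipode h1 * h3)) h].

Definition corresponds_r (a : P -> P) (g : H -> P) : Prop :=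
  [/\ linear g, g 1 = 1,
      forall f, a f = tlift (fun (f0 : P) (f1 : H) => g f1 * f0) (coact P f) &
      forall h, coact P (g h) =
        sweedler3 (fun h1 h2 h3 => tpure (g h2) (h3 * antipodeV h1)) h].

Definition is_gauge_map_l (a : P -> P) (g : H -> P) : Prop :=
  corresponds_l a g /\
  exists aV gV, [/\ cancel a aV, cancel aV a, corresponds_l aV gV,
    forall h, sweedler2 (fun h1 h2 => g h1 * gV h2) h = counit h *: (1 : P) &
    forall h, sweedler2 (fun h1 h2 => gV h1 * g h2) h = counit h *: (1 : P)].

Definition is_gauge_map_r (a : P -> P) (g : H -> P) : Prop :=
  corresponds_r a g /\
  exists aV gV, [/\ cancel a aV, cancel aV a, corresponds_r aV gV,
    forall h, sweedler2 (fun h1 h2 => g h2 * gV h1) h = counit h *: (1 : P) &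
    forall h, sweedler2 (fun h1 h2 => gV h2 * g h1) h = counit h *: (1 : P)].

(* The map g_alpha; it is determined by alpha, already by the third clause of
   [corresponds_l] (resp. [corresponds_r]). *)
Definition gauge_map_l (a : P -> P) : H -> P :=
  xget (fun=> 0) [set g | is_gauge_map_l a g].
Definition gauge_map_r (a : P -> P) : H -> P :=
  xget (fun=> 0) [set g | is_gauge_map_r a g].
End Gauge.

(* Right covariance: the coproduct extends to a right coaction on Gamma(H)
   that is an algebra homomorphism commuting with d. *)
Definition right_covariant (k : fieldType) (H : hopf k) (G : diffalg H) : Prop :=
  exists delta : alghom G (talg G H),
    [/\ forall w, tmap delta id (delta w) = id_comul (delta w),
        forall w, tlift (fun (w0 : G) (w1 : H) => counit w1 *: w0) (delta w) = w,
        forall h, delta (da_in G h) = tmap (da_in G) id (comul H h) &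
        forall w, delta (dif w) = tmap (@dif k G) id (delta w)].

Record diffstr (k : fieldType) (Q : qpfb k) := Diffstr {
  dbase : forall i : cov_idx Q, diffalg (quo (cov_ideal i));
  dfibre : diffalg (fibre_hopf Q);
  dfibre_cov : right_covariant dfibre
}.


Lemma da_homog (k : fieldType) (A : alg k) (G : diffalg A) (a : A) :
  homog 0 (da_in G a).
Proof. by apply/da_deg0; exists a. Qed.

Section Embedding.
Variables (k : fieldType) (A C : alg k) (G : diffalg A) (K : diffalg C).

(* Gamma(A) (x) C -> Gamma(A) (x)^ Gamma(C) *)
Definition gt_hor (x : talg G C) : gtens G K := tmap id (da_in K) x.
Fact gt_hor_linear : linear gt_hor.
Proof. exact: (tmap_linear (@lin_id k G) (alghom_linear (da_in K))). Qed.
Lemma gt_horE (w : G) (c : C) : gt_hor (tpure w c) = tpure w (da_in K c).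
Proof. exact: (tmapE _ _ (@lin_id k G) (alghom_linear (da_in K))). Qed.
Fact gt_hor_monoid : monoid_morphism gt_hor.
Proof.
split; first by rewrite [LHS]gt_horE ah1.
have hD (x y : talg G C) : gt_hor (x + y) = gt_hor x + gt_hor y.
  exact: (linD gt_hor_linear).
have h0 : gt_hor 0 = 0 by exact: (lin0 gt_hor_linear).
move=> x y; elim/tens_ind: x => [|w c|x x' hx hx'].
- by rewrite [X in gt_hor X]mul0r h0 mul0r.
- elim/tens_ind: y => [|w' c'|y y' hy hy'].
  + by rewrite [X in gt_hor X]mulr0 h0 mulr0.
  + rewrite !gt_horE [X in gt_hor X]tmulE gt_horE ahM.
    elim/homog_ind: w' => [|n w' hw'|w1 w2 h1 h2].
    * by rewrite mulr0 !(lin0 ((tpure_bilin _ _).1 _)) mulr0.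
    * rewrite [RHS](@gtmulE _ _ _ 0 n) //; last by apply/da_deg0; exists c.
      by rewrite mul0n scale1r.
    * by rewrite mulrDr !(linD ((tpure_bilin _ _).1 _)) h1 h2 mulrDr.
  + by rewrite [X in gt_hor X]mulrDr hD hy hy' hD mulrDr.
- by rewrite [X in gt_hor X]mulrDl hD hx hx' hD mulrDl.
Qed.

(* A (x) C -> Gamma(A) (x)^ Gamma(C) *)
Definition gt_in_fun (x : talg A C) : gtens G K := tmap (da_in G) (da_in K) x.
Fact gt_in_linear : linear gt_in_fun.
Proof. exact: (tmap_linear (alghom_linear (da_in G)) (alghom_linear (da_in K))). Qed.
Lemma gt_inE (a : A) (c : C) : gt_in_fun (tpure a c) = tpure (da_in G a) (da_in K c).
Proof. exact: (tmapE _ _ (alghom_linear (da_in G)) (alghom_linear (da_in K))). Qed.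
Lemma gt_in_hor x : gt_in_fun x = gt_hor (tmap (da_in G) id x).
Proof.
have l1 := tmap_linear (alghom_linear (da_in G)) (@lin_id k C).
move: x; apply: (tens_lin_ext gt_in_linear (lin_comp gt_hor_linear l1)) => a c /=.
by rewrite gt_inE tmapE ?gt_horE //; exact: alghom_linear.
Qed.
Fact gt_in_monoid : monoid_morphism gt_in_fun.
Proof.
have hm : monoid_morphism (tmap (da_in G) id : talg A C -> talg G C).
  have hE (a : A) (c : C) : tmap (da_in G) id (tpure a c) = tpure (da_in G a) c.
    by rewrite tmapE //; exact: alghom_linear.
  have l1 := tmap_linear (alghom_linear (da_in G)) (@lin_id k C).
  split; first by rewrite [LHS]hE ah1.
  move=> x y; elim/tens_ind: x => [|w c|x x' hx hx'].
  - by rewrite [X in tmap _ _ X]mul0r !(lin0 l1) mul0r.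
  - elim/tens_ind: y => [|w' c'|y y' hy hy'].
    + by rewrite [X in tmap _ _ X]mulr0 !(lin0 l1) mulr0.
    + by rewrite !hE [X in tmap _ _ X]tmulE hE ahM [RHS]tmulE.
    + by rewrite [X in tmap _ _ X]mulrDr (linD l1) hy hy' (linD l1) mulrDr.
  - by rewrite [X in tmap _ _ X]mulrDl (linD l1) hx hx' (linD l1) mulrDl.
split; first by rewrite gt_in_hor hm.1 gt_hor_monoid.1.
by move=> x y; rewrite !gt_in_hor hm.2 gt_hor_monoid.2.
Qed.
Definition gt_in : alghom (talg A C) (gtens G K) := AlgHom gt_in_linear gt_in_monoid.
Lemma gt_in_homog x : homog 0 (gt_in x).
Proof.
rewrite /homog; elim/tens_ind: x => [|a c|x y hx hy].
- by rewrite ah0 hcomp0.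
- rewrite /= gt_inE; exact: (gthcompE 0 (da_homog G a) (da_homog K c)).
- by rewrite ahD hcompD hx hy.
Qed.
End Embedding.

Definition alghom_comp (k : fieldType) (A B C : alg k) (g : alghom B C)
    (f : alghom A B) : alghom A C.
Proof.
refine (@AlgHom k A C (g \o f) (lin_comp (alghom_linear g) (alghom_linear f)) _).
by split=> [|x y] /=; rewrite ?ah1 ?ahM.
Defined.

(* [formsP], [formsC], [formsM] and [hor] are Gamma(P), Gamma_c(P), Gamma_m(B)
   and hor Gamma_c(P); [chiG], [chiC] and [chiH] are the maps chi_(i,Gamma) on
   Gamma(P), Gamma_c(P) and hor Gamma_c(P). *)
Section Forms.
Variables (k : fieldType) (Q : qpfb k) (X : diffstr Q).
Local Notation B := (base_alg Q).
Local Notation H := (fibre_hopf Q).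
Local Notation P := (total_alg Q).
Local Notation GB i := (dbase X i).
Local Notation GH := (dfibre X).
Local Notation GT i := (gtens (GB i) GH).

Definition chi_in (i : cov_idx Q) : alghom P (GT i) :=
  alghom_comp (gt_in (GB i) GH) (chi i).
Fact chi_in_degree0 i : in_degree0 (chi_in i).
Proof. by move=> f; apply: gt_in_homog. Qed.

Definition chi_omega (i : cov_idx Q) : alghom (omega P) (GT i) :=
  omega_lift (@chi_in_degree0 i).
Definition J_P (i : cov_idx Q) : ideal (omega P) := ker_ideal (chi_omega i).

Definition formsP : alg k := quo (bigcap_ideal J_P).
Definition difP (w : formsP) : formsP := quo_pi _ (dif (quo_repr_of w)).

Definition chiG (i : cov_idx Q) : alghom formsP (GT i) :=
  @quo_lift k (omega P) (GT i) (bigcap_ideal J_P) (chi_omega i) (fun x Jx => Jx i).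
Definition K_P (i : cov_idx Q) : ideal formsP := ker_ideal (chiG i).
Definition K_PP (i j : cov_idx Q) : ideal formsP := add_ideal (K_P i) (K_P j).

Lemma chiG_pi i x : chiG i (quo_pi _ x) = chi_omega i x.
Proof.
exact: (@quo_lift_funE k (omega P) (GT i) (bigcap_ideal J_P) (chi_omega i)
  (fun y Jy => Jy i) x).
Qed.
Lemma difP_pi (x : omega P) : difP (quo_pi _ x) = quo_pi _ (dif x).
Proof.
apply/quo_piP => i.
have /quo_piP /(_ i) h := quo_repr_ofK (quo_pi (bigcap_ideal J_P) x).
change (chi_omega i (dif (quo_repr_of (quo_pi (bigcap_ideal J_P) x)) - dif x) = 0).
by rewrite -(linB (@dif_linear _ _)) omega_lift_dif [X in dif X]h dif0.
Qed.
Lemma difPB v w : difP (v - w) = difP v - difP w.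
Proof.
rewrite -[v]quo_repr_ofK -[w]quo_repr_ofK -ahB !difP_pi.
by rewrite (linB (@dif_linear _ _)) ahB.
Qed.
Lemma chiG_difP i w : chiG i (difP w) = dif (chiG i w).
Proof.
rewrite /difP chiG_pi.
exact: (omega_lift_dif (@chi_in_degree0 i) (quo_repr_of w)).
Qed.

(* u in Gamma(P)/K_i and v in Gamma(P)/K_j, seen in Gamma(B_i) (x)^ Gamma(H)
   and Gamma(B_j) (x)^ Gamma(H), have the same image in Gamma(P)/(K_i + K_j) *)
Definition compat (i j : cov_idx Q) (u : GT i) (v : GT j) : Prop :=
  exists wi wj : formsP, [/\ chiG i wi = u, chiG j wj = v &
    quo_pi (K_PP i j) wi = quo_pi (K_PP i j) wj].

Definition formsC_sub : subalg (prod_alg (fun i => GT i)).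
Proof.
refine (@Subalg k (prod_alg (fun i => GT i))
  (fun g : prod_car (fun i => GT i) => forall i j, compat (g i) (g j)) _ _ _).
- by move=> i j; exists 1, 1; split; rewrite ?ah1.
- move=> c x y hx hy i j; have [u [v [e1 e2 e3]]] := hx i j.
  have [u' [v' [e1' e2' e3']]] := hy i j.
  by exists (c *: u + u'), (c *: v + v'); rewrite !ahP e1 e2 e3 e1' e2' e3'.
- move=> x y hx hy i j; have [u [v [e1 e2 e3]]] := hx i j.
  have [u' [v' [e1' e2' e3']]] := hy i j.
  by exists (u * u'), (v * v'); rewrite !ahM e1 e2 e3 e1' e2' e3'.
Defined.
Definition formsC : alg k := sub_alg formsC_sub.
Definition chiC (i : cov_idx Q) (g : formsC) : GT i :=
  (sub_val g : prod_car (fun i => GT i)) i.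

Fact difC_proof (g : formsC) :
  formsC_sub (fun i => dif (chiC i g) : GT i).
Proof.
move=> i j; have [u [v [e1 e2 /quo_piP [a [b [Ka Kb e]]]]]] := sub_valP g i j.
exists (difP u), (difP v); split; rewrite ?chiG_difP ?e1 ?e2 //.
apply/quo_piP; exists (difP a), (- difP (- b)).
rewrite -difPB e; split.
- by change (chiG i (difP a) = 0); rewrite chiG_difP Ka dif0.
- apply: (idealN (J := K_P j)); change (chiG j (difP (- b)) = 0).
  rewrite chiG_difP.
  by rewrite (linN (alghom_linear (chiG j))) Kb oppr0 dif0.
- by rewrite -difPB opprK.
Qed.
Definition difC (g : formsC) : formsC := sub_mk (difC_proof g).
Definition degC (n : nat) (g : formsC) : Prop := forall i, homog n (chiC i g).

Fact formsC_in_proof (f : P) : formsC_sub (fun i => chi_in i f).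
Proof.
move=> i j; exists (quo_pi _ (omega_in P f)), (quo_pi _ (omega_in P f)).
by split=> //; rewrite chiG_pi;
  exact: (omega_lift_in (@chi_in_degree0 _)).
Qed.
Definition formsC_in (f : P) : formsC := sub_mk (formsC_in_proof f).

Definition hor_sub : subalg formsC.
Proof.
refine (@Subalg k formsC (fun g => forall i, exists y : tens (GB i) H,
  chiC i g = gt_hor GH y) _ _ _).
- move=> i; exists (1 : talg (GB i) H).
  by rewrite (gt_hor_monoid (GB i) GH).1.
- move=> c x y hx hy i; have [u e] := hx i; have [v e'] := hy i.
  exists (c *: u + v); rewrite gt_hor_linear -e -e'; exact: erefl.
- move=> x y hx hy i; have [u e] := hx i; have [v e'] := hy i.
  exists ((u : talg (GB i) H) * (v : talg (GB i) H)).
  rewrite (gt_hor_monoid (GB i) GH).2 -e -e'; exact: erefl.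
Defined.
Definition hor : alg k := sub_alg hor_sub.
Definition chiH (i : cov_idx Q) (g : hor) : GT i := chiC i (sub_val g).

Fact hor_in_proof (f : P) : hor_sub (formsC_in f).
Proof.
by move=> i; exists (tmap (da_in (GB i)) id (chi i f)); rewrite -gt_in_hor.
Qed.
Definition hor_in (f : P) : hor := sub_mk (hor_in_proof f).

(* The right coaction of H on hor Gamma_c(P): its value at g is the element t
   of hor (x) H with (chi_i (x) id)(t) = (id (x) Delta)(chi_i(g)) for all i,
   where chi_i(g) is read in Gamma(B_i) (x) H along [gt_hor]. *)
Definition is_hor_coact (g : hor) (t : tens hor H) : Prop :=
  forall i (y : tens (GB i) H), chiH i g = gt_hor GH y ->
    tmap (chiH i) id t = tmap (gt_hor GH : _ -> GT i) id (id_comul y).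
Definition hor_coact (g : hor) : tens hor H :=
  xget 0 [set t | is_hor_coact g t].

Definition act_l (a : P -> P) (g : hor) : hor :=
  tlift (fun (g0 : hor) (g1 : H) => g0 * hor_in (gauge_map_l a g1)) (hor_coact g).
Definition act_r (a : P -> P) (g : hor) : hor :=
  tlift (fun (g0 : hor) (g1 : H) => hor_in (gauge_map_r a g1) * g0) (hor_coact g).

Definition formsM (g : formsC) : Prop :=
  forall i, exists w : GB i, chiC i g = tpure w (1 : GH).

Definition is_covder (D : hor -> hor) : Prop :=
  [/\ linear D,
      forall n g, degC n (sub_val g) -> degC n.+1 (sub_val (D g)),
      D 1 = 0,
      forall g, hor_coact (D g) = tmap D id (hor_coact g) &
      forall i g, chiH i g = 0 -> chiH i (D g) = 0].

Definition left_covder (D : hor -> hor) : Prop := is_covder D /\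
  forall n (rho g : hor), formsM (sub_val rho) -> degC n (sub_val rho) ->
    sub_val (D (rho * g)) =
      difC (sub_val rho) * sub_val g + (-1) ^+ n *: (sub_val rho * sub_val (D g)).

Definition right_covder (D : hor -> hor) : Prop := is_covder D /\
  forall n (rho g : hor), formsM (sub_val rho) -> degC n (sub_val g) ->
    sub_val (D (g * rho)) =
      sub_val (D g) * sub_val rho + (-1) ^+ n *: (sub_val g * difC (sub_val rho)).
End Forms.

(* Main.v *)
(* A gauge transformation [a] is [a f = sum f_0 g(f_1)] for a map [g : H -> P],
   namely [g_i(h) = sum phi_i(S h_1) a_i(phi_i(h_2))] on the i-th trivial piece,
   with [phi_i(h) = 1 (x) h].  These local maps agree on
   [P / (ker chi_i + ker chi_j)], because there both describe the map induced by
   [a], so completeness of the covering glues them.  The covariance of [g] and of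
   the action it defines are identities in convolution algebras.

   The coaction on the horizontal forms exists because [Omega(P)] is right
   covariant: for every linear functional on [H], slicing [(id (x) Delta) gamma_i]
   along it gives a family that again lies in [hor], and finite families of slices
   recover an element of [hor (x) H].  The same slices show that the action of [a]
   preserves degrees and the kernels of the [chi_i].  Elements of [Gamma_m(B)] are
   coinvariant, so the action commutes with multiplication by them, which gives the
   Leibniz rule for the conjugated derivative.

   The right case is the left case for the opposite algebras; the opposite of [H]
   is a Hopf algebra whose antipode is the inverse of [S]. *)
Require Import Defs.
From mathcomp Require Import all_boot all_order all_algebra.
From mathcomp Require Import boolp classical_sets functions reals complex.
Local Open Scope ring_scope.
Set Implicit Arguments.
Unset Strict Implicit.
Unset Printing Implicit Defensive.
Import GRing.Theory.

(** * Linear functionals and slices of tensors *)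

Section LinearClosure.
Variable k : fieldType.
Implicit Types U V W Z : lmodType k.

Lemma linear_tpurel U V W (f : U -> V) (w : W) :
  linear f -> linear (fun u => tpure (f u) w).
Proof. by move=> lf c x y; rewrite lf; exact: (tpure_bilin V W).1. Qed.
Lemma linear_tpurer U V W (f : U -> W) (v : V) :
  linear f -> linear (fun u => tpure v (f u)).
Proof. by move=> lf c x y; rewrite lf; exact: (tpure_bilin V W).2. Qed.
Lemma linear_mull U (A : alg k) (f : U -> A) (a : A) :
  linear f -> linear (fun u => f u * a : A).
Proof. by move=> lf c x y; rewrite lf mulrDl ascalerAl. Qed.
Lemma linear_mulr U (A : alg k) (f : U -> A) (a : A) :
  linear f -> linear (fun u => a * f u : A).
Proof. by move=> lf c x y; rewrite lf mulrDr ascalerAr. Qed.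
Lemma linear_scalel U V (f : U -> k^o) (v : V) :
  linear f -> linear (fun u => f u *: v : V).
Proof. by move=> lf c x y; rewrite lf scalerDl scalerA. Qed.
Lemma linear_scaler U V (f : U -> V) (a : k) :
  linear f -> linear (fun u => a *: f u : V).
Proof. by move=> lf c x y; rewrite lf scalerDr !scalerA mulrC. Qed.
Lemma linear_add U V (f g : U -> V) :
  linear f -> linear g -> linear (fun u => f u + g u : V).
Proof. by move=> lf lg c x y; rewrite lf lg scalerDr addrACA. Qed.
Lemma linear_tlift U V W Z (F : V -> W -> Z) (x : U -> tens V W) :
  bilin F -> linear x -> linear (fun u => tlift F (x u)).
Proof. by move=> bF lx; exact: (lin_comp (tlift_linear bF) lx). Qed.
Lemma linear_tliftl U V W Z (F : U -> V -> W -> Z) (x : tens V W) :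
  (forall v w, linear (fun u => F u v w)) -> linear (fun u => tlift (F u) x).
Proof.
by move=> lF c u u'; rewrite -tlift_linl; apply: eq_tlift => v w; exact: lF.
Qed.
Lemma linear_tmap U V V' W W' (f : V -> V') (g : W -> W') (x : U -> tens V W) :
  linear f -> linear g -> linear x -> linear (fun u => tmap f g (x u)).
Proof. by move=> lf lg lx; exact: (lin_comp (tmap_linear lf lg) lx). Qed.
Lemma linear_ah U (A B : alg k) (f : alghom A B) (x : U -> A) :
  linear x -> linear (fun u => f (x u)).
Proof. by move=> lx; exact: (lin_comp (alghom_linear f) lx). Qed.
Lemma linear_ap U V W (f : V -> W) (x : U -> V) :
  linear f -> linear x -> linear (fun u => f (x u)).
Proof. by move=> lf lx; exact: (lin_comp lf lx). Qed.
Lemma bilinP V W Z (F : V -> W -> Z) : (forall w, linear (fun v => F v w)) ->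
  (forall v, linear (fun w => F v w)) -> bilin F.
Proof. by []. Qed.
End LinearClosure.

(* [id] is skipped: [id _] unifies with any term, so the search would loop. *)
Ltac linear_hyp tac := match goal with
  | lf : GRing.linear_for _ ?F |- _ => lazymatch F with
      | @id _ => fail | (fun x => x) => fail | _ => refine (linear_ap lf _); tac end
  | lf : forall _, GRing.linear_for _ _ |- _ => refine (linear_ap (lf _) _); tac end.

Ltac lin := intros; lazymatch goal with
  | |- bilin _ => refine (bilinP _ _); lin
  | |- GRing.linear_for _ (fun x => x) => exact: lin_id
  | |- GRing.linear_for _ (@id _) => exact: lin_id
  | |- GRing.linear_for _ (fun x => tpure (@?f x) (@?g x)) =>
      first [refine (linear_tpurel _ _); lin | refine (linear_tpurer _ _); lin]
  | |- GRing.linear_for _ (fun x => (@?f x) * (@?g x)) =>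
      first [refine (linear_mull _ _); lin | refine (linear_mulr _ _); lin]
  | |- GRing.linear_for _ (fun x => (@?f x) *: (@?g x)) =>
      first [refine (linear_scaler _ _); lin | refine (linear_scalel _ _); lin]
  | |- GRing.linear_for _ (fun x => (@?f x) + (@?g x)) => refine (linear_add _ _); lin
  | |- GRing.linear_for _ (fun x => tmap (@?f x) (@?g x) (@?h x)) =>
      refine (linear_tmap _ _ _); lin
  | |- GRing.linear_for _ (fun x => tlift (@?f x) (@?g x)) =>
      first [refine (linear_tliftl _ _); lin | refine (linear_tlift _ _); lin]
  | |- GRing.linear_for _ (fun x => alghom_fun (@?f x) (@?g x)) =>
      first [refine (linear_ah _ _); lin
            | linear_hyp lin]
  | |- GRing.linear_for _ (tmap _ _) => refine (tmap_linear _ _); lin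
  | |- GRing.linear_for _ (tlift _) => refine (tlift_linear _); lin
  | |- GRing.linear_for _ (GRing.mul _) => refine (linear_mulr _ _); exact: lin_id
  | |- GRing.linear_for _ (GRing.scale _) => refine (linear_scaler _ _); exact: lin_id
  | |- GRing.linear_for _ (tpure _) => exact: (tpure_bilin _ _).2
  | |- GRing.linear_for _ _ => first [assumption | exact: alghom_linear
      | linear_hyp lin] end.

Section Functionals.
Variables (k : fieldType) (W : lmodType k).
Local Open Scope classical_set_scope.

(** A subspace [M] maximal among those avoiding [x] is a complement of the line through [x]: every
    [y] is [c x] modulo [M] for a unique [c], and [y -> c] is the functional. *)
Lemma functional_sep (x : W) : x != 0 ->
  exists f : W -> k^o, linear f /\ f x = 1.
Proof.
move=> x0.
pose P (A : set W) := (forall (c : k) u v, A u -> A v -> A (c *: u + v)) /\ ~ A x.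
have [|M [[clM Mx] maxM]] := @Zorn_bigcup W P.
  move=> F FP Ftot; split; last by move=> [A FA Ax]; case: (FP _ FA).
  move=> c u v [A FA Au] [B FB Bv].
  have [AB|BA] := Ftot _ _ FA FB.
    by exists B => //; apply: (FP _ FB).1 => //; apply: AB.
  by exists A => //; apply: (FP _ FA).1 => //; apply: BA.
(* The empty set also satisfies [P]; if [M] were empty, the set containing only 0 would be
   larger. *)
have M0 : M 0.
  have [[u Mu]|Mn] := pselect (exists u, M u).
    by have := clM (-1) u u Mu Mu; rewrite scaleN1r addNr.
  exfalso; refine (maxM [set 0] _ _).
    split=> [y My|/(_ 0 erefl) M0]; first by case: Mn; exists y.
    by apply: Mn; exists 0.
  split=> [c u v -> ->|e]; first by rewrite scaler0 addr0.
  by rewrite e eqxx in x0.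
have MZ c u : M u -> M (c *: u) by move=> Mu; rewrite -[_ *: _]addr0; apply: clM.
have ex y : {c : k | M (y - c *: x)}.
  apply: cid; have [My|My] := pselect (M y).
    by exists 0; rewrite scale0r subr0.
  (* The span of [y] and [M] is larger than [M], so it contains [x = b y + m]; solving for [y] gives
     the coefficient [b^-1]. *)
  pose B := [set z | exists b m, M m /\ z = b *: y + m].
  have [[b [m [Mm e]]]|Bx] := pselect (B x); last first.
    exfalso; refine (maxM B _ _).
      split=> [z Mz|BM]; first by exists 0, z; rewrite scale0r add0r.
      by apply: My; apply: BM; exists 1, 0; rewrite scale1r addr0.
    split=> // c u v [b [m [Mm ->]]] [b' [m' [Mm' ->]]].
    exists (c * b + b'), (c *: m + m'); split; first exact: clM.
    by rewrite scalerDr scalerA addrACA scalerDl.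
  have b0 : b != 0.
    by apply: contra_not_neq Mx => b0; rewrite e b0 scale0r add0r.
  exists b^-1; rewrite e scalerDr scalerA mulVf // scale1r opprD addNKr -scaleNr.
  exact: MZ.
have uniq y c c' : M (y - c *: x) -> M (y - c' *: x) -> c = c'.
  move=> h h'; apply/eqP/negPn/negP => cc'; apply: Mx.
  have := clM (-1) _ _ h h'; rewrite scaleN1r opprB addrA subrK -scalerBl.
  move=> /(MZ (c - c')^-1); rewrite scalerA mulVf ?scale1r //.
  by rewrite subr_eq0.
exists (fun y => sval (ex y)); split=> [c u v|].
  apply: (uniq _ _ _ (svalP (ex _))).
  rewrite scalerDl opprD addrACA -scalerA -scalerBr.
  exact: clM (svalP (ex u)) (svalP (ex v)).
by apply: (uniq _ _ _ (svalP (ex x))); rewrite scale1r subrr.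
Qed.

(* Finite rank operators [sum f_k w_k] replace a basis of W. *)
Lemma finite_rank_id (s : seq W) :
  exists L : seq ({f : W -> k^o | linear f} * W),
    forall x, x \in s -> x = \sum_(p <- L) sval p.1 x *: p.2.
Proof.
elim: s => [|x s [L hL]]; first by exists [::].
(* The defect of the operator built so far, which vanishes on [s]. If [q x] is not 0, adding the
   rank one operator [y -> f(q y) (q x)] with [f(q x) = 1] repairs [x] without disturbing [s]. *)
pose q y := y - \sum_(p <- L) sval p.1 y *: p.2.
have lq : linear q.
  move=> c u v; rewrite /q scalerBr addrACA -opprD; congr (_ - _).
  rewrite scaler_sumr -big_split; apply: eq_bigr => p _ /=.
  by rewrite (svalP p.1) scalerDl scalerA.
have qs y : y \in s -> q y = 0 by move=> /hL e; rewrite /q -e subrr.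
have [qx|] := eqVneq (q x) 0.
  exists L => y; rewrite inE => /orP[/eqP->|/hL//].
  by apply/eqP; rewrite -subr_eq0; apply/eqP.
move=> /functional_sep[f [lf fx]].
have lfq : linear (fun y => f (q y)) by lin.
exists ((exist _ _ lfq, q x) :: L) => y; rewrite inE big_cons /=.
move=> /orP[/eqP->|ys]; first by rewrite fx scale1r /q subrK.
by rewrite qs // (lin0 lf) scale0r add0r; apply: hL.
Qed.
End Functionals.

Section Slices.
Variables (k : fieldType) (V W : lmodType k).

Definition slice (f : W -> k^o) (x : tens V W) : V :=
  tlift (fun v w => f w *: v) x.

Lemma slice_bilin (f : W -> k^o) : linear f ->
  bilin (fun (v : V) w => f w *: v).
Proof. move=> lf; lin. Qed.
Lemma slice_linear f : linear f -> linear (slice f).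
Proof. by move=> lf; apply/tlift_linear/slice_bilin. Qed.
Lemma sliceE f v w : linear f -> slice f (tpure v w) = f w *: v.
Proof. by move=> lf; rewrite /slice tliftE //; exact: slice_bilin. Qed.

(** [L] stands for a finite rank operator on [W]. By hypothesis it fixes the second legs of a
    representative of [x], so applying it to the second leg of [x] changes nothing. *)
Lemma slice_expand (x : tens V W) (L : seq ({f : W -> k^o | linear f} * W)) :
  (forall q, q \in repr x -> q.2 = \sum_(p <- L) sval p.1 q.2 *: p.2) ->
  x = \sum_(p <- L) tpure (slice (sval p.1) x) p.2.
Proof.
move=> hL; have lD : linear (fun y => \sum_(p <- L) tpure (slice (sval p.1) y) p.2).
  move=> c u v; rewrite scaler_sumr -big_split; apply: eq_bigr => p _ /=.
  by rewrite (slice_linear (svalP p.1)) (tpure_bilin _ _).1.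
rewrite {2}(tens_sum x) (lin_sum lD) {1}(tens_sum x).
rewrite !big_seq; apply: eq_bigr => q qx.
rewrite {1}(hL _ qx) (lin_sum ((tpure_bilin _ _).2 _)); apply: eq_bigr => p _.
rewrite sliceE; last exact: (svalP p.1).
by rewrite (linZ ((tpure_bilin _ _).2 _)) (linZ ((tpure_bilin _ _).1 _)).
Qed.

Lemma slice_decomp (x : tens V W) :
  exists L : seq ({f : W -> k^o | linear f} * W),
    x = \sum_(p <- L) tpure (slice (sval p.1) x) p.2.
Proof.
have [L hL] := finite_rank_id [seq p.2 | p <- repr x].
by exists L; apply: slice_expand => p px; apply: hL; rewrite map_f.
Qed.

Lemma slice_inj (x y : tens V W) :
  (forall f, linear f -> slice f x = slice f y) -> x = y.
Proof.
move=> h; apply/eqP; rewrite -subr_eq0; apply/eqP.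
have [L ->] := slice_decomp (x - y); apply: big1 => p _.
rewrite (linB (slice_linear (svalP p.1))) (h _ (svalP p.1)) subrr.
exact: (lin0 ((tpure_bilin _ _).1 _)).
Qed.
End Slices.

(** One finite rank operator can fix the second legs of all the [x i] at once. This uniformity in
    [i] is what permits gluing slices taken on different pieces. *)
Lemma slice_decomp_dep (k : fieldType) (I : finType) (V : I -> lmodType k)
    (W : lmodType k) (x : forall i, tens (V i) W) :
  exists L : seq ({f : W -> k^o | linear f} * W),
    forall i, x i = \sum_(p <- L) tpure (slice (sval p.1) (x i)) p.2.
Proof.
have [L hL] := finite_rank_id (flatten [seq [seq p.2 | p <- repr (x i)] | i <- enum I]).
exists L => i; apply: slice_expand => q qx; apply: hL.
by apply/flatten_mapP; exists i; rewrite ?mem_enum ?map_f.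
Qed.

Lemma slice_tmap (k : fieldType) (V V' W : lmodType k) (g : V -> V') (f : W -> k^o) x :
  linear g -> linear f -> slice f (tmap g id x) = g (slice f x).
Proof.
move=> lg lf; have lid := @lin_id k W; have ls := slice_linear (V := V) lf.
have ls' := slice_linear (V := V') lf.
move: x; apply: tens_lin_ext; [by lin|by lin|].
by move=> v w; rewrite tmapE // !sliceE // (linZ lg).
Qed.

(** Slicing commutes with the [g i] and slices separate tensors, so joint injectivity survives
    tensoring with [W]. *)
Lemma tmap_joint_inj (k : fieldType) (I : Type) (V W : lmodType k)
    (V' : I -> lmodType k) (g : forall i, V -> V' i) (x y : tens V W) :
  (forall i, linear (g i)) -> (forall u v, (forall i, g i u = g i v) -> u = v) ->
  (forall i, tmap (g i) id x = tmap (g i) id y) -> x = y.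
Proof.
move=> lg ginj h; apply: slice_inj => f lf; apply: ginj => i.
by rewrite -!slice_tmap // h.
Qed.

(** * Convolution *)

Section TensorLift.
Variable k : fieldType.
Implicit Types U V W Z : lmodType k.

Lemma lin_tlift V W Z Z' (g : Z -> Z') (F : V -> W -> Z) x : linear g ->
  g (tlift F x) = tlift (fun v w => g (F v w)) x.
Proof. by move=> lg; rewrite /tlift /fsum (lin_sum lg). Qed.

Lemma tlift_tmap V V' W W' Z (F : V' -> W' -> Z) (f : V -> V') (g : W -> W') x :
  bilin F -> linear f -> linear g ->
  tlift F (tmap f g x) = tlift (fun v w => F (f v) (g w)) x.
Proof.
move=> bF lf lg; rewrite /tmap (lin_tlift _ _ (tlift_linear bF)).
by apply: eq_tlift => v w; rewrite tliftE.
Qed.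

Lemma tmap_comp V V' V'' W W' W'' (f : V -> V') (f' : V' -> V'') (g : W -> W')
    (g' : W' -> W'') x : linear f -> linear f' -> linear g -> linear g' ->
  tmap f' g' (tmap f g x) = tmap (fun v => f' (f v)) (fun w => g' (g w)) x.
Proof. by move=> lf lf' lg lg'; rewrite {1}/tmap tlift_tmap //; exact: tmap_bilin. Qed.

Lemma eq_tmap V V' W W' (f f' : V -> V') (g g' : W -> W') x :
  f =1 f' -> g =1 g' -> tmap f g x = tmap f' g' x.
Proof. by move=> e e'; apply: eq_tlift => v w; rewrite e e'. Qed.

Lemma tmap_id V W (x : tens V W) : tmap id id x = x.
Proof.
have l := @lin_id k V; have l' := @lin_id k W.
by move: x; apply: tens_lin_ext => [||v w]; [lin|lin|rewrite tmapE].
Qed.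

Lemma tassoc_linear U V W : linear (@tassoc k U V W).
Proof. by apply: tlift_linear; lin. Qed.

Lemma tlift_tassoc U V W Z (F : tens U V -> W -> Z) x : bilin F ->
  tlift F (tassoc x) = tlift (fun u y => tlift (fun v w => F (tpure u v) w) y) x.
Proof.
move=> bF; rewrite /tassoc (lin_tlift _ _ (tlift_linear bF)).
apply: eq_tlift => u y; rewrite (lin_tlift _ _ (tlift_linear bF)).
by apply: eq_tlift => v w; rewrite tliftE.
Qed.

Lemma tlift_tmul (A B : alg k) Z (F : A -> B -> Z) (x y : talg A B) : bilin F ->
  tlift F (x * y) =
  tlift (fun (a : A) (b : B) => tlift (fun (a' : A) (b' : B) => F (a * a') (b * b')) y) x.
Proof.
move=> bF; rewrite [x * y]/(tmul x y) /tmul (lin_tlift _ _ (tlift_linear bF)).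
apply: eq_tlift => a b; rewrite (lin_tlift _ _ (tlift_linear bF)).
by apply: eq_tlift => a' b'; rewrite tliftE.
Qed.

Lemma linear_scalar V (f : V -> k) : scalar f -> linear (f : V -> k^o).
Proof. by []. Qed.

Lemma tpureM (A B : alg k) (a a' : A) (b b' : B) :
  (tpure a b : talg A B) * (tpure a' b' : talg A B) = tpure (a * a') (b * b').
Proof. exact: tmulE. Qed.

Lemma tpure11 (A B : alg k) : (1 : talg A B) = tpure (1 : A) (1 : B).
Proof. by []. Qed.

Lemma tmap_monoid (A A' B B' : alg k) (f : alghom A A') (g : alghom B B') :
  monoid_morphism (tmap f g : talg A B -> talg A' B').
Proof.
have lf := alghom_linear f; have lg := alghom_linear g.
split; first by rewrite tpure11 tmapE // !ah1.
move=> x y; elim/tens_ind: x => [|a b|x x' hx hx'].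
- by rewrite mul0r (lin0 (tmap_linear lf lg)) mul0r.
- elim/tens_ind: y => [|a' b'|y y' hy hy'].
  + by rewrite mulr0 (lin0 (tmap_linear lf lg)) mulr0.
  + by rewrite tpureM !tmapE // tpureM !ahM.
  + by rewrite mulrDr !(linD (tmap_linear lf lg)) hy hy' mulrDr.
- by rewrite mulrDl !(linD (tmap_linear lf lg)) hx hx' mulrDl.
Qed.
Definition tmap_ah (A A' B B' : alg k) (f : alghom A A') (g : alghom B B') :
  alghom (talg A B) (talg A' B') :=
  @AlgHom k (talg A B) (talg A' B') _ (tmap_linear (alghom_linear f) (alghom_linear g)) (tmap_monoid f g).

Lemma id_monoid (A : alg k) : monoid_morphism (@id A). Proof. by []. Qed.
Definition id_ah (A : alg k) : alghom A A := AlgHom (@lin_id k A) (id_monoid A).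

Lemma tinl_monoid (A B : alg k) : monoid_morphism (fun a : A => tpure a (1 : B) : talg A B).
Proof. by split=> // x y; rewrite tpureM mulr1. Qed.
Definition tinl (A B : alg k) : alghom A (talg A B) :=
  @AlgHom k A (talg A B) _ (linear_tpurel _ (@lin_id k A)) (tinl_monoid A B).
Lemma tinr_monoid (A B : alg k) : monoid_morphism (fun b : B => tpure (1 : A) b : talg A B).
Proof. by split=> // x y; rewrite tpureM mulr1. Qed.
Definition tinr (A B : alg k) : alghom B (talg A B) :=
  @AlgHom k B (talg A B) _ (linear_tpurer _ (@lin_id k B)) (tinr_monoid A B).
Lemma tinlr (A B : alg k) (a : A) (b : B) : tinl A B a * tinr A B b = tpure a b.
Proof. by rewrite tpureM mulr1 mul1r. Qed.
Lemma tinrl (A B : alg k) (a : A) (b : B) : tinr A B b * tinl A B a = tpure a b.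
Proof. by rewrite tpureM mulr1 mul1r. Qed.
End TensorLift.

Section Convolution.
Variables (k : fieldType) (H : hopf k).

Lemma comul_linear : linear (comul H : H -> tens H H).
Proof. exact (alghom_linear (comul H)). Qed.
Lemma coact_linear (E : comod_alg H) : linear (coact E : E -> tens E H).
Proof. exact (alghom_linear (coact E)). Qed.

(** With [E = H] the action [act] below becomes convolution, so most convolution laws are instances
    of laws of the action. *)
Definition self_comod : comod_alg H :=
  @ComodAlg k H H (comul H) (fun h => esym (comulA h)) (@counitr k H).

Section Act.
Variable E : comod_alg H.

Lemma coact_assoc (Z : lmodType k) (F : E -> H -> H -> Z) (x : E) :
  (forall h h', linear (fun x => F x h h')) -> (forall x h', linear (fun h => F x h h')) ->
  (forall x h, linear (F x h)) ->
  tlift (fun x0 h => tlift (fun x1 x2 => F x1 x2 h) (coact E x0)) (coact E x) =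
  tlift (fun x0 h => tlift (F x0) (comul H h)) (coact E x).
Proof.
move=> l1 l2 l3; have l3' h h' : linear (fun y => F h h' y) by exact: l3.
have bF : bilin (fun (u : tens E H) h => tlift (fun x1 x2 => F x1 x2 h) u).
  split; first by move=> h; apply: tlift_linear; split.
  by move=> u; apply: linear_tliftl.
have lid := @lin_id k H.
have := congr1 (tlift (fun (u : tens E H) h => tlift (fun x1 x2 => F x1 x2 h) u)) (coactA x).
rewrite tlift_tmap //; last exact: coact_linear.
move=> ->; rewrite /id_comul (tlift_tassoc _ bF) tlift_tmap //; last 2 first.
- split=> [y|u].
    by apply: linear_tliftl => h h'; apply: linear_tlift; [split|exact: linear_tpurel].
  apply: tlift_linear; split=> [h|h].
    by apply: linear_tlift; [split|exact: linear_tpurer].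
  by apply: linear_tliftl.
- exact: comul_linear.
by apply: eq_tlift => x0 h; apply: eq_tlift => h1 h2; rewrite tliftE //; split.
Qed.

(* The action of the convolution algebra Hom(H, A) on Hom(E, A). *)
Definition act (A : alg k) (f : E -> A) (g : H -> A) (x : E) : A :=
  tlift (fun (x0 : E) (x1 : H) => f x0 * g x1) (coact E x).

Definition conv_one (A : alg k) (h : H) : A := counit h *: (1 : A).

Lemma act_bilin (A : alg k) (f : E -> A) (g : H -> A) : linear f -> linear g ->
  bilin (fun (x0 : E) (x1 : H) => f x0 * g x1).
Proof. move=> lf lg; lin. Qed.
Lemma act_linear (A : alg k) (f : E -> A) (g : H -> A) :
  linear f -> linear g -> linear (act f g).
Proof. by move=> lf lg; exact: linear_tlift (act_bilin lf lg) (@coact_linear E). Qed.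
Lemma eq_act (A : alg k) (f f' : E -> A) (g g' : H -> A) :
  f =1 f' -> g =1 g' -> act f g =1 act f' g'.
Proof. by move=> ef eg x; apply: eq_tlift => v w; rewrite ef eg. Qed.
Lemma act_one (A : alg k) (f : E -> A) : linear f -> act f (@conv_one A) =1 f.
Proof.
move=> lf x; rewrite -{2}(coact_counit x) (lin_tlift _ _ lf).
by apply: eq_tlift => v w; rewrite /conv_one -ascalerAr mulr1 (linZ lf).
Qed.
Lemma ah_act (A A' : alg k) (p : alghom A A') (f : E -> A) (g : H -> A) x :
  p (act f g x) = act (fun y => p (f y)) (fun h => p (g h)) x.
Proof.
by rewrite /act (lin_tlift _ _ (alghom_linear p)); apply: eq_tlift => v w; rewrite ahM.
Qed.
End Act.

Definition conv (A : alg k) (f g : H -> A) (h : H) : A :=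
  tlift (fun h1 h2 : H => f h1 * g h2) (comul H h).

Lemma act_assoc (E : comod_alg H) (A : alg k) (f : E -> A) (g g' : H -> A) :
  linear f -> linear g -> linear g' -> act (act f g) g' =1 act f (conv g g').
Proof.
move=> lf lg lg' x; rewrite /act.
under eq_tlift => v w do
  rewrite (lin_tlift _ _ (linear_mull (g' w) (@lin_id k A))) /=.
rewrite (coact_assoc (F := fun v h h' => f v * g h * g' h')); [|lin|lin|lin].
apply: eq_tlift => v w; rewrite /conv.
rewrite [RHS](lin_tlift _ _ (linear_mulr (f v) (@lin_id k A))).
by apply: eq_tlift => h h'; rewrite mulrA.
Qed.

Section Conv.
Variable A : alg k.
Implicit Types f g : H -> A.

Lemma conv_linear f g : linear f -> linear g -> linear (conv f g).
Proof. exact: (act_linear (E := self_comod)). Qed.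
Lemma eq_conv f f' g g' : f =1 f' -> g =1 g' -> conv f g =1 conv f' g'.
Proof. exact: (eq_act (E := self_comod)). Qed.
Lemma conv_assoc f g g' : linear f -> linear g -> linear g' ->
  conv (conv f g) g' =1 conv f (conv g g').
Proof. exact: (act_assoc (E := self_comod)). Qed.
Lemma conv_oner f : linear f -> conv f (@conv_one A) =1 f.
Proof. exact: (act_one (E := self_comod)). Qed.
Lemma conv_onel f : linear f -> conv (@conv_one A) f =1 f.
Proof.
move=> lf h; rewrite -{2}(counitl h) (lin_tlift _ _ lf).
by apply: eq_tlift => v w; rewrite /conv_one -ascalerAl mul1r (linZ lf).
Qed.
Lemma ah_conv (A' : alg k) (p : alghom A A') f g h :
  p (conv f g h) = conv (fun h => p (f h)) (fun h => p (g h)) h.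
Proof. exact: (ah_act (E := self_comod)). Qed.
Lemma ah_conv_one (A' : alg k) (p : alghom A A') h :
  p (conv_one A h) = conv_one A' h.
Proof. by rewrite /conv_one (linZ (alghom_linear p)) ah1. Qed.

Lemma conv_cancel f g g' : linear f -> linear g -> linear g' ->
  conv f g =1 @conv_one A -> conv f (conv g g') =1 g'.
Proof.
move=> lf lg lg' e h; rewrite -conv_assoc // (eq_conv e (fun _ => erefl)).
exact: conv_onel.
Qed.
Lemma conv_inv_uniq f g g' : linear f -> linear g -> linear g' ->
  conv f g =1 @conv_one A -> conv g g' =1 @conv_one A -> f =1 g'.
Proof.
move=> lf lg lg' e e' h; rewrite -[RHS](conv_cancel lf lg lg' e).
by rewrite (eq_conv (fun _ => erefl) e') conv_oner.
Qed.
End Conv.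

Lemma conv_antipodel (A : alg k) (p : alghom H A) :
  conv (fun h => p (antipode h)) p =1 @conv_one A.
Proof.
move=> h; rewrite -(ah_conv_one p) /conv_one -antipodel.
by rewrite (lin_tlift _ _ (alghom_linear p)); apply: eq_tlift => v w; rewrite ahM.
Qed.
Lemma conv_antipoder (A : alg k) (p : alghom H A) :
  conv p (fun h => p (antipode h)) =1 @conv_one A.
Proof.
move=> h; rewrite -(ah_conv_one p) /conv_one -antipoder.
by rewrite (lin_tlift _ _ (alghom_linear p)); apply: eq_tlift => v w; rewrite ahM.
Qed.

(** Since [x0 (x) x1] is the product of [x0 (x) 1] and [1 (x) x1], the coaction is itself of the
    form [act]. Identities about coactions thereby become cancellations in a convolution algebra. *)
Lemma coactE (E : comod_alg H) (x : E) : coact E x = act (tinl E H) (tinr E H) x.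
Proof.
rewrite {1}(tens_sum (coact E x)); apply: eq_bigr => p _; exact/esym/tinlr.
Qed.

(** [comul o S] is a left convolution inverse of [comul], and [sum S(h2) (x) S(h1)] is a right one:
    writing the coproduct as [(h1 (x) 1)(1 (x) h2)], the two factors cancel one after the other. *)
Lemma comul_antipode h :
  comul H (antipode h) =
  conv (fun h => tinr H H (antipode h)) (fun h => tinl H H (antipode h)) h.
Proof.
have lS := @antipode_linear k H; have lD := alghom_linear (comul H).
have ll := alghom_linear (tinl H H); have lr := alghom_linear (tinr H H).
have lS1 : linear (fun h => tinl H H (antipode h)) by lin.
have lS2 : linear (fun h => tinr H H (antipode h)) by lin.
have lS3 : linear (fun h => comul H (antipode h)) by lin.
have lc := conv_linear lS2 lS1.
apply: (conv_inv_uniq lS3 lD lc (conv_antipodel _)) => {}h.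
rewrite (eq_conv (coactE (E := self_comod)) (fun _ => erefl)).
rewrite [LHS](conv_assoc ll lr lc).
rewrite (eq_conv (fun _ => erefl) (conv_cancel lr lS2 lS1 (conv_antipoder _))).
exact: conv_antipoder.
Qed.

Lemma antipode1 : antipode (1 : H) = 1.
Proof.
have := antipodel (1 : H); rewrite ah1 tliftE ?mulr1 //.
  by rewrite (counit_monoid H).1 scale1r.
have lS := @antipode_linear k H; lin.
Qed.

(* [S(xy) = S(y)S(x)]: [m x y = sum S(x1 y) x2] is [eps(x) S(y)], since it is
   a left convolution inverse of id in the variable y. *)
Lemma antipodeM (x y : H) : antipode (x * y) = antipode y * antipode x.
Proof.
have lS := @antipode_linear k H; have lid := @lin_id k H.
have lc := linear_scalar (@counit_linear k H).
pose m x y := conv (fun x => antipode (x * y)) id x.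
have lm1 y' : linear (fun x => m x y') by apply: conv_linear; lin.
have lm2 x' : linear (fun y => m x' y) by rewrite /m /conv /=; lin.
have hm x' y' : conv (m x') id y' = counit x' *: conv_one H y'.
  rewrite /conv_one scalerA -(counit_monoid H).2 -antipodel ahM tlift_tmul; last by lin.
  rewrite /m /conv.
  under eq_tlift => v w do
    rewrite (lin_tlift _ _ (linear_mull w (@lin_id k H))) /=.
  rewrite /tlift /fsum exchange_big /=; apply: eq_bigr => p _; apply: eq_bigr => q _.
  by rewrite mulrA.
have hmS x' y' : m x' y' = counit x' *: antipode y'.
  rewrite -[LHS](conv_oner (lm2 x')).
  rewrite -(eq_conv (fun _ => erefl) (conv_antipoder (id_ah H))).
  rewrite -(conv_assoc (lm2 x') lid lS) (eq_conv (hm x') (fun _ => erefl)) /conv.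
  rewrite -{2}(counitl y') (lin_tlift _ _ lS) [RHS](lin_tlift _ _ (linear_scaler _ lid)).
  apply: eq_tlift => v w.
  by rewrite (linZ lS) /conv_one -!ascalerAl mul1r.
(* The same device in the variable [x]: in [S(x y) = sum S(x1 y) x2 S(x3)] the first two factors
   collapse to [eps(x1) S(y)]. *)
have lSy : linear (fun x : H => antipode (x * y)) by lin.
rewrite -[LHS](conv_oner lSy) -(eq_conv (fun _ => erefl) (conv_antipoder (id_ah H))).
rewrite -(conv_assoc lSy lid lS) (eq_conv (fun x' : H => hmS x' y) (fun _ => erefl)) /conv.
rewrite -{2}(counitl x) (lin_tlift _ _ lS) [RHS](lin_tlift _ _ (linear_mulr _ lid)).
by apply: eq_tlift => v w; rewrite (linZ lS) -ascalerAl ascalerAr.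
Qed.
End Convolution.

(** * Opposite algebras *)

(** The inverses of the antipode and of the action on forms are written with the total function
    [pinv]; for a bijection its default value is never reached. *)
Lemma pinv_cancel (T U : Type) (d : U -> T) (f : T -> U) : bijective f ->
  cancel f ('pinv_d setT f) /\ cancel ('pinv_d setT f) f.
Proof.
move=> [g fK gK]; split=> x.
  by apply: pinvKV; rewrite ?inE // => a b _ _; exact: (can_inj fK).
by apply: pinvK; rewrite inE; exists (g x).
Qed.

Lemma lin_can2 (k : fieldType) (U V : lmodType k) (f : U -> V) (g : V -> U) :
  linear f -> cancel f g -> cancel g f -> linear g.
Proof. by move=> lf fK gK c x y; apply: (can_inj fK); rewrite lf !gK. Qed.

Section Opposite.
Variable k : fieldType.

(** The carrier and the linear structure are kept, so linear maps, tensors and coproducts of the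
    original serve for the opposite by conversion. *)
Definition opalg (A : alg k) : alg k :=
  @Alg k A (1 : A) (fun x y : A => y * x : A)
    (fun x y z => esym (mulrA z y x)) (fun x => mulr1 x) (fun x => mul1r x)
    (fun x y z => mulrDr z x y) (fun x y z => mulrDl y z x)
    (fun c x y => ascalerAr c y x) (fun c x y => ascalerAl c y x).

Lemma op_ah_monoid (A B : alg k) (f : alghom A B) :
  monoid_morphism (f : opalg A -> opalg B).
Proof. by split=> [|x y]; [exact: (ah1 f)|exact: (ahM f y x)]. Qed.
Definition op_ah (A B : alg k) (f : alghom A B) : alghom (opalg A) (opalg B) :=
  @AlgHom k (opalg A) (opalg B) f (alghom_linear f) (op_ah_monoid f).

Lemma tmul_op (A B : alg k) (x y : tens A B) :
  (x : talg (opalg A) (opalg B)) * (y : talg (opalg A) (opalg B)) =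
  (y : talg A B) * (x : talg A B).
Proof.
move: y; apply: tens_lin_ext => [||a b].
- exact: (@linear_mulr k _ (talg (opalg A) (opalg B)) id x (@lin_id k _)).
- exact: (@linear_mull k _ (talg A B) id x (@lin_id k _)).
move: x; apply: tens_lin_ext => [||a' b'].
- exact: (@linear_mull k _ (talg (opalg A) (opalg B)) id (tpure a b) (@lin_id k _)).
- exact: (@linear_mulr k _ (talg A B) id (tpure a b) (@lin_id k _)).
by rewrite [LHS]tmulE [RHS]tmulE.
Qed.

Lemma op_tens_monoid (A B C : alg k) (f : alghom A (talg B C)) :
  monoid_morphism (f : opalg A -> talg (opalg B) (opalg C)).
Proof.
by split=> [|x y]; [exact: (ah1 f)|rewrite [RHS]tmul_op; exact: (ahM f y x)].
Qed.
Definition op_tens_ah (A B C : alg k) (f : alghom A (talg B C)) :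
    alghom (opalg A) (talg (opalg B) (opalg C)) :=
  @AlgHom k (opalg A) (talg (opalg B) (opalg C)) f (alghom_linear f) (op_tens_monoid f).

Section OpHopf.
Variables (H : hopf k) (S_bij : bijective (@antipode k H)).

Lemma antipodeVK : cancel (@antipodeV k H) (@antipode k H).
Proof. exact: (pinv_cancel _ S_bij).2. Qed.
Lemma antipodeKV : cancel (@antipode k H) (@antipodeV k H).
Proof. exact: (pinv_cancel _ S_bij).1. Qed.
Lemma antipodeV_linear : linear (@antipodeV k H).
Proof. exact: (lin_can2 (@antipode_linear k H) antipodeKV antipodeVK). Qed.

(** Applying [S], which reverses products, turns [h2 S^-1(h1)] into [h1 S(h2)]. With its mirror
    image this makes [S^-1] an antipode for the reversed product. *)
Lemma antipodeV_l (h : H) :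
  tlift (fun h1 h2 : H => h2 * antipodeV h1) (comul H h) = counit h *: (1 : H).
Proof.
have lS := @antipode_linear k H.
apply: (can_inj antipodeKV); rewrite (linZ lS) antipode1 -antipoder (lin_tlift _ _ lS).
by apply: eq_tlift => v w; rewrite antipodeM antipodeVK.
Qed.
Lemma antipodeV_r (h : H) :
  tlift (fun h1 h2 : H => antipodeV h2 * h1) (comul H h) = counit h *: (1 : H).
Proof.
have lS := @antipode_linear k H.
apply: (can_inj antipodeKV); rewrite (linZ lS) antipode1 -antipodel (lin_tlift _ _ lS).
by apply: eq_tlift => v w; rewrite antipodeM antipodeVK.
Qed.

Lemma op_counit_monoid : monoid_morphism (@counit k H : opalg H -> k).
Proof.
split=> [|x y]; first exact: (counit_monoid H).1.
by rewrite mulrC; exact: (counit_monoid H).2.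
Qed.

Definition ophopf : hopf k :=
  @Hopf k (opalg H) (op_tens_ah (comul H)) (@counit k H) (@antipodeV k H)
    (@comulA k H) (@counit_linear k H) op_counit_monoid
    (@counitl k H) (@counitr k H) antipodeV_linear antipodeV_l antipodeV_r.

Definition opcomod (E : comod_alg H) : comod_alg ophopf :=
  @ComodAlg k ophopf (opalg E) (op_tens_ah (coact E)) (@coactA k H E)
    (@coact_counit k H E).
End OpHopf.
End Opposite.

(** * Gauge transformations and convolution *)

Section Translation.
Variables (k : fieldType) (H : hopf k).

Lemma act_colinear (E E' : comod_alg H) (A : alg k) (p : E' -> E) (f : E -> A)
    (g : H -> A) (x : E') : linear p -> linear f -> linear g ->
  coact E (p x) = tmap p id (coact E' x) ->
  act f g (p x) = act (fun y => f (p y)) g x.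
Proof.
move=> lp lf lg e; rewrite /act e tlift_tmap //; exact: act_bilin.
Qed.

(** Coinvariance gives [coact (b x) = sum b x0 (x) x1], so [b] factors out on the left. Linearity of
    translations over coinvariants comes from here. *)
Lemma act_coinv (E : comod_alg H) (A : alg k) (f : alghom E A) (g : H -> A) (b x : E) :
  linear g -> coact E b = tpure b (1 : H) -> act f g (b * x) = f b * act f g x.
Proof.
move=> lg e; have lf := alghom_linear f.
rewrite /act ahM e tlift_tmul; last by lin.
rewrite tliftE; last by apply: bilin_tlift => v w; lin.
rewrite (lin_tlift _ _ (linear_mulr (f b) (@lin_id k A))); apply: eq_tlift => v w.
by rewrite ahM mul1r mulrA.
Qed.

Lemma conv1 (A : alg k) (f g : H -> A) : linear f -> linear g ->
  conv f g 1 = f 1 * g 1.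
Proof. by move=> lf lg; rewrite /conv ah1 tliftE //; lin. Qed.

Lemma tmap_act (E : comod_alg H) (E' : alg k) (f : E -> E') (x : E) :
  tmap f id (coact E x) = act (fun y => tinl E' H (f y)) (tinr E' H) x.
Proof. by apply: eq_tlift => v w; rewrite tinlr. Qed.

Variable E : comod_alg H.

Definition transl (g : H -> E) : E -> E := act id g.

Lemma transl_linear (g : H -> E) : linear g -> linear (transl g).
Proof. by apply: act_linear; exact: lin_id. Qed.

(** The two legs commute, so [g(h2) (x) S(h1) h3] is the product of [1 (x) S(h1)], [g(h2) (x) 1] and
    [1 (x) h3] in the order of the Sweedler indices. In this form covariance can be cancelled
    against a coaction. *)
Lemma sweedler3_conv (g : H -> E) h : linear g ->
  sweedler3 (fun h1 h2 h3 => tpure (g h2) (antipode h1 * h3)) h =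
  conv (conv (fun h => tinr E H (antipode h)) (fun h => tinl E H (g h))) (tinr E H) h.
Proof.
move=> lg; have lS := @antipode_linear k H; have lid := @lin_id k H.
have lD := @comul_linear k H.
rewrite /sweedler3 tlift_tmap //; last first.
  split=> [w|u]; last by apply: linear_tliftl => v w; lin.
  by apply: tlift_linear; lin.
apply: eq_tlift => v w; rewrite /conv.
rewrite [RHS](lin_tlift _ _ (linear_mull (A := talg E H) _ (@lin_id k _))).
by apply: eq_tlift => a b; rewrite tinrl tpureM mulr1.
Qed.

(* The correspondence [a <-> g] of the context, for an arbitrary comodule algebra. *)
Definition gauge_corr (a : E -> E) (g : H -> E) : Prop :=
  [/\ linear g, g 1 = 1, forall f, a f = transl g f &
      forall h, coact E (g h) =
        sweedler3 (fun h1 h2 h3 => tpure (g h2) (antipode h1 * h3)) h].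

(** The coaction of [x0 g(x1)] is [(x0 (x) 1)(1 (x) x1)(1 (x) S(x2))(g(x3) (x) 1)(1 (x) x4)]; the
    second and third factors cancel. *)
Lemma transl_coact a g : gauge_corr a g ->
  forall x, coact E (transl g x) = tmap (transl g) id (coact E x).
Proof.
move=> [lg _ _ gco] x.
have ll := alghom_linear (tinl E H); have lr := alghom_linear (tinr E H).
have lS := @antipode_linear k H; have lD := alghom_linear (coact E).
have l1 : linear (fun h => tinr E H (antipode h)) by lin.
have l2 : linear (fun h => tinl E H (g h)) by lin.
have l21 : linear (fun h => coact E (g h)) by lin.
have l3 := conv_linear l2 lr; have l4 := conv_linear l1 l2.
rewrite /transl ah_act tmap_act.
have e1 h : coact E (g h) = conv (fun h => tinr E H (antipode h))
    (conv (fun h => tinl E H (g h)) (tinr E H)) h.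
  by rewrite gco sweedler3_conv // conv_assoc.
rewrite (eq_act (@coactE k H E) e1).
rewrite act_assoc //; last exact: conv_linear.
rewrite (eq_act (fun _ => erefl) (conv_cancel lr l1 l3 (conv_antipoder (tinr E H)))).
rewrite -(act_assoc ll l2 lr); apply: eq_act => // y.
by rewrite -(ah_act (tinl E H) id g y).
Qed.

(** Colinearity of the inner translation turns the composite into [sum x0 g'(x1) g(x2)], so the
    inner map comes first in the convolution product. *)
Lemma transl_comp (g g' : H -> E) : linear g -> linear g' ->
  (forall x, coact E (transl g' x) = tmap (transl g') id (coact E x)) ->
  forall x, transl g (transl g' x) = transl (conv g' g) x.
Proof.
move=> lg lg' co x; have lid := @lin_id k E; have lt := transl_linear lg'.
rewrite {1}/transl act_colinear //.
exact: (act_assoc lid lg' lg).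
Qed.

Lemma transl1 (g : H -> E) : linear g -> g 1 = 1 -> transl g 1 = 1.
Proof.
move=> lg g1; have lid := @lin_id k E.
by rewrite /transl /act ah1 tliftE ?g1 ?mulr1 //; exact: act_bilin.
Qed.

Lemma transl_coinv (g : H -> E) (b x : E) : linear g -> coact E b = tpure b (1 : H) ->
  transl g (b * x) = b * transl g x.
Proof. exact: (@act_coinv E E (id_ah E)). Qed.

Lemma transl_cancel a g aV gV : gauge_corr a g -> gauge_corr aV gV ->
  conv gV g =1 @conv_one k H E -> cancel (transl gV) (transl g).
Proof.
move=> ca caV e x; have [lg _ _ _] := ca; have [lgV _ _ _] := caV.
rewrite transl_comp //; last exact: transl_coact caV.
rewrite /transl (eq_act (fun _ => erefl) e); exact: act_one.
Qed.

(** The coaction of [x] is a finite sum of tensors whose first legs are slices of it. The criterion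
    is applied to the forms of a given degree and to the kernels of the [chi_i]. *)
Lemma transl_slices (N : E -> Prop) (g : H -> E) : linear g ->
  (forall x y, N x -> N y -> N (x + y)) -> N 0 -> (forall x h, N x -> N (x * g h)) ->
  (forall (f : H -> k^o) x, linear f -> N x -> N (slice f (coact E x))) ->
  forall x, N x -> N (transl g x).
Proof.
move=> lg ND N0 NM Ns x Nx; rewrite /transl /act.
have [L ->] := slice_decomp (coact E x : tens E H).
have bF := act_bilin (@lin_id k E) lg.
rewrite (lin_sum (tlift_linear bF)); apply: big_ind => // p _.
by rewrite tliftE //; apply: NM; apply: Ns => //; exact: svalP p.1.
Qed.
End Translation.

Lemma alghom_factor (k : fieldType) (P T Q : alg k) (p : alghom P T) (q : alghom P Q) :
  (forall y, exists f, p f = y) -> (forall f, p f = 0 -> q f = 0) ->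
  exists r : alghom T Q, forall f, r (p f) = q f.
Proof.
move=> ps pq; have [s sK] := choice ps.
have rE f : q (s (p f)) = q f.
  by apply/eqP; rewrite -subr_eq0 -ahB; apply/eqP/pq; rewrite ahB sK subrr.
have rl : linear (fun y => q (s y)).
  move=> c x y; have [f <-] := ps x; have [f' <-] := ps y.
  by rewrite -ahP !rE ahP.
have rm : monoid_morphism (fun y => q (s y)).
  split=> [|x y]; first by rewrite -(ah1 p) rE ah1.
  by have [f <-] := ps x; have [f' <-] := ps y; rewrite -ahM !rE ahM.
by exists (AlgHom rl rm).
Qed.

(** * Gauge maps of an abstract locally trivial comodule algebra *)

Section GaugeMap.
Variables (k : fieldType) (H : hopf k) (P : comod_alg H) (I : Type).
Variables (T : I -> comod_alg H) (chi : forall i, alghom P (T i)).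
Hypothesis chi_surj : forall i y, exists f, chi i f = y.
Hypothesis chi_coact : forall i f, coact (T i) (chi i f) = tmap (chi i) id (coact P f).
Hypothesis chi_inj : forall f f', (forall i, chi i f = chi i f') -> f = f'.
Hypothesis chi_glue : forall u : I -> P,
  (forall i j, exists x y, [/\ chi i x = 0, chi j y = 0 & u i - u j = x + y]) ->
  exists w, forall i, chi i w = chi i (u i).
Variable phi : forall i, alghom H (T i).
Hypothesis phi_coact : forall i h, coact (T i) (phi i h) = tmap (phi i) id (comul H h).
Variable C : forall i, T i -> Prop.
Hypothesis C_coinv : forall i b, C b -> coact (T i) b = tpure b (1 : H).
Hypothesis C_span : forall i (N : T i -> Prop), N 0 ->
  (forall b h, C b -> N (b * phi i h)) -> (forall x y, N x -> N y -> N (x + y)) ->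
  forall x, N x.

(** [C i] plays the part of [B_i (x) 1] and [phi i] that of [1 (x) H]. In these terms one argument
    serves both the trivial bundles and their opposites. *)
Definition gauge_loc i (ai : T i -> T i) : Prop :=
  [/\ linear ai, forall b x, C b -> ai (b * x) = b * ai x,
      forall x, coact (T i) (ai x) = tmap ai id (coact (T i) x) & ai 1 = 1].

Section Local.
Variables (i : I) (ai : T i -> T i) (gai : gauge_loc ai).

Definition loc_map : H -> T i :=
  conv (fun h => phi i (antipode h)) (fun h => ai (phi i h)).

Let lai : linear ai. Proof. by case: gai. Qed.
Let lphi := alghom_linear (phi i).
Let lS := @antipode_linear k H.
Let lphiS : linear (fun h => phi i (antipode h)). Proof. by lin. Qed.
Let laphi : linear (fun h => ai (phi i h)). Proof. by lin. Qed.

Lemma loc_map_linear : linear loc_map.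
Proof. exact: conv_linear. Qed.

Lemma loc_map1 : loc_map 1 = 1.
Proof. by rewrite /loc_map conv1 // antipode1 !ah1 mul1r; case: gai. Qed.

Lemma conv_phi_loc_map h : conv (phi i) loc_map h = ai (phi i h).
Proof. exact: conv_cancel lphi lphiS laphi (conv_antipoder (phi i)) h. Qed.

Lemma act_phi (A : alg k) (f : T i -> A) (g : H -> A) h : linear f -> linear g ->
  act f g (phi i h) = conv (fun h => f (phi i h)) g h.
Proof.
by move=> lf lg; apply: (act_colinear (E' := self_comod H)) => //; exact: phi_coact.
Qed.

(** Both sides commute with left multiplication by [C], and they agree on [phi i h] by
    [conv_phi_loc_map]; the products [b * phi i h] span. *)
Lemma gauge_loc_act y : ai y = act id loc_map y.
Proof.
have [_ aiC _ _] := gai; have lg := loc_map_linear; have lid := @lin_id k (T i).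
elim/C_span: y => [|b h Cb|x y hx hy].
- by rewrite (lin0 lai) (lin0 (act_linear lid lg)).
- rewrite aiC // (act_coinv (id_ah (T i))) //; last exact: C_coinv.
  by congr (_ * _); rewrite act_phi // conv_phi_loc_map.
- by rewrite (linD lai) (linD (act_linear lid lg)) hx hy.
Qed.

(** The coproduct of the antipode contributes [1 (x) S(h1)] on the left, colinearity of [ai]
    contributes the factor from [1 (x) H] on the right, and the two middle factors recombine to
    [loc_map]. *)
Lemma loc_map_coact h : coact (T i) (loc_map h) =
  conv (conv (fun h => tinr (T i) H (antipode h)) (fun h => tinl (T i) H (loc_map h)))
    (tinr (T i) H) h.
Proof.
have [_ _ aico _] := gai; have lid := @lin_id k H; have lg := loc_map_linear.
have ll := alghom_linear (tinl (T i) H); have lr := alghom_linear (tinr (T i) H).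
have l1 : linear (fun h => tinr (T i) H (antipode h)) by lin.
have l2 : linear (fun h => tinl (T i) H (phi i (antipode h))) by lin.
have l3 : linear (fun h => tinl (T i) H (ai (phi i h))) by lin.
have l4 : linear (fun h => tinl (T i) H (loc_map h)) by lin.
have e1 h' : coact (T i) (phi i (antipode h')) =
    conv (fun h => tinr (T i) H (antipode h)) (fun h => tinl (T i) H (phi i (antipode h))) h'.
  rewrite phi_coact comul_antipode.
  rewrite [LHS](ah_conv (tmap_ah (phi i) (id_ah H))); apply: eq_conv => h'' /=.
    by rewrite tmapE // ah1.
  by rewrite tmapE.
have e2 h' : coact (T i) (ai (phi i h')) =
    conv (fun h => tinl (T i) H (ai (phi i h))) (tinr (T i) H) h'.
  rewrite aico phi_coact tmap_comp // -/(coact (self_comod H) h').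
  exact: (tmap_act (E := self_comod H)).
rewrite {1}/loc_map ah_conv (eq_conv e1 e2).
rewrite conv_assoc //; last exact: conv_linear.
rewrite [RHS]conv_assoc //.
apply: eq_conv => // h'; rewrite -conv_assoc //; apply: eq_conv => // h''.
by rewrite -ah_conv.
Qed.
End Local.

Definition gauge (a : P -> P) : Prop := linear a /\
  forall i, exists ai, gauge_loc ai /\ forall f, chi i (a f) = ai (chi i f).

(* On [P / (ker chi_i + ker chi_j)] the map induced by [a] is the translation
   by the image of [g_i], and also the one by the image of [g_j]. *)
Lemma loc_map_compat (a : P -> P) i j ai aj (f f' : P) h :
  gauge_loc ai -> gauge_loc aj ->
  (forall f, chi i (a f) = ai (chi i f)) -> (forall f, chi j (a f) = aj (chi j f)) ->
  chi i f = loc_map ai h -> chi j f' = loc_map aj h ->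
  exists x y, [/\ chi i x = 0, chi j y = 0 & f - f' = x + y].
Proof.
move=> gai gaj hai haj ef ef'.
have lS := @antipode_linear k H; have [lai _ _ _] := gai; have [laj _ _ _] := gaj.
pose q := quo_pi (add_ideal (ker_ideal (chi i)) (ker_ideal (chi j))).
(* [ri], and likewise [rj], carries its chart to the quotient of [P] by the sum of the two kernels,
   where the local maps can be compared. *)
have [|ri hri] := @alghom_factor k P (T i) _ (chi i) q (chi_surj (i := i)).
  move=> x xK; rewrite -(ah0 q); apply/quo_piP; exists x, 0.
  by split; rewrite ?subr0 ?addr0 //; exact: ideal0.
have [|rj hrj] := @alghom_factor k P (T j) _ (chi j) q (chi_surj (i := j)).
  move=> x xK; rewrite -(ah0 q); apply/quo_piP; exists 0, x.
  by split; rewrite ?subr0 ?add0r //; exact: ideal0.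
have lri := alghom_linear ri; have lrj := alghom_linear rj.
have lci := alghom_linear (chi i); have lcj := alghom_linear (chi j).
have lpj := alghom_linear (phi j).
have lgi := loc_map_linear gai.
have lG : linear (fun h => ri (loc_map ai h)) by lin.
(* The map induced by [a] on the quotient, entered through the chart [j], is translation by the
   image of the local map of the chart [i]. *)
have hact y : rj (aj y) = act rj (fun h => ri (loc_map ai h)) y.
  have [p <-] := chi_surj y.
  rewrite -haj hrj -hri hai (gauge_loc_act gai) ah_act.
  rewrite (act_colinear (p := chi i)) // (act_colinear (p := chi j)) //.
  by apply: eq_act => // z; rewrite hri hrj.
suff e : ri (loc_map ai h) = rj (loc_map aj h).
  have /quo_piP[x [y [hx hy e']]] : q f = q f' by rewrite -hri -hrj ef ef'.
  by exists x, y.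
rewrite [in RHS]/loc_map ah_conv.
(* At [phi j h'] this leaves [phi j] convolved with the image of [loc_map ai]; the factor
   [phi j o S] in [loc_map aj] then cancels [phi j]. *)
have e1 h' : rj (aj (phi j h')) = conv (fun h => rj (phi j h)) (fun h => ri (loc_map ai h)) h'.
  by rewrite hact act_phi.
rewrite (eq_conv (fun _ => erefl) e1); apply/esym.
have l1 : linear (fun h => rj (phi j (antipode h))) by lin.
have l2 : linear (fun h => rj (phi j h)) by lin.
exact: (conv_cancel l1 l2 lG (conv_antipodel (alghom_comp rj (phi j)))).
Qed.

Lemma gauge_map_exists a : gauge a -> exists g, gauge_corr a g.
Proof.
move=> [la hloc]; pose ai i := sval (cid (hloc i)).
have gai i : gauge_loc (ai i) by case: (svalP (cid (hloc i))).
have aiE i f : chi i (a f) = ai i (chi i f) by case: (svalP (cid (hloc i))).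
(* For each [h], preimages of the local values differ on every pair by an element of the sum of the
   kernels, hence they glue. The clauses of [gauge_corr] are then checked chart by chart. *)
have /choice[g hg] (h : H) : exists w : P, forall i, chi i w = loc_map (ai i) h.
  pose u i := sval (cid (chi_surj (loc_map (ai i) h))).
  have hu i : chi i (u i) = loc_map (ai i) h by exact: (svalP (cid (chi_surj (loc_map (ai i) h)))).
  have [|w hw] := chi_glue (u := u).
    by move=> i j; exact: (loc_map_compat (gai i) (gai j) (aiE i) (aiE j) (hu i) (hu j)).
  by exists w => i; rewrite hw hu.
have lg : linear g.
  move=> c x y; apply: chi_inj => i; rewrite ahP !hg; exact: loc_map_linear.
exists g; split=> // [|f|h].
- by apply: chi_inj => i; rewrite hg ah1 loc_map1.
- apply: chi_inj => i; have lgi := loc_map_linear (gai i).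
  have lci := alghom_linear (chi i); have lid := @lin_id k (T i).
  rewrite aiE gauge_loc_act // act_colinear // /transl ah_act.
  by apply: eq_act => // h; rewrite hg.
- apply: (@tmap_joint_inj k I P H (fun i => T i) chi) => // i; first exact: alghom_linear.
  rewrite -chi_coact hg (loc_map_coact (gai i)) sweedler3_conv //.
  rewrite [RHS](ah_conv (tmap_ah (chi i) (id_ah H))).
  have lci := alghom_linear (chi i); have lid := @lin_id k H.
  apply: (eq_conv (A := talg (T i) H)) => h'; last by rewrite /= tmapE // ah1.
  rewrite [RHS](ah_conv (tmap_ah (chi i) (id_ah H))).
  by apply: eq_conv => h''; rewrite /= tmapE // ?ah1 ?hg.
Qed.

(** A translation determines its map: evaluating at [phi i h] shows that [phi i] convolved with
    [chi i o u] is [phi i], and [phi i] is convolution invertible. *)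
Lemma transl_id_unit (u : H -> P) : linear u -> (forall f, transl u f = f) -> u =1 @conv_one k H P.
Proof.
move=> lu e h; apply: chi_inj => i; have lci := alghom_linear (chi i).
have lS := @antipode_linear k H; have lp := alghom_linear (phi i).
have lv : linear (fun h => chi i (u h)) by lin.
have lpS : linear (fun h => phi i (antipode h)) by lin.
have hv y : act id (fun h => chi i (u h)) y = y.
  have [f <-] := chi_surj y; rewrite -{2}(e f) /transl ah_act act_colinear //.
rewrite -(conv_cancel lpS lp lv (conv_antipodel (phi i))) ah_conv_one.
rewrite -(conv_antipodel (phi i)); apply: eq_conv => // h'.
exact: etrans (esym (act_phi h' (@lin_id k (T i)) lv)) (hv _).
Qed.

Lemma gauge_map_inv a aV g gV : gauge_corr a g -> gauge_corr aV gV -> cancel aV a ->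
  conv gV g =1 @conv_one k H P.
Proof.
move=> ca caV aVK; have [lg _ aE _] := ca; have [lgV _ aVE _] := caV.
apply: transl_id_unit => [|f]; first exact: conv_linear.
rewrite -transl_comp //; last exact: transl_coact caV.
by rewrite -aE -aVE.
Qed.

Lemma gauge_inv a aV : gauge a -> cancel a aV -> cancel aV a ->
  (forall i ai, gauge_loc ai -> (forall f, chi i (a f) = ai (chi i f)) -> bijective ai) ->
  gauge aV.
Proof.
move=> [la hloc] aK aVK bij; split; first exact: (@lin_can2 k P P a aV la aK aVK).
move=> i; have [ai [gai e]] := hloc i; have [bi aiK biK] := bij i ai gai e.
have [lai aiC aico ai1] := gai; have lbi := @lin_can2 k (T i) (T i) ai bi lai aiK biK.
have lid := @lin_id k H.
exists bi; split; last by move=> f; apply: (can_inj aiK); rewrite biK -e aVK.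
split=> // [b x Cb|x|]; first by apply: (can_inj aiK); rewrite aiC // !biK.
- rewrite -{2}(biK x) aico tmap_comp // -{1}[coact _ _]tmap_id.
  by apply: eq_tmap => // y; rewrite aiK.
- by apply: (can_inj aiK); rewrite biK ai1.
Qed.

Lemma gauge_map_pair a : gauge a -> bijective a ->
  (forall i, exists2 ai, bijective ai & forall f, chi i (a f) = ai (chi i f)) ->
  exists g, gauge_corr a g /\ exists aV gV, [/\ cancel a aV, cancel aV a,
    gauge_corr aV gV, conv g gV =1 @conv_one k H P & conv gV g =1 @conv_one k H P].
Proof.
move=> ga [aV aK aVK] bij.
have gaV : gauge aV.
  apply: gauge_inv ga aK aVK _ => i ai _ e; have [ai' bai' e'] := bij i.
  by apply: (eq_bij bai') => y; have [f <-] := chi_surj y; rewrite -e e'.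
have [g cg] := gauge_map_exists ga; have [gV cgV] := gauge_map_exists gaV.
exists g; split=> //; exists aV, gV; split=> //.
  exact: gauge_map_inv cgV cg aK.
exact: gauge_map_inv cg cgV aVK.
Qed.
End GaugeMap.

(** * The gauge map of a locally trivial bundle *)

Section RightCoaction.
Variables (k : fieldType) (H : hopf k).

(** [id_comul] is the instance where [delta] is the coproduct, so the laws below cover both
    [B (x) H] and forms with a coaction on [Gamma(H)]. *)
Definition rcoact (V M : lmodType k) (delta : M -> tens M H) (x : tens V M) :
    tens (tens V M) H := tassoc (tmap id delta x).

Section Facts.
Variables (V M : lmodType k) (delta : M -> tens M H) (ld : linear delta).

Lemma rcoact_linear : linear (rcoact (V := V) delta).
Proof. exact: lin_comp (@tassoc_linear k V M H) (tmap_linear (@lin_id k V) ld). Qed.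

Lemma rcoactE (v : V) (m : M) : rcoact delta (tpure v m) = tmap (tpure v) id (delta m).
Proof. by rewrite /rcoact tmapE // /tassoc tliftE //; split=> [y|u]; lin. Qed.
End Facts.

Lemma rcoact_nat (V V' M M' : lmodType k) (delta : M -> tens M H)
    (delta' : M' -> tens M' H) (g : V -> V') (f : M -> M') x :
  linear delta -> linear delta' -> linear g -> linear f ->
  (forall m, delta' (f m) = tmap f id (delta m)) ->
  rcoact delta' (tmap g f x) = tmap (tmap g f) id (rcoact delta x).
Proof.
move=> ld ld' lg lf e; have lid := @lin_id k H.
have lr := rcoact_linear (V := V) ld; have lr' := rcoact_linear (V := V') ld'.
have lt := tmap_linear lg lf.
move: x; apply: tens_lin_ext; [by lin|by lin|move=> v m].
have lv := (tpure_bilin V M).2 v; have lgv := (tpure_bilin V' M').2 (g v).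
rewrite tmapE // !rcoactE // e !tmap_comp //.
by apply: eq_tmap => // y; rewrite tmapE.
Qed.

Lemma rcoact_assoc (V M : lmodType k) (delta : M -> tens M H) (x : tens V M) :
  linear delta -> (forall m, tmap delta id (delta m) = id_comul (delta m)) ->
  tmap (rcoact delta) id (rcoact delta x) = id_comul (rcoact delta x).
Proof.
move=> ld e; have lid := @lin_id k H; have lr := rcoact_linear (V := V) ld.
have lc := rcoact_linear (V := tens V M) (@comul_linear k H).
have lc' := rcoact_linear (V := M) (@comul_linear k H).
move: x; apply: tens_lin_ext; [by lin|by exact: lin_comp lc lr|move=> v m].
have lv := (tpure_bilin V M).2 v; have lvv := tmap_linear lv lid.
rewrite rcoactE // tmap_comp // -[id_comul _]/(rcoact (comul H) _).
rewrite (@rcoact_nat M _ H H (comul H) (comul H) (tpure v) id) //; try exact: comul_linear.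
  rewrite -[rcoact _ _]/(id_comul _) -e tmap_comp //.
  by apply: eq_tmap => // y; rewrite rcoactE.
by move=> h; rewrite tmap_id.
Qed.

Lemma rcoact_counit (V M : lmodType k) (delta : M -> tens M H) (x : tens V M) :
  linear delta -> (forall m, slice (@counit k H) (delta m) = m) ->
  slice (@counit k H) (rcoact delta x) = x.
Proof.
move=> ld e; have lr := rcoact_linear (V := V) ld.
have lc : linear (@counit k H : H -> k^o) := linear_scalar (@counit_linear k H).
have ls := slice_linear (V := tens V M) lc.
move: x; apply: tens_lin_ext; [by lin|exact: lin_id|move=> v m].
by rewrite rcoactE // slice_tmap ?e //; exact: (tpure_bilin V M).2.
Qed.

(** * Trivial bundles as comodule algebras *)

Section FreeComodule.
Variable B : alg k.

Lemma id_comul_linear : linear (@id_comul k H B).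
Proof. exact: rcoact_linear (@comul_linear k H). Qed.
Lemma id_comulE (b : B) (h : H) : id_comul (tpure b h) = tmap (tpure b) id (comul H h).
Proof. exact: rcoactE (@comul_linear k H) b h. Qed.

Lemma tmap_tpureM (M : alg k) (b b' : B) (x y : talg M H) :
  tmap (tpure (b * b')) id (x * y) =
  (tmap (tpure b) id x : talg (talg B M) H) * (tmap (tpure b') id y : talg (talg B M) H).
Proof.
have lb c := (tpure_bilin B M).2 c; have lid := @lin_id k H.
have lm c := tmap_linear (lb c) lid.
elim/tens_ind: x => [|m h|x x' hx hx'].
- by rewrite mul0r !(lin0 (lm _)) mul0r.
- elim/tens_ind: y => [|m' h'|y y' hy hy'].
  + by rewrite mulr0 !(lin0 (lm _)) mulr0.
  + by rewrite tpureM !tmapE // tpureM tpureM.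
  + by rewrite mulrDr !(linD (lm _)) hy hy' mulrDr.
- by rewrite mulrDl !(linD (lm _)) hx hx' mulrDl.
Qed.

Lemma id_comul_monoid :
  monoid_morphism (id_comul (H := H) (V := B) : talg B H -> talg (talg B H) H).
Proof.
have lc := id_comul_linear.
split; first by rewrite tpure11 id_comulE ah1 tpure11 tmapE //; exact: (tpure_bilin B H).2.
move=> x y; elim/tens_ind: x => [|b h|x x' hx hx'].
- by rewrite mul0r !(lin0 lc) mul0r.
- elim/tens_ind: y => [|b' h'|y y' hy hy'].
  + by rewrite mulr0 !(lin0 lc) mulr0.
  + by rewrite tpureM !id_comulE ahM; exact: tmap_tpureM.
  + by rewrite mulrDr !(linD lc) hy hy' mulrDr.
- by rewrite mulrDl !(linD lc) hx hx' mulrDl.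
Qed.

Definition free_comod : comod_alg H :=
  @ComodAlg k H (talg B H)
    (@AlgHom k (talg B H) (talg (talg B H) H) (@id_comul k H B) id_comul_linear id_comul_monoid)
    (fun x => rcoact_assoc x (@comul_linear k H) (coactA (c := self_comod H)))
    (fun x => rcoact_counit x (@comul_linear k H) (@counitr k H)).

Lemma free_comod_span (N : talg B H -> Prop) : N 0 ->
  (forall (b : talg B H) (h : H), (exists c : B, b = tpure c (1 : H)) -> N (b * tinr B H h)) ->
  (forall x y, N x -> N y -> N (x + y)) -> forall x, N x.
Proof.
move=> N0 Np ND x; elim/tens_ind: x => // b h.
by have := Np _ h (ex_intro _ b erefl); rewrite tpureM mulr1 mul1r.
Qed.
End FreeComodule.
End RightCoaction.

(** * Left and right gauge maps of the bundle *)

Section Bundle.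
Variables (k : fieldType) (Q : qpfb k).
Local Notation H := (fibre_hopf Q).
Local Notation P := (total_alg Q).
Local Notation B_ i := (quo (cov_ideal i)).
Local Notation T i := (free_comod H (B_ i)).

Lemma chi_joint_inj (f f' : P) : (forall i, chi i f = chi i f') -> f = f'.
Proof.
move=> e; apply/eqP; rewrite -subr_eq0; apply/eqP; apply: (chi_complete Q).1 => i.
by rewrite /= ahB e subrr.
Qed.

Lemma chi_glue (u : cov_idx Q -> P) :
  (forall i j, exists x y, [/\ chi i x = 0, chi j y = 0 & u i - u j = x + y]) ->
  exists w, forall i, chi i w = chi i (u i).
Proof.
move=> hu; have rK i : chi i (quo_repr_of (quo_pi (ker_ideal (chi i)) (u i)) - u i) = 0.
  by apply: (quo_piP (ker_ideal (chi i)) _ _).1; rewrite quo_repr_ofK.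
have [i j|w hw] := (chi_complete Q).2 (fun i => quo_pi (ker_ideal (chi i)) (u i)).
  apply/quo_piP; have [x [y [hx hy e]]] := hu i j.
  (* The chosen representative of the class of [u i] differs from [u i] by an element of the kernel
     of [chi i]; such corrections are absorbed into [x] and [y]. *)
  exists (quo_repr_of (quo_pi (ker_ideal (chi i)) (u i)) - u i + x),
    (y - (quo_repr_of (quo_pi (ker_ideal (chi j)) (u j)) - u j)); split.
  - by rewrite /= ahD rK hx addr0.
  - by rewrite /= ahB rK hy subr0.
  - by rewrite -addrA (addrA x y) -e opprB !subrKA.
exists w => i; have /quo_piP := hw i; rewrite /= ahB => /eqP.
by rewrite subr_eq0 => /eqP.
Qed.

Lemma left_gauge_map (a : P -> P) : left_gauge a -> is_gauge_map_l a (gauge_map_l a).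
Proof.
move=> [la ba _ aloc].
(* [gauge_map_l] is a choice with default 0, so exhibiting one suitable map secures the properties
   of the chosen one. *)
suff : exists g, is_gauge_map_l a g by exact: (@xgetPex _ (fun=> 0) (is_gauge_map_l a)).
pose T' (i : cov_idx Q) := T i.
pose chi' (i : cov_idx Q) : alghom P (T' i) := chi i.
pose phi' (i : cov_idx Q) : alghom H (T' i) := tinr (B_ i) H.
pose C (i : cov_idx Q) (b : T' i) := exists c : B_ i, b = tpure c (1 : H).
have ga : gauge chi' C a.
  split=> // i; have [ai [[lai _ aiC aico ai1] e]] := aloc i; exists ai; split=> //.
  split=> // [_ x [c ->]|x|]; [exact: aiC|exact/esym/aico|exact: ai1].
apply: (@gauge_map_pair k H P _ T' chi' _ _ _ _ phi' _ C _ _ a ga ba).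
- by move=> i y; exact: chi_surj.
- by move=> i f; exact/esym/chi_coact.
- exact: chi_joint_inj.
- exact: chi_glue.
- by move=> i h; exact: id_comulE.
- move=> i _ [c ->]; rewrite [LHS]id_comulE ah1 tpure11 tmapE //.
  exact: (tpure_bilin (B_ i) H).2.
- by move=> i; exact: free_comod_span.
- by move=> i; have [ai [[_ bai _ _ _] e]] := aloc i; exists ai.
Qed.

Hypothesis S_bij : bijective (@antipode _ H).

Lemma right_gauge_map (a : P -> P) : right_gauge a -> is_gauge_map_r a (gauge_map_r a).
Proof.
move=> [la ba _ aloc].
suff : exists g, is_gauge_map_r a g by exact: (@xgetPex _ (fun=> 0) (is_gauge_map_r a)).
pose T' (i : cov_idx Q) := opcomod S_bij (T i).
pose chi' (i : cov_idx Q) : alghom (opcomod S_bij P) (T' i) := op_ah (chi i).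
pose phi' (i : cov_idx Q) : alghom (ophopf S_bij) (T' i) := op_ah (tinr (B_ i) H).
pose C (i : cov_idx Q) (b : T' i) := exists c : B_ i, b = tpure c (1 : H).
have ga : gauge chi' C a.
  split=> // i; have [ai [[lai _ aiC aico ai1] e]] := aloc i; exists ai; split=> //.
  split=> // [_ x [c ->]|x|]; [exact: aiC|exact/esym/aico|exact: ai1].
(* Over [ophopf] the antipode is [antipodeV], so [gauge_corr] unfolds to [corresponds_r].
   Convolution of [g] with [gV] there reads [gV(h2) g(h1)], so the two inversion identities trade
   places. *)
suff [g [cg [aV [gV [aK aVK cgV e1 e2]]]]] : exists g, gauge_corr (E := opcomod S_bij P) a g /\
    exists aV gV, [/\ cancel a aV, cancel aV a, gauge_corr (E := opcomod S_bij P) aV gV,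
      conv g gV =1 @conv_one k (ophopf S_bij) (opcomod S_bij P) &
      conv gV g =1 @conv_one k (ophopf S_bij) (opcomod S_bij P)].
  by exists g; split=> //; exists aV, gV; split.
apply: (@gauge_map_pair k (ophopf S_bij) (opcomod S_bij P) _ T' chi' _ _ _ _ phi' _ C _ _ a ga ba).
- by move=> i y; exact: chi_surj.
- by move=> i f; exact/esym/chi_coact.
- exact: chi_joint_inj.
- exact: chi_glue.
- by move=> i h; exact: id_comulE.
- move=> i _ [c ->]; rewrite [LHS]id_comulE ah1 tpure11 tmapE //.
  exact: (tpure_bilin (B_ i) H).2.
(* In the opposite algebra the base factor stands on the right; [c (x) 1] and [1 (x) h] commute, so
   the same elements span. *)
- move=> i N N0 Np; apply: (@free_comod_span k H (B_ i) N) => // _ h [c ->].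
  rewrite tinlr -[tpure c h]tinrl; exact: (Np (tpure c (1 : H)) h (ex_intro _ c erefl)).
- by move=> i; have [ai [[_ bai _ _ _] e]] := aloc i; exists ai.
Qed.
End Bundle.

(** * Coaction on graded tensor products *)

Section GradedCoaction.
Variables (k : fieldType) (H : hopf k).

Lemma tmap_zero (V V' W : lmodType k) (f : V -> V') (x : tens V W) :
  (forall v, f v = 0) -> tmap f id x = 0.
Proof.
move=> e; rewrite /tmap /tlift /fsum; apply: big1 => p _.
by rewrite e (lin0 ((tpure_bilin _ _).1 _)).
Qed.

Lemma tmap_hcompM (G : dga k) n (u v : talg G H) :
  tmap (@hcomp k G n) id (u * v) =
  \sum_(i < n.+1) (tmap (@hcomp k G i) id u : talg G H) * tmap (@hcomp k G (n - i)) id v.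
Proof.
have lid := @lin_id k H; have lh m := @hcomp_linear k G m.
have lt m := tmap_linear (lh m) lid.
elim/tens_ind: u => [|a h|u u' hu hu'].
- by rewrite mul0r (lin0 (lt _)) big1 // => i _; rewrite (lin0 (lt _)) mul0r.
- elim/tens_ind: v => [|b h'|v v' hv hv'].
  + by rewrite mulr0 (lin0 (lt _)) big1 // => i _; rewrite (lin0 (lt _)) mulr0.
  + rewrite tpureM tmapE // hcompM (lin_sum ((tpure_bilin _ _).1 _)).
    by apply: eq_bigr => i _; rewrite !tmapE // tpureM.
  + rewrite mulrDr (linD (lt _)) hv hv' -big_split; apply: eq_bigr => i _ /=.
    by rewrite (linD (lt _)) mulrDr.
- rewrite mulrDl (linD (lt _)) hu hu' -big_split; apply: eq_bigr => i _ /=.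
  by rewrite (linD (lt _)) mulrDl.
Qed.

Variables (A : alg k) (G : diffalg A) (delta : alghom G (talg G H)).
Hypothesis delta_in : forall a, exists c : tens A H, delta (da_in G a) = tmap (da_in G) id c.
Hypothesis delta_dif : forall w, delta (dif w) = tmap (@dif k G) id (delta w).

Let ld : linear (delta : G -> tens G H). Proof. exact (alghom_linear delta). Qed.

(** The elements on which [delta] respects every component form a subalgebra containing [A] and
    [dA], and these generate [G]. *)
Lemma delta_hcomp n w : delta (hcomp n w) = tmap (@hcomp k G n) id (delta w).
Proof.
have lid := @lin_id k H; have lh m := @hcomp_linear k G m.
have lt m := tmap_linear (lh m) lid; have li := alghom_linear (da_in G).
have ldif := @dif_linear k G.
pose S (x : G) := forall m, delta (hcomp m x) = tmap (@hcomp k G m) id (delta x).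
have S1 : S 1.
  move=> m; rewrite (hcomp_homog m (hcomp_one G)) ah1 tpure11 tmapE //.
  rewrite (hcomp_homog m (hcomp_one G)).
  by case: eqP => _; rewrite ?ah1 // ah0 (lin0 ((tpure_bilin _ _).1 _)).
have SP c x y : S x -> S y -> S (c *: x + y).
  by move=> hx hy m; rewrite (hcomp_linear m) !ahP hx hy (lt m).
have SM x y : S x -> S y -> S (x * y).
  move=> hx hy m; rewrite hcompM (lin_sum ld) ahM tmap_hcompM.
  by apply: eq_bigr => i _; rewrite ahM hx hy.
have Sin a : S (da_in G a).
  move=> m; rewrite (hcomp_homog m (da_homog G a)); have [c e] := delta_in a; rewrite e.
  rewrite tmap_comp //; case: eqP => [->|/eqP/negPf ne].
    by rewrite e; apply: eq_tmap => // b; exact/esym/da_homog.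
  rewrite ah0 tmap_zero // => b.
  by rewrite (hcomp_homog m (da_homog G b)) ne.
have Sdif a : S (dif (da_in G a)).
  case=> [|m].
    by rewrite hcomp_dif0 ah0 delta_dif tmap_comp // tmap_zero // => b; exact: hcomp_dif0.
  rewrite hcomp_difS delta_dif Sin delta_dif !tmap_comp //.
  by apply: eq_tmap => // y; rewrite hcomp_difS.
exact: (da_gen (S := Subalg S1 SP SM) Sin Sdif w n).
Qed.

Section Graded.
Variable GB : dga k.
Local Notation GT := (gtens GB G).
Implicit Types (x y : GT).

(** The sign of the graded product depends on the degree of the leg in [G]; projecting that leg to
    degree [q] fixes one sign for the whole sum. *)
Lemma gtmap_tpureM q p (w w' : GB) (u v : talg G H) : homog p w' ->
  (tmap (tpure w) id (tmap (@hcomp k G q) id u) : talg GT H) * tmap (tpure w') id v =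
  (-1) ^+ (q * p) *: tmap (tpure (w * w')) id ((tmap (@hcomp k G q) id u : talg G H) * v).
Proof.
move=> hw; have lb c := (tpure_bilin GB G).2 c; have lid := @lin_id k H.
have lm c := tmap_linear (lb c) lid; have lq := tmap_linear (@hcomp_linear k G q) lid.
have lh := @hcomp_linear k G q.
elim/tens_ind: u => [|m h|u u' hu hu'].
- by rewrite (lin0 lq) !(lin0 (lm _)) !mul0r (lin0 (lm _)) scaler0.
- elim/tens_ind: v => [|m' h'|v v' hv hv'].
  + by rewrite !(lin0 (lm _)) !mulr0 (lin0 (lm _)) scaler0.
  + rewrite !tmapE // !tpureM tmapE // -(linZ ((tpure_bilin _ _).1 _)).
    by rewrite [X in tpure X _](gtmulE _ _ (homog_hcomp q m) hw).
  + by rewrite !(linD (lm _)) !mulrDr !(linD (lm _)) hv hv' scalerDr.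
- by rewrite !(linD lq) !(linD (lm _)) !mulrDl !(linD (lm _)) hu hu' scalerDr.
Qed.

Lemma grcoact_linear : linear (rcoact delta : GT -> tens GT H).
Proof. exact: rcoact_linear. Qed.

Lemma grcoactE (w : GB) (m : G) : rcoact delta (tpure w m) = tmap (tpure w) id (delta m).
Proof. exact: rcoactE. Qed.

Lemma grcoact_monoid : monoid_morphism (rcoact delta : GT -> talg GT H).
Proof.
have lr := grcoact_linear; have lb c := (tpure_bilin GB G).2 c.
split; first by rewrite [LHS]grcoactE ah1 tpure11 tmapE.
move=> x y; elim/gt_ind: x => [|p q a b ha hb|x x' hx hx'].
- by rewrite mul0r !(lin0 lr) mul0r.
- elim/gt_ind: y => [|p' q' a' b' ha' hb'|y y' hy hy'].
  + by rewrite mulr0 !(lin0 lr) mulr0.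
  + rewrite [_ * _](gtmulE _ _ hb ha') (linZ lr) !grcoactE ahM -hb delta_hcomp.
    by rewrite (@gtmap_tpureM q p' a a' (delta b) (delta b') ha').
  + by rewrite mulrDr !(linD lr) hy hy' mulrDr.
- by rewrite mulrDl !(linD lr) hx hx' mulrDl.
Qed.

Lemma grcoact_dif x : rcoact delta (dif x) = tmap (@dif k GT) id (rcoact delta x).
Proof.
have lr := grcoact_linear; have lid := @lin_id k H; have ldif := @dif_linear k GT.
have lt := tmap_linear ldif lid; have lb c := (tpure_bilin GB G).2 c.
have ldg := @dif_linear k G.
elim/gt_ind: x => [|p q a b ha hb|x y hx hy].
- by rewrite dif0 !(lin0 lr) (lin0 lt).
- rewrite [X in rcoact _ X](gtdifE _ ha) (linD lr) (linZ lr) !grcoactE delta_dif.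
  elim/tens_ind: (delta b : tens G H) => [|m h|u v hu hv].
  + by rewrite !(lin0 (tmap_linear _ lid)) // scaler0 addr0.
  + rewrite !tmapE // [X in _ = tpure X _](gtdifE _ ha).
    by rewrite (linD ((tpure_bilin _ _).1 _)) (linZ ((tpure_bilin _ _).1 _)).
  + rewrite !(linD (tmap_linear _ lid)) //.
    by rewrite scalerDr addrACA hu hv.
- by rewrite difD !(linD lr) (linD lt) hx hy.
Qed.

Lemma grcoact_hcomp n x : rcoact delta (hcomp n x) = tmap (@hcomp k GT n) id (rcoact delta x).
Proof.
have lr := grcoact_linear; have lid := @lin_id k H; have lh := @hcomp_linear k GT n.
have lt := tmap_linear lh lid; have lb c := (tpure_bilin GB G).2 c.
elim/gt_ind: x => [|p q a b ha hb|x y hx hy].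
- by rewrite hcomp0 !(lin0 lr) (lin0 lt).
- have lhq := @hcomp_linear k G q.
  have la : linear (fun m : G => hcomp n (tpure a m : GT)) by lin.
  rewrite [X in rcoact _ X](gthcompE n ha hb) grcoactE -{2}hb delta_hcomp tmap_comp //.
  rewrite tmap_comp //; case ne: (n == (p + q)%N); last first.
    rewrite (lin0 lr) tmap_zero // => m.
    by rewrite [LHS](gthcompE n ha (homog_hcomp q m)) ne.
  rewrite grcoactE -{1}hb delta_hcomp tmap_comp //.
  by apply: eq_tmap => // m; rewrite [RHS](gthcompE n ha (homog_hcomp q m)) ne.
- by rewrite hcompD !(linD lr) (linD lt) hx hy.
Qed.
End Graded.
End GradedCoaction.

(** * Coaction on horizontal forms *)

Section Projections.
Variable k : fieldType.

Lemma prod_proj_linear (I : Type) (A : I -> alg k) i :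
  linear (fun x : prod_alg A => (x : prod_car A) i).
Proof. by []. Qed.
Lemma prod_proj_monoid (I : Type) (A : I -> alg k) i :
  monoid_morphism (fun x : prod_alg A => (x : prod_car A) i).
Proof. by []. Qed.
Definition prod_proj (I : Type) (A : I -> alg k) i : alghom (prod_alg A) (A i) :=
  AlgHom (@prod_proj_linear I A i) (@prod_proj_monoid I A i).
Definition sub_val_ah (A : alg k) (S : subalg A) : alghom (sub_alg S) A :=
  AlgHom (@sub_val_linear k A S) (@sub_val_monoid k A S).

Variables (A : alg k) (S : subalg A).
Implicit Types x y : sub_alg S.
Lemma sub_valD x y : sub_val (x + y) = sub_val x + sub_val y.
Proof. exact: ahD (sub_val_ah S) x y. Qed.
Lemma sub_valZ c x : sub_val (c *: x) = c *: sub_val x.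
Proof. exact: linZ (alghom_linear (sub_val_ah S)) c x. Qed.
Lemma sub_valM x y : sub_val (x * y) = sub_val x * sub_val y.
Proof. exact: ahM (sub_val_ah S) x y. Qed.
End Projections.

Section HorCoaction.
Variables (k : fieldType) (Q : qpfb k) (X : diffstr Q).
Local Notation H := (fibre_hopf Q).
Local Notation P := (total_alg Q).
Local Notation B_ i := (quo (cov_ideal i)).
Local Notation GB i := (dbase X i).
Local Notation GH := (dfibre X).
Local Notation GT i := (gtens (GB i) GH).

(** If [wi - wj = a + b] with [a] in [K_i] and [b] in [K_j], then [wi - a = wj + b] lies over both
    [u] and [v]. *)
Lemma compatP i j (u : GT i) (v : GT j) :
  compat u v <-> exists w : omega P, chi_omega X i w = u /\ chi_omega X j w = v.
Proof.
split=> [[wi [wj [ei ej /quo_piP[a [b [Ka Kb e]]]]]]|[w [eu ev]]]; last first.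
  by exists (quo_pi _ w), (quo_pi _ w); rewrite !chiG_pi.
exists (quo_repr_of (wi - a)); rewrite -!chiG_pi quo_repr_ofK; split.
  by rewrite ahB ei [X in _ - X]Ka subr0.
have -> : wi - a = wj + b by apply/eqP; rewrite subr_eq -addrA (addrC b) -e addrC subrK.
by rewrite ahD ej [X in _ + X]Kb addr0.
Qed.

Definition chiH_ah i : alghom (hor X) (GT i) :=
  alghom_comp (prod_proj (fun i => GT i) i)
    (alghom_comp (sub_val_ah (formsC_sub X)) (sub_val_ah (hor_sub X))).
Lemma chiH_linear i : linear (@chiH k Q X i).
Proof. exact (alghom_linear (chiH_ah i)). Qed.
Lemma chiH_monoid i : monoid_morphism (@chiH k Q X i).
Proof. exact (alghom_monoid (chiH_ah i)). Qed.

Lemma chiH_inj (g g' : hor X) : (forall i, chiH i g = chiH i g') -> g = g'.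
Proof.
move=> e; apply: sub_val_inj; apply: sub_val_inj.
exact: functional_extensionality_dep e.
Qed.

Lemma chiH_hor_in i f : chiH i (hor_in X f) = chi_in X i f.
Proof. by []. Qed.

Lemma hor_in_linear : linear (@hor_in k Q X).
Proof.
by move=> c x y; apply: chiH_inj => i; rewrite chiH_linear !chiH_hor_in ahP.
Qed.
Lemma hor_in_monoid : monoid_morphism (@hor_in k Q X).
Proof.
split=> [|x y]; apply: chiH_inj => i.
  by rewrite chiH_hor_in (chiH_monoid i).1 ah1.
by rewrite (chiH_monoid i).2 !chiH_hor_in ahM.
Qed.
Definition hor_in_ah : alghom P (hor X) := AlgHom hor_in_linear hor_in_monoid.

Section Delta.
Variable delta : alghom GH (talg GH H).
Hypotheses (dA : forall w, tmap delta id (delta w) = id_comul (delta w))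
  (dc : forall w, tlift (fun (w0 : GH) (w1 : H) => counit w1 *: w0) (delta w) = w)
  (di : forall h, delta (da_in GH h) = tmap (da_in GH) id (comul H h))
  (dd : forall w, delta (dif w) = tmap (@dif k GH) id (delta w)).

Let di' h : exists c : tens H H, delta (da_in GH h) = tmap (da_in GH) id c.
Proof. by exists (comul H h). Qed.
Let ld : linear (delta : GH -> tens GH H). Proof. exact (alghom_linear delta). Qed.
Local Notation D := (rcoact delta).
Let lD i : linear (D : GT i -> tens (GT i) H).
Proof. exact: grcoact_linear. Qed.
Let lid := @lin_id k H.

(** [delta] extends the coproduct, so on horizontal forms [D] is the local coaction [id (x) Delta].
    Coactions can then be computed without choosing preimages under [gt_hor]. *)
Lemma rcoact_gt_hor i (y : tens (GB i) H) :
  D (gt_hor GH y) = tmap (gt_hor GH : _ -> GT i) id (id_comul y).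
Proof.
apply: (@rcoact_nat k H (GB i) (GB i) H GH (comul H) delta id (da_in GH)) => //.
- exact: comul_linear.
- exact: alghom_linear.
Qed.

Lemma rcoact_chi_in i f :
  D (chi_in X i f) = tmap (chi_in X i) id (coact P f).
Proof.
have lB := alghom_linear (da_in (GB i)); have lH := alghom_linear (da_in GH).
have lc : linear (chi i : P -> tens (B_ i) H) by exact (alghom_linear (chi i)).
rewrite [LHS](@rcoact_nat k H (B_ i) (GB i) H GH (comul H) delta) //; last exact: comul_linear.
rewrite -[rcoact _ _]/(id_comul _) -chi_coact tmap_comp //.
exact: tmap_linear.
Qed.

(** By induction on the generation of [Omega(P)] from [P]: [D] is linear, multiplicative and
    commutes with [d], so each operation lifts to tensors with [H], by a single [z] for all [i]. *)
Lemma omega_coact (x : omega P) : exists z : tens (omega P) H,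
  forall i, tmap (chi_omega X i) id z = D (chi_omega X i x).
Proof.
have lc i := alghom_linear (chi_omega X i).
have lt i := tmap_linear (lc i) lid; have ldif := @dif_linear k (omega P).
have lin_in := alghom_linear (omega_in P).
elim/omega_ind: x => [f|x [z hz]|x y [z hz] [z' hz']|c x [z hz]|x y [z hz] [z' hz']].
- exists (tmap (omega_in P) id (coact P f)) => i.
  have e f' : chi_omega X i (omega_in P f') = chi_in X i f'.
    exact: (omega_lift_in (@chi_in_degree0 k Q X i)).
  by have lci := lc i; rewrite e rcoact_chi_in tmap_comp //; apply: eq_tmap.
- exists (tmap (@dif k (omega P)) id z) => i.
  have e w : chi_omega X i (dif w) = dif (chi_omega X i w).
    exact: (omega_lift_dif (@chi_in_degree0 k Q X i)).
  have ldi := @dif_linear k (GT i); have lci := lc i.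
  by rewrite e grcoact_dif // -hz !tmap_comp //; apply: eq_tmap.
- by exists (z + z') => i; rewrite ahD (linD (@lD i)) -hz -hz' (linD (lt i)).
- by exists (c *: z) => i; rewrite (linZ (lc i)) (linZ (@lD i)) -hz (linZ (lt i)).
- exists ((z : talg (omega P) H) * z') => i; rewrite ahM.
  rewrite [RHS](grcoact_monoid di' dd (GB i)).2 -hz -hz'.
  exact: (tmap_monoid (chi_omega X i) (id_ah H)).2.
Qed.

Lemma hor_slice (f : H -> k^o) (g : hor X) : linear f ->
  exists g' : hor X, forall i, chiH i g' = slice f (D (chiH i g)).
Proof.
move=> lf.
have cp : formsC_sub X (fun i => slice f (D (chiH i g))).
  (* The values of [g] on the two pieces have a common preimage [w]; slicing a lift [z] of its
     coaction gives a common preimage of the two slices. *)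
  move=> i j; apply/compatP; have /compatP[w [ei ej]] := sub_valP (sub_val g) i j.
  have [z hz] := omega_coact w; exists (slice f z).
  have lc i' := alghom_linear (chi_omega X i').
  by rewrite -(slice_tmap z (lc i) lf) -(slice_tmap z (lc j) lf) !hz ei ej.
have hp : hor_sub X (sub_mk cp).
  move=> i; have [y e] := sub_valP g i; exists (slice f (id_comul y)).
  rewrite -(slice_tmap (id_comul y) (@gt_hor_linear k _ _ (GB i) GH) lf).
  by rewrite -rcoact_gt_hor -e.
by exists (sub_mk hp).
Qed.

(** Decomposing all the local coactions along one list of functionals leaves families of slices,
    each of which is the family of a single horizontal form. *)
Lemma hor_coact_exists (g : hor X) :
  exists t : tens (hor X) H, forall i, tmap (@chiH k Q X i) id t = D (chiH i g).
Proof.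
have [L hL] := slice_decomp_dep (fun i => D (chiH i g)).
have /choice[s hs] (p : {f : H -> k^o | linear f} * H) : exists g' : hor X,
    forall i, chiH i g' = slice (sval p.1) (D (chiH i g)).
  by apply: hor_slice; exact: svalP p.1.
exists (\sum_(p <- L) tpure (s p) p.2) => i.
rewrite (lin_sum (tmap_linear (@chiH_linear i) lid)) (hL i).
by apply: eq_bigr => p _; rewrite (tmapE _ _ (@chiH_linear i) lid) hs.
Qed.

Lemma is_hor_coactP (g : hor X) t :
  is_hor_coact g t <-> forall i, tmap (@chiH k Q X i) id t = D (chiH i g).
Proof.
split=> [h i|h i y e]; last by rewrite h e rcoact_gt_hor.
by have [y e] := sub_valP g i; rewrite (h i y e) -rcoact_gt_hor -e.
Qed.

Lemma hor_coactE i (g : hor X) : tmap (@chiH k Q X i) id (hor_coact g) = D (chiH i g).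
Proof.
apply/is_hor_coactP: i.
have [t /is_hor_coactP ht] := hor_coact_exists g.
exact: (@xgetPex _ 0 (is_hor_coact g) (ex_intro _ t ht)).
Qed.

Lemma hor_tens_inj (V : lmodType k) (s t : tens (hor X) V) :
  (forall i, tmap (@chiH k Q X i) id s = tmap (@chiH k Q X i) id t) -> s = t.
Proof. by apply: tmap_joint_inj; [exact: chiH_linear|exact: chiH_inj]. Qed.

Lemma hor_coact_linear : linear (@hor_coact k Q X).
Proof.
move=> c x y; apply: hor_tens_inj => i.
rewrite hor_coactE chiH_linear (@lD i) (tmap_linear (@chiH_linear i) lid).
by rewrite !hor_coactE.
Qed.
Lemma hor_coact_monoid :
  monoid_morphism (@hor_coact k Q X : hor X -> talg (hor X) H).
Proof.
have m i := tmap_monoid (chiH_ah i) (id_ah H).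
split=> [|x y]; apply: hor_tens_inj => i; rewrite hor_coactE.
  by rewrite [RHS](m i).1 (chiH_monoid i).1; exact: (grcoact_monoid di' dd (GB i)).1.
rewrite [RHS](m i).2 (chiH_monoid i).2 [LHS](grcoact_monoid di' dd (GB i)).2.
by rewrite /= !hor_coactE.
Qed.

Lemma hor_coactA (g : hor X) :
  tmap (@hor_coact k Q X) id (hor_coact g) = id_comul (hor_coact g).
Proof.
apply: (@tmap_joint_inj k _ _ _ (fun i => tens (GT i) H) (fun i => tmap (@chiH k Q X i) id)).
- by move=> i; exact: (tmap_linear (@chiH_linear i) lid).
- exact: hor_tens_inj.
move=> i; have lt := tmap_linear (@chiH_linear i) lid.
have lcm := @comul_linear k H.
rewrite (tmap_comp _ hor_coact_linear lt lid lid).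
rewrite (eq_tmap _ (hor_coactE i) (fun _ => erefl)).
rewrite -(tmap_comp _ (@chiH_linear i) (@lD i) lid lid) hor_coactE.
rewrite rcoact_assoc // -hor_coactE.
exact: (rcoact_nat _ lcm lcm (@chiH_linear i) lid (fun h => esym (tmap_id _))).
Qed.

Lemma hor_coact_counit (g : hor X) :
  tlift (fun (g0 : hor X) (g1 : H) => counit g1 *: g0) (hor_coact g) = g.
Proof.
have lc := linear_scalar (@counit_linear k H).
apply: chiH_inj => i; rewrite -[tlift _ _]/(slice (@counit k H) _).
by rewrite -(slice_tmap _ (@chiH_linear i) lc) hor_coactE rcoact_counit.
Qed.

Definition hor_comod_of : comod_alg H :=
  @ComodAlg k H (hor X)
    (@AlgHom k (hor X) (talg (hor X) H) (@hor_coact k Q X) hor_coact_linear hor_coact_monoid)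
    hor_coactA hor_coact_counit.

Lemma hor_coact_in_of f : hor_coact (hor_in X f) = tmap (@hor_in k Q X) id (coact P f).
Proof.
apply: hor_tens_inj => i; rewrite hor_coactE chiH_hor_in rcoact_chi_in.
by rewrite (tmap_comp _ hor_in_linear (@chiH_linear i) lid lid).
Qed.

Lemma hor_coact_formsM_of (g : hor X) : formsM (sub_val g) -> hor_coact g = tpure g (1 : H).
Proof.
move=> gM; apply: hor_tens_inj => i; rewrite hor_coactE (tmapE _ _ (@chiH_linear i) lid).
have [w e] := gM i; rewrite -[chiH i g]/(chiC i (sub_val g)) e.
by rewrite [LHS]grcoactE ah1 tpure11 tmapE //; exact: (tpure_bilin _ _).2.
Qed.

Lemma slice_hor_coact_chiH_of (f : H -> k^o) (g : hor X) i : linear f ->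
  chiH i (slice f (hor_coact g)) = slice f (D (chiH i g)).
Proof. by move=> lf; rewrite -(slice_tmap _ (@chiH_linear i) lf) hor_coactE. Qed.

Lemma slice_hor_coact_ker_of (f : H -> k^o) (g : hor X) i : linear f ->
  chiH i g = 0 -> chiH i (slice f (hor_coact g)) = 0.
Proof.
by move=> lf e; rewrite slice_hor_coact_chiH_of // e (lin0 (@lD i)) (lin0 (slice_linear lf)).
Qed.

Lemma slice_hor_coact_deg_of (f : H -> k^o) (g : hor X) n : linear f ->
  degC n (sub_val g) -> degC n (sub_val (slice f (hor_coact g))).
Proof.
move=> lf hg i; rewrite -[chiC _ _]/(chiH i (slice f (hor_coact g))) slice_hor_coact_chiH_of //.
rewrite /homog -(slice_tmap _ (@hcomp_linear k (GT i) n) lf).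
by rewrite -grcoact_hcomp //; congr (slice f (D _)); exact: hg.
Qed.
End Delta.
End HorCoaction.

(** * Conjugation of covariant derivatives *)

(** Covariance of [g] is an identity of convolution products, and [j (x) id] carries it to the one
    for [j o g]. With [j] the inclusion of [P] into the horizontal forms this yields the action on
    forms. *)
Lemma gauge_corr_ah (k : fieldType) (H : hopf k) (P E : comod_alg H) (j : alghom P E)
    (a : P -> P) (g : H -> P) :
  (forall f, coact E (j f) = tmap j id (coact P f)) -> gauge_corr a g ->
  gauge_corr (transl (fun h => j (g h))) (fun h => j (g h)).
Proof.
move=> ej [lg g1 _ gco]; have lj := alghom_linear j; have lid := @lin_id k H.
have ljg : linear (fun h => j (g h)) by lin.
split=> // [|h]; first by rewrite g1 ah1.
rewrite ej gco !sweedler3_conv // [LHS](ah_conv (tmap_ah j (id_ah H))).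
apply: (eq_conv (A := talg E H)) => h'; last by rewrite /= tmapE // ah1.
rewrite [LHS](ah_conv (tmap_ah j (id_ah H))).
by apply: (eq_conv (A := talg E H)) => h''; rewrite /= tmapE // ah1.
Qed.

Lemma transl_op_coinv (k : fieldType) (H : hopf k) (S_bij : bijective (@antipode k H))
    (E : comod_alg H) (g : ophopf S_bij -> opcomod S_bij E) (b x : E) :
  linear g -> coact E b = tpure b (1 : H) ->
  transl (E := opcomod S_bij E) g (x * b) = (transl (E := opcomod S_bij E) g x : E) * b.
Proof.
move=> lg e; change (transl (E := opcomod S_bij E) g ((b : opcomod S_bij E) * x) =
  (b : opcomod S_bij E) * transl (E := opcomod S_bij E) g x).
exact: transl_coinv.
Qed.

Lemma dif_one (k : fieldType) (G : dga k) : dif (1 : G) = 0.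
Proof.
have := dif_mul (1 : G) (hcomp_one G); rewrite mulr1 mulr1 mul1r expr0 scale1r.
by move=> /eqP; rewrite -subr_eq subrr eq_sym => /eqP.
Qed.

Lemma gtdif_tpure1 (k : fieldType) (G K : dga k) (w : G) :
  dif (tpure w (1 : K) : gtens G K) = tpure (dif w) (1 : K).
Proof.
have l1 := (tpure_bilin G K).1 1.
elim/homog_ind: w => [|p w hw|v w hv hw].
- by rewrite dif0 (lin0 l1) dif0.
- by rewrite [LHS](gtdifE _ hw) dif_one (lin0 ((tpure_bilin G K).2 w)) scaler0 addr0.
- by rewrite (linD l1) [LHS](@difD k (gtens G K)) hv hw difD (linD l1).
Qed.

Section Conjugation.
Variables (k : fieldType) (Q : qpfb k) (X : diffstr Q).
Local Notation H := (fibre_hopf Q).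
Local Notation P := (total_alg Q).
Local Notation GH := (dfibre X).
Local Notation E := (hor X).
Implicit Types (A D : E -> E).

(** The properties by which conjugation transfers [is_covder] clause by clause; the Leibniz rule is
    treated separately. *)
Definition hor_auto A : Prop :=
  [/\ linear A, A 1 = 1, forall g, hor_coact (A g) = tmap A id (hor_coact g),
      forall n g, degC n (sub_val g) -> degC n (sub_val (A g)) &
      forall i g, chiH i g = 0 -> chiH i (A g) = 0].

Lemma covder_conj A A' D : hor_auto A -> hor_auto A' -> is_covder D ->
  is_covder (A \o D \o A').
Proof.
move=> [lA A1 Aco Adeg Aker] [lA' A'1 A'co A'deg A'ker] [lD Ddeg D1 Dco Dker].
have lDA' := lin_comp lD lA'; have lid := @lin_id k H.
split=> [|n g hg||g|i g hg] /=.
- exact: lin_comp lA lDA'.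
- by apply: Adeg; apply: Ddeg; apply: A'deg.
- by rewrite A'1 D1 (lin0 lA).
- rewrite Aco Dco A'co (tmap_comp _ lA' lD lid lid).
  by rewrite (tmap_comp _ lDA' lA lid lid).
- by apply: Aker; apply: Dker; apply: A'ker.
Qed.

(** The Leibniz rule involves [difC], whose values lie in [Gamma_c(P)]. On [Gamma_m(B)] they are
    again in [Gamma_m(B)], hence horizontal, so the rule can be read inside [hor]. *)
Lemma formsM_dif (rho : E) : formsM (sub_val rho) ->
  exists2 r : E, sub_val r = difC (sub_val rho) & formsM (sub_val r).
Proof.
move=> rM; have dM : formsM (difC (sub_val rho)).
  move=> i; have [w e] := rM i; exists (dif w).
  by rewrite -gtdif_tpure1 -e.
have dh : hor_sub X (difC (sub_val rho)).
  move=> i; have [w e] := dM i; exists (tpure w (1 : H)).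
  by rewrite e gt_horE ah1.
by exists (sub_mk dh).
Qed.

Lemma degC_mulr n (x : E) (f : P) :
  degC n (sub_val x) -> degC n (sub_val (x * hor_in X f)).
Proof.
move=> hx i; rewrite /homog -[chiC _ _]/(chiH i (x * hor_in X f)).
rewrite (@chiH_monoid k Q X i).2.
by have := hcomp_mul (hx i) (chi_in_degree0 X i f); rewrite addn0.
Qed.
Lemma degC_mull n (x : E) (f : P) :
  degC n (sub_val x) -> degC n (sub_val (hor_in X f * x)).
Proof.
move=> hx i; rewrite /homog -[chiC _ _]/(chiH i (hor_in X f * x)).
rewrite (@chiH_monoid k Q X i).2.
by have := hcomp_mul (chi_in_degree0 X i f) (hx i); rewrite add0n.
Qed.
Lemma degCD n (x y : E) :
  degC n (sub_val x) -> degC n (sub_val y) -> degC n (sub_val (x + y)).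
Proof.
move=> hx hy i; rewrite /homog -[chiC i (sub_val _)]/(chiH i (x + y)).
by rewrite (linD (@chiH_linear k Q X i)) hcompD (hx i : hcomp n (chiH i x) = _) (hy i : hcomp n (chiH i y) = _).
Qed.
Lemma degC0 n : degC n (sub_val (0 : E)).
Proof.
move=> i; rewrite /homog -[chiC i (sub_val _)]/(chiH i 0).
by rewrite (lin0 (@chiH_linear k Q X i)) hcomp0.
Qed.

Section Delta.
Variable delta : alghom GH (talg GH H).
Hypotheses (dA : forall w, tmap delta id (delta w) = id_comul (delta w))
  (dc : forall w, tlift (fun (w0 : GH) (w1 : H) => counit w1 *: w0) (delta w) = w)
  (di : forall h, delta (da_in GH h) = tmap (da_in GH) id (comul H h))
  (dd : forall w, delta (dif w) = tmap (@dif k GH) id (delta w)).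
Let CE : comod_alg H := hor_comod_of dA dc di dd.
Let jn : alghom P CE := hor_in_ah X.
Let jco (f : P) : coact CE (jn f) = tmap jn id (coact P f) := hor_coact_in_of di dd f.

Lemma transl_hor_auto a g : gauge_corr (E := P) a g ->
  hor_auto (transl (E := CE) (fun h => jn (g h))).
Proof.
move=> cg; have cj := gauge_corr_ah jco cg; have [lj j1 _ _] := cj.
split.
- exact (@transl_linear k H CE _ lj).
- exact (@transl1 k H CE _ lj j1).
- exact (transl_coact cj).
- move=> n; apply: (@transl_slices k H CE (fun x => degC n (sub_val (x : E))) _ lj).
  + by move=> x y; exact: degCD.
  + exact: degC0.
  + by move=> x h; exact: degC_mulr.
  + by move=> f x lf; exact: (slice_hor_coact_deg_of di dd).
- move=> i; apply: (@transl_slices k H CE (fun x => chiH i (x : E) = 0) _ lj).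
  + by move=> x y hx hy; rewrite (linD (@chiH_linear k Q X i)) hx hy addr0.
  + exact: (lin0 (@chiH_linear k Q X i)).
  + by move=> x h hx; rewrite (@chiH_monoid k Q X i).2 hx mul0r.
  + by move=> f x lf; exact: (slice_hor_coact_ker_of di dd).
Qed.

Lemma left_covder_conj_of (a : P -> P) D : left_gauge a -> left_covder D ->
  left_covder (act_l a \o D \o 'pinv_(fun=> 0) setT (act_l a)).
Proof.
move=> /left_gauge_map; set g := gauge_map_l a; move=> [cg [aV [gV [_ _ cgV e1 e2]]]].
move=> [covD leibD].
have [lg _ _ _] := cg; have [lgV _ _ _] := cgV.
(* [A] is convertible to [act_l a], and [A'] is translation by the map of the inverse gauge
   transformation; the inversion identities make them mutually inverse. *)
pose A : E -> E := transl (E := CE) (fun h => jn (g h)).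
pose A' : E -> E := transl (E := CE) (fun h => jn (gV h)).
have cj := gauge_corr_ah jco cg; have cjV := gauge_corr_ah jco cgV.
have [ljg _ _ _] := cj; have [ljV _ _ _] := cjV.
have hE (u v : H -> P) : conv u v =1 @conv_one k H P ->
    conv (fun h => jn (u h)) (fun h => jn (v h)) =1 @conv_one k H CE.
  by move=> e h; rewrite -ah_conv e ah_conv_one.
have AK : cancel A A' by exact: transl_cancel cjV cj (hE _ _ e1).
have AVK : cancel A' A by exact: transl_cancel cj cjV (hE _ _ e2).
have -> : 'pinv_(fun=> 0) setT (act_l a) = A'.
  apply/funext => x; apply: (can_inj AK); rewrite AVK.
  by apply: (pinv_cancel (fun=> 0) (f := A) _).2; exists A'.
have hA : hor_auto A := transl_hor_auto cg.
have hA' : hor_auto A' := transl_hor_auto cgV.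
have lA : linear A by case: hA.
split=> [|n rho x rM rn]; first exact: covder_conj hA hA' covD.
have [r er rM'] := formsM_dif rM.
have coM y : formsM (sub_val y) -> coact CE y = tpure y (1 : H).
  exact: (hor_coact_formsM_of di dd).
rewrite -er -!sub_valM -sub_valZ -sub_valD; congr sub_val.
rewrite /comp -![act_l a _]/(A _).
(* Both [rho] and its differential [r] are coinvariant, so [A'] and [A] let them pass and only [D]
   in the middle produces the differential term. *)
have -> : A' (rho * x) = rho * A' x by exact (@transl_coinv k H CE _ rho x ljV (coM _ rM)).
have -> : D (rho * A' x) = r * A' x + (-1) ^+ n *: (rho * D (A' x)).
  by apply: sub_val_inj; rewrite sub_valD sub_valZ !sub_valM (leibD n rho _ rM rn) -er.
rewrite (linD lA) (linZ lA) [A (r * _)](@transl_coinv k H CE _ r (A' x) ljg (coM _ rM')).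
by rewrite [A (rho * _)](@transl_coinv k H CE _ rho (D (A' x)) ljg (coM _ rM)) -/A AVK.
Qed.

Hypothesis S_bij : bijective (@antipode _ H).
Let CEop := opcomod S_bij CE.
Let Pop := opcomod S_bij P.
Let jop : alghom Pop CEop := op_ah (hor_in_ah X).
Let jop_co (f : Pop) : coact CEop (jop f) = tmap jop id (coact Pop f) := jco f.

Lemma transl_op_hor_auto a g : gauge_corr (E := Pop) a g ->
  hor_auto (transl (E := CEop) (fun h => jop (g h))).
Proof.
move=> cg; have cj := gauge_corr_ah jop_co cg; have [lj j1 _ _] := cj.
split.
- exact (@transl_linear k _ CEop _ lj).
- exact (@transl1 k _ CEop _ lj j1).
- exact (transl_coact cj).
- move=> n; apply: (@transl_slices k _ CEop (fun x => degC n (sub_val (x : E))) _ lj).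
  + by move=> x y; exact: degCD.
  + exact: degC0.
  + by move=> x h; exact: degC_mull.
  + by move=> f x lf; exact: (slice_hor_coact_deg_of di dd).
- move=> i; apply: (@transl_slices k _ CEop (fun x => chiH i (x : E) = 0) _ lj).
  + by move=> x y hx hy; rewrite (linD (@chiH_linear k Q X i)) hx hy addr0.
  + exact: (lin0 (@chiH_linear k Q X i)).
  + move=> x h hx; change (chiH i (hor_in X (g h) * (x : E)) = 0).
    by rewrite (@chiH_monoid k Q X i).2 hx mulr0.
  + by move=> f x lf; exact: (slice_hor_coact_ker_of di dd).
Qed.

Lemma right_covder_conj_of (a : P -> P) D : right_gauge a -> right_covder D ->
  right_covder (act_r a \o D \o 'pinv_(fun=> 0) setT (act_r a)).
Proof.
move=> /(right_gauge_map S_bij); set g := gauge_map_r a.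
move=> [cg [aV [gV [_ _ cgV e2 e1]]]] [covD leibD].
pose A : E -> E := transl (E := CEop) (fun h => jop (g h)).
pose A' : E -> E := transl (E := CEop) (fun h => jop (gV h)).
have cj := gauge_corr_ah jop_co cg; have cjV := gauge_corr_ah jop_co cgV.
have [ljg _ _ _] := cj; have [ljV _ _ _] := cjV.
have hE (u v : ophopf S_bij -> Pop) : conv u v =1 @conv_one k _ Pop ->
    conv (fun h => jop (u h)) (fun h => jop (v h)) =1 @conv_one k _ CEop.
  by move=> e h; rewrite -ah_conv e ah_conv_one.
have AK : cancel A A' by exact: transl_cancel cjV cj (hE _ _ e1).
have AVK : cancel A' A by exact: transl_cancel cj cjV (hE _ _ e2).
have -> : 'pinv_(fun=> 0) setT (act_r a) = A'.
  apply/funext => x; apply: (can_inj AK); rewrite AVK.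
  by apply: (pinv_cancel (fun=> 0) (f := A) _).2; exists A'.
have hA : hor_auto A := transl_op_hor_auto cg.
have hA' : hor_auto A' := transl_op_hor_auto cgV.
have lA : linear A by case: hA.
split=> [|n rho x rM xn]; first exact: covder_conj hA hA' covD.
have [r er rM'] := formsM_dif rM.
have coM y : formsM (sub_val y) -> coact CEop y = tpure y (1 : ophopf S_bij).
  exact: (hor_coact_formsM_of di dd).
(* The sign of the right Leibniz rule is governed by the degree of the form that [D] meets, here
   [A' x]. *)
have xn' : degC n (sub_val (A' x)) by case: hA' => _ _ _ + _; apply.
rewrite -er -!sub_valM -sub_valZ -sub_valD; congr sub_val.
rewrite /comp -![act_r a _]/(A _).
have -> : A' (x * rho) = A' x * rho.
  by exact (@transl_op_coinv k H S_bij CE _ rho x ljV (coM _ rM)).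
have -> : D (A' x * rho) = D (A' x) * rho + (-1) ^+ n *: (A' x * r).
  by apply: sub_val_inj; rewrite sub_valD sub_valZ !sub_valM (leibD n rho _ rM xn') -er.
rewrite (linD lA) (linZ lA) [A (A' x * r)](@transl_op_coinv k H S_bij CE _ r (A' x) ljg (coM _ rM')).
rewrite [A (D _ * rho)](@transl_op_coinv k H S_bij CE _ rho (D (A' x)) ljg (coM _ rM)) -/A AVK.
by [].
Qed.
End Delta.
End Conjugation.

Theorem proposition12 (R : realType) (Q : qpfb R[i])
    (S_bij : bijective (@antipode _ (fibre_hopf Q))) (X : diffstr Q) :
  (forall (D : hor X -> hor X) (a : total_alg Q -> total_alg Q),
     left_covder D -> left_gauge a ->
     left_covder (act_l a \o D \o 'pinv_(fun=> 0) setT (act_l a))) /\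
  (forall (D : hor X -> hor X) (a : total_alg Q -> total_alg Q),
     right_covder D -> right_gauge a ->
     right_covder (act_r a \o D \o 'pinv_(fun=> 0) setT (act_r a))).
Proof.
(* Right covariance provides the coaction of [H] on [Gamma(H)] from which the coaction on horizontal
   forms gets its existence and its laws. *)
have [delta [dA dc di dd]] := dfibre_cov X.
split=> D a covD ga.
  exact: (left_covder_conj_of dA dc di dd ga covD).
exact: (right_covder_conj_of dA dc di dd S_bij ga covD).
Qed.
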